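(* Let $\psi \in \mathcal{S}(\mathbb{R})$ be a Schwartz function with $\widehat{\psi}(0) = 0$, and for each $k \in \mathbb{N}$ define $\psi_k := 2^k \psi(2^k \cdot)$, so that $\widehat{\psi_k} = \widehat{\psi}(2^{-k}\cdot)$. Let $p \in (1,\infty)$. Then there is a constant $C$, independent of $f$, such that for all $f \in S^p$, $$\Big\| \Big( \sum_{k \in \mathbb{N}} |f * \psi_k|^2 \Big)^{1/2} \Big\|_{S^p} \le C \, \|f\|_{S^p}.$$
   Context: $\mathbb{N} = \{1,2,3,\dots\}$. For $p \in [1,\infty)$ and a measurable function $f$ on $\mathbb{R}$, the Stepanov norm is $$\|f\|_{S^p} := \Big( \sup_{x \in \mathbb{R}} \int_x^{x+1} |f(s)|^p \, ds \Big)^{1/p},$$ and the Stepanov space $S^p$ is the completion, with respect to this norm, of the space of trigonometric polynomials on $\mathbb{R}$, i.e. finite sums $\sum_{n=-N}^{N} c_n e^{i\lambda_n \cdot}$ with $c_n \in \mathbb{C}$, $\lambda_n \in \mathbb{R}$ (a space of functions in $L^p_{\mathrm{loc}}(\mathbb{R})$, identified up to a.e. equality). The Fourier transform on $\mathbb{R}$ is $\widehat{\psi}(\xi) = \int_{\mathbb{R}} \psi(x) e^{-ix\xi} \, dx$, and $*$ denotes convolution on the line, $f * \psi = \int_{\mathbb{R}} f(\cdot - y) \psi(y) \, dy$. *)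

(* Defs.v *)
From HB Require Import structures.
From mathcomp Require Import all_boot all_order all_algebra.
From mathcomp Require Import complex.
From mathcomp Require Import all_classical all_reals all_analysis.

Set Implicit Arguments.
Unset Strict Implicit.
Unset Printing Implicit Defensive.

Import Order.TTheory GRing.Theory Num.Theory.
Import ComplexField.Normc.
Import numFieldNormedType.Exports.

Local Open Scope classical_set_scope.
Local Open Scope complex_scope.
Local Open Scope ring_scope.

Section Stepanov.
Variable R : realType.
Local Notation mu := (@lebesgue_measure R).

Implicit Types (f psi : R -> R[i]) (p : R).

Definition cexpi (t : R) : R[i] := cos t +i* sin t.

Definition cmeasurable f : Prop :=
  measurable_fun [set: R] (fun x => complex.Re (f x)) /\
  measurable_fun [set: R] (fun x => complex.Im (f x)).

Definition cintegral f : R[i] :=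
  (\int[mu]_x complex.Re (f x)) +i* (\int[mu]_x complex.Im (f x)).

Definition fourier psi (xi : R) : R[i] :=
  cintegral (fun x => psi x * cexpi (- (x * xi))).

Definition convolution f psi (x : R) : R[i] :=
  cintegral (fun y => f (x - y) * psi y).

Definition cderiven (n : nat) psi (x : R) : R[i] :=
  (derive1n n (fun y => complex.Re (psi y)) x)
    +i* (derive1n n (fun y => complex.Im (psi y)) x).

Definition csmooth psi : Prop := forall (n : nat) (x : R),
  derivable (derive1n n (fun y => complex.Re (psi y))) x 1 /\
  derivable (derive1n n (fun y => complex.Im (psi y))) x 1.

Definition schwartz psi : Prop := csmooth psi /\
  forall m n : nat, exists C : R,
    forall x : R, `|x| ^+ m * normc (cderiven n psi x) <= C.

(* The argument is extended-real valued because the square function below may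
   a priori be infinite at some points; for a complex function [f], take
   [g := cmod f]. *)
Definition stepanov_norm p (g : R -> \bar R) : \bar R :=
  ((ereal_sup [set \int[mu]_(s in `[x, (x + 1)%R]) (`|g s| `^ p)
               | x in [set: R]])
     `^ (p^-1)%R)%E.

Definition cmod f (x : R) : \bar R := (normc (f x))%:E.

Definition trig_polynomial f : Prop :=
  exists (n : nat) (c : 'I_n -> R[i]) (lambda : 'I_n -> R),
    forall x, f x = \sum_(j < n) c j * cexpi (lambda j * x).

(* The completion of the trigonometric polynomials, realized as their closure
   among measurable functions: the space of measurable functions of finite
   Stepanov norm, modulo a.e. equality, is complete.  Classes are represented
   by Borel functions. *)
Definition stepanov_space p f : Prop := cmeasurable f /\
  forall eps : R, 0 < eps ->
    exists2 P : R -> R[i], trig_polynomial P &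
      (stepanov_norm p (cmod (fun x => f x - P x)%R) < eps%:E)%E.

Definition dyadic_dilation psi (k : nat) (x : R) : R[i] :=
  (2 ^+ k)%:C * psi (2 ^+ k * x).

Definition square_function psi f (x : R) : \bar R :=
  ((\sum_(1 <= k <oo)
      cmod (convolution f (dyadic_dilation psi k)) x ^+ 2) `^ (2^-1)%R)%E.

End Stepanov.

(* Main.v *)
(** It suffices to treat a real kernel [psi] of mean zero and [f >= 0], using only
    a bound [M] for the integrals of [f^p] over unit intervals.  Let [u_j x] be the
    mean of [f] over [[x - 2^-j, x]], so that [u_j x] is the average of [u_(j+1)] at
    [x] and [x - 2^-(j+1)], and let [d_j x] be half the difference of these values.
    Decay, smoothness and cancellation of [psi] give, with [A_r] the mean over the
    ball of radius [r],
      [ |f * psi_(k+1)| <= C sum_(m,i) 2^-m 2^(-4i) A_(2^(i+1-k)) |d_(k+m)| ],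
    so it is enough to bound the square functions [sum_k A_(2^(i-k)) (d_(k+m)^2)]
    locally, with a loss in [m] and [i] that is beaten by the geometric factors.
    For [1 < p <= 2], strong convexity of [t^p] gives
      [ c d_j^2 u_j^(p-2) + u_j^p <= mean of u_(j+1)^p at x and x - 2^-(j+1) ];
    integrating and telescoping bounds [sum_j d_j^2 u_j^(p-2)] in L^1, and Hoelder's
    inequality together with the maximal theorem concludes.  For [p > 2] one
    dualizes with [v] in [L^((p/2)')], and applies the case of exponent 2 with the
    maximal function of [v] as a weight. *)

Require Import Defs.
From HB Require Import structures.
From mathcomp Require Import all_boot all_order all_algebra.
From mathcomp Require Import complex.
From mathcomp Require Import all_classical all_reals all_analysis measurable_realfun.
From mathcomp Require Import ring lra.

Set Implicit Arguments.
Unset Strict Implicit.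
Unset Printing Implicit Defensive.

Import Order.TTheory GRing.Theory Num.Theory.
Import numFieldNormedType.Exports.

Local Open Scope classical_set_scope.
Local Open Scope ring_scope.

(** The Stepanov norm sees a function only on unit intervals, so every estimate is local: as $k \ge
    0$, a ball of radius $2^{i-k}$ meets $O(2^i)$ unit intervals, and the tails of the kernel pay
    for that factor. The averages use sliding windows instead of a dyadic grid, hence commute with
    translation and convolution; the price is that the domain drifts to the left while telescoping,
    by at most 1 in all since the steps are $2^{-(j+1)}$. Nonnegativity of [f] gives sense to
    $u_j^{p-2}$ and lets a maximal function dominate $u_j$. For $p \le 2$ this domination costs
    $2^{m(2-p)}$ before the power $p/2$ is taken, while the kernel gains $2^{-m}$; the net exponent
    of $2^m$ is $-p(p-1)/2$, negative because $p > 1$. In the telescoping of the convolution, each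
    level has to show a difference of averages of [f] and also the smoothness of the kernel;
    averaging twice makes room for both. For $p > 2$ the dual test function is a power of the square
    function itself, so the sum over scales stays finite until a finite integral has been
    absorbed. *)

Lemma eq_ler d (T : porderType d) (x y : T) : x = y -> (x <= y)%O.
Proof. by move=> ->. Qed.

(** * A convexity gap *)

Section PowerGap.
Variable R : realType.
Implicit Types a b t p q : R.

(** Bernoulli's inequality, obtained as Young's inequality for $t^q \cdot 1$ with the exponents
    $1/q$ and $1/(1-q)$. *)
Lemma powR_le_affine t q : 0 <= t -> 0 < q <= 1 -> t `^ q <= 1 + q * (t - 1).
Proof.
move=> t0 /andP[q0]; rewrite le_eqVlt => /orP[/eqP->|q1].
  by rewrite powRr1//; lra.
have q1' : 0 < 1 - q by rewrite subr_gt0.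
have := @conjugate_powR _ (t `^ q) 1 q^-1 (1 - q)^-1 (powR_ge0 _ _) ler01.
rewrite !invr_gt0 !invrK q0 q1' => /(_ isT isT).
rewrite subrKC mulr1 -powRrM mulfV ?gt_eqF// powRr1// powR1 => /(_ erefl).
by lra.
Qed.

(** Bernoulli's inequality at $1/t$ bounds $t^{1+q}$ from below by $t^2 / (t - q(t-1))$, and
    comparing this with the quadratic polynomial is algebra. The range $t \le 2$ fits the later use
    at $1 \pm s$ with $|s| \le 1$. *)
Lemma powR_strong_convex t q : 0 <= t <= 2 -> 0 < q <= 1 ->
  1 + (1 + q) * (t - 1) + q ^+ 2 / 2 * (t - 1) ^+ 2 <= t `^ (1 + q).
Proof.
move=> /andP[]; rewrite le_eqVlt => /orP[/eqP<- _ /andP[q0 q1]|t0 t2 qh].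
  by apply: le_trans (powR_ge0 _ _); nra.
have /andP[q0 q1] := qh.
have -> : t `^ (1 + q) = t * t `^ q.
  by rewrite powRD ?powRr1// ?ltW// (gt_eqF t0) implybT.
have := @powR_le_affine t^-1 q; rewrite invr_ge0 (ltW t0) qh => /(_ isT isT).
have tq : 0 < t `^ q by exact: powR_gt0.
have -> : (t^-1) `^ q = (t `^ q)^-1 by rewrite -[in LHS]powR_inv1 ?ltW// -powRrM mulN1r powRN.
set y := t `^ q in tq *.
rewrite -(ler_pM2l (mulr_gt0 t0 tq)).
have -> : t * y * y^-1 = t by rewrite mulfK ?gt_eqF.
have -> : t * y * (1 + q * (t^-1 - 1)) = y * (t - q * (t - 1)).
  by field; rewrite gt_eqF.
move=> h.
have d0 : 0 < t - q * (t - 1) by nra.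
rewrite -(ler_pM2r d0).
apply: (@le_trans _ _ (t * t)); last by nra.
rewrite -subr_ge0.
(* The gap factors; its last factor is nonnegative because $(1-q)(t-1) \le 1$. *)
have -> : t * t - (1 + (1 + q) * (t - 1) + q ^+ 2 / 2 * (t - 1) ^+ 2) * (t - q * (t - 1))
  = (t - 1) ^+ 2 * q ^+ 2 * (1 - (1 + (1 - q) * (t - 1)) / 2) by field.
apply: mulr_ge0; first by rewrite mulr_ge0// sqr_ge0.
by nra.
Qed.

(** With the mean [m] and $a = m(1+s)$, $b = m(1-s)$, the inequality is the average of
    [powR_strong_convex] at $1 \pm s$, where the linear terms cancel. The quadratic term that
    remains is the gain which telescoping will sum. *)
Lemma powR_mean_gap a b p : 0 <= a -> 0 <= b -> 1 < p <= 2 ->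
  (p - 1) ^+ 2 / 2 * (((a - b) / 2) ^+ 2 * ((a + b) / 2) `^ (p - 2)) + ((a + b) / 2) `^ p
  <= (a `^ p + b `^ p) / 2.
Proof.
move=> a0 b0 /andP[p1 p2]; set m := (a + b) / 2.
have : 0 <= m by rewrite divr_ge0// addr_ge0.
rewrite le_eqVlt => /orP[/eqP m0|m0].
  (* Both values vanish with the mean, and the factor $((a-b)/2)^2$ kills whatever value [powR]
     takes at zero. *)
  have -> : a = 0 by move: m0; rewrite /m; lra.
  have -> : b = 0 by move: m0; rewrite /m; lra.
  rewrite -m0 subrr mul0r expr0n/= mul0r mulr0 add0r powR0; last by rewrite gt_eqF// (lt_trans _ p1).
  by rewrite addr0 mul0r.
set s := (a - b) / 2 / m.
have ms : m * s = (a - b) / 2 by rewrite /s mulrCA mulfV ?mulr1// gt_eqF.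
have am : a = m * (1 + s) by rewrite mulrDr ms /m; field.
have bm : b = m * (1 - s) by rewrite mulrBr ms /m; field.
have s1 : 0 <= 1 + s by rewrite -(pmulr_rge0 _ m0) -am.
have s2 : 0 <= 1 - s by rewrite -(pmulr_rge0 _ m0) -bm.
have q0 : 0 < p - 1 <= 1 by lra.
have pE : p = 1 + (p - 1) by lra.
have h1 : 1 + p * s + (p - 1) ^+ 2 / 2 * s ^+ 2 <= (1 + s) `^ p.
  have := @powR_strong_convex (1 + s) (p - 1) _ q0.
  by rewrite -pE [1 + s - 1]addrAC subrr add0r; apply; lra.
have h2 : 1 - p * s + (p - 1) ^+ 2 / 2 * s ^+ 2 <= (1 - s) `^ p.
  have := @powR_strong_convex (1 - s) (p - 1) _ q0.
  rewrite -pE [1 - s - 1]addrAC subrr add0r mulrN sqrrN; apply; lra.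
have -> : a `^ p = m `^ p * (1 + s) `^ p by rewrite {1}am powRM// ltW.
have -> : b `^ p = m `^ p * (1 - s) `^ p by rewrite {1}bm powRM// ltW.
rewrite -ms.
have -> : m `^ (p - 2) = m `^ p / m ^+ 2.
  by rewrite powRB ?(gt_eqF m0) ?implybT// powR_mulrn ?ltW.
have mp : 0 < m `^ p by exact: powR_gt0.
have -> : (m * s) ^+ 2 * (m `^ p / m ^+ 2) = s ^+ 2 * m `^ p.
  by field; rewrite gt_eqF.
nra.
Qed.

End PowerGap.

(** * Integrals on the line *)

Section Substitution.
Variable R : realType.
Local Notation mu := (@lebesgue_measure R).
Local Open Scope ereal_scope.
Implicit Types (g : R -> \bar R) (D : set R).

Lemma lebesgue_measure_affine (a b : R) (a0 : (0 <= a)%R) (A : set R) :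
  (0 < a)%R -> measurable A ->
  mu A = pushforward (mscale (NngNum a0) mu)
    (fun x : measurableTypeR R => a * x + b : measurableTypeR R)%R A.
Proof.
move=> a1 mA; apply: lebesgue_measure_unique => //=.
  by apply: measurable_funD => //; exact: measurable_funM.
move=> _ _ [[c e]] /= _ <-; rewrite /mscale /= /pushforward.
have -> : (fun x : R => a * x + b)%R @^-1` `]c, e] = `]((c - b) / a)%R, ((e - b) / a)%R]%classic.
  by apply/seteqP; split => x /=; rewrite !in_itv/= ltr_pdivrMr// ler_pdivlMr// ltrBlDr lerBrDr mulrC.
rewrite !lebesgue_measure_itv/= !lte_fin ltr_pM2r ?invr_gt0// ltrD2r.
case: ifPn => _; last by rewrite mule0.
rewrite -!EFinB -EFinM; congr (_%:E).
by field; rewrite gt_eqF.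
Qed.

Lemma ge0_integral_affine (a b : R) g : (0 < a)%R ->
  measurable_fun setT g -> (forall x, 0 <= g x) ->
  \int[mu]_x g x = a%:E * \int[mu]_x g (a * x + b)%R.
Proof.
move=> a0 mg g0.
have mphi : measurable_fun setT (fun x : measurableTypeR R => a * x + b : measurableTypeR R)%R.
  by apply: measurable_funD => //; exact: measurable_funM.
transitivity (\int[pushforward (mscale (NngNum (ltW a0)) mu)
    (fun x : measurableTypeR R => a * x + b : measurableTypeR R)%R]_x g x).
  by apply: eq_measure_integral => A mA _; exact: lebesgue_measure_affine.
rewrite ge0_integral_pushforward//= preimage_setT ge0_integral_mscale//=.
exact: measurableT_comp.
Qed.

Lemma ge0_integral_opp g : measurable_fun setT g -> (forall x, 0 <= g x) ->
  \int[mu]_x g x = \int[mu]_x g (- x)%R.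
Proof.
move=> mg g0.
transitivity (\int[pushforward mu (-%R : _ -> measurableTypeR R)]_x g x).
  by apply: eq_measure_integral => A mA _; exact/esym/lebesgue_measureN.
by rewrite ge0_integral_pushforward// preimage_setT.
Qed.

Lemma ge0_integral_shift (c : R) g : measurable_fun setT g -> (forall x, 0 <= g x) ->
  \int[mu]_x g x = \int[mu]_x g (x + c)%R.
Proof.
move=> mg g0; rewrite (@ge0_integral_affine 1 c)// mul1e.
by under eq_integral do rewrite mul1r.
Qed.

Lemma ge0_integral_reflect (c : R) g : measurable_fun setT g -> (forall x, 0 <= g x) ->
  \int[mu]_x g x = \int[mu]_x g (c - x)%R.
Proof.
move=> mg g0; rewrite (ge0_integral_shift c)// ge0_integral_opp//.
- by under eq_integral do rewrite addrC.
- apply: measurableT_comp => //; exact: measurable_funD.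
Qed.

Lemma ge0_integral_shift_dom (c : R) g D : measurable D ->
  measurable_fun setT g -> (forall x, 0 <= g x) ->
  \int[mu]_(x in D) g x = \int[mu]_(x in (fun x => x + c)%R @^-1` D) g (x + c)%R.
Proof.
move=> mD mg g0; rewrite integral_mkcond (ge0_integral_shift c).
- rewrite [RHS]integral_mkcond; apply: eq_integral => x _.
  by rewrite !patchE; congr (if _ then _ else _).
- by apply/(measurable_restrictT _ _).1 => //; exact: measurable_funTS.
- by move=> x; apply: erestrict_ge0.
Qed.

Lemma ge0_integral_reflect_dom (c : R) g D : measurable D ->
  measurable_fun setT g -> (forall x, 0 <= g x) ->
  \int[mu]_(x in D) g x = \int[mu]_(x in (fun x => c - x)%R @^-1` D) g (c - x)%R.
Proof.
move=> mD mg g0; rewrite integral_mkcond (ge0_integral_reflect c).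
- rewrite [RHS]integral_mkcond; apply: eq_integral => x _.
  by rewrite !patchE; congr (if _ then _ else _).
- by apply/(measurable_restrictT _ _).1 => //; exact: measurable_funTS.
- by move=> x; apply: erestrict_ge0.
Qed.

Lemma integral_mul_indic (f : R -> \bar R) D :
  \int[mu]_x (f x * (\1_D x)%:E) = \int[mu]_(x in D) f x.
Proof. by rewrite [RHS]integral_mkcond epatch_indic. Qed.

(** Tonelli on the region $0 \le l < w(x)$. The density [h] in the level is general because the
    maximal theorem uses a multiple of $l^{-1/q}$. *)
Lemma ge0_layer_cake_weight g (w h : R -> \bar R) :
  measurable_fun setT g -> (forall x, 0 <= g x) ->
  measurable_fun setT w ->
  measurable_fun setT h -> (forall x, 0 <= h x) ->
  \int[mu]_x (g x * \int[mu]_(l in [set l : R | (0 <= l)%R /\ l%:E < w x]) h l) =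
  \int[mu]_(l in `[0%R, +oo[) (h l * \int[mu]_(x in [set x : R | l%:E < w x]) g x).
Proof.
move=> mg g0 mw mh h0.
pose A : set (R * R) := [set z | (0 <= z.2)%R] `&` [set z | z.2%:E < w z.1].
have mA : measurable A.
  apply: measurableI.
    rewrite [X in measurable X](_ : _ = setT `&` (@snd R R) @^-1` `[0%R, +oo[); last first.
      by rewrite setTI; apply/seteqP; split => z /=; rewrite in_itv/= andbT.
    by apply: measurable_snd.
  rewrite [X in measurable X](_ : _ = setT `&` [set z : R * R | z.2%:E < w z.1]); last by rewrite setTI.
  by apply: emeasurable_fun_lt => //; apply: measurableT_comp.
have mA1 : measurable_fun setT (EFin \o \1_A : R * R -> \bar R).
  by apply/measurable_EFinP; exact: measurable_indic.
pose F (z : R * R) := g z.1 * (h z.2 * (\1_A z)%:E).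
have mF : measurable_fun setT F.
  apply: emeasurable_funM; first exact: measurableT_comp.
  by apply: emeasurable_funM => //; exact: measurableT_comp.
have F0 z : 0 <= F z by rewrite mule_ge0// mule_ge0.
transitivity (\int[mu]_x \int[mu]_l F (x, l)).
  apply: eq_integral => x _; rewrite /F/= ge0_integralZl//; last first.
  - by move=> l _; rewrite mule_ge0.
  - apply: emeasurable_funM => //.
    rewrite [X in measurable_fun _ X](_ : _ = (EFin \o \1_A) \o (fun l => (x, l)))//.
    by apply: measurableT_comp => //; exact: pair1_measurable.
  congr (_ * _); rewrite [LHS]integral_mkcond epatch_indic; apply: eq_integral => l _.
  by rewrite /= !indicE; congr (_ * (nat_of_bool _)%:R%:E).
rewrite fubini_tonelli// [RHS]integral_mkcond epatch_indic; apply: eq_integral => l _.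
rewrite [in RHS]integral_mkcond epatch_indic /=.
have mI : measurable [set x : R | l%:E < w x].
  by rewrite -[X in measurable X]setTI; exact: emeasurable_fun_lt.
have mgI : measurable_fun [set: R] (fun x => g x * (\1_[set x0 : R | (l%:E < w x0)%E] x)%:E).
  by apply: emeasurable_funM => //; apply/measurable_EFinP/measurable_indic.
rewrite -ge0_integralZl//=; last by move=> x _; rewrite mule_ge0.
rewrite -ge0_integralZr//=; last 2 first.
- by apply: emeasurable_funM => //; exact: measurable_cst.
- by move=> x _; rewrite !mule_ge0.
apply: eq_integral => x _.
rewrite /F/= /A indicI /= EFinM muleCA -!muleA; congr (_ * (_ * _)).
rewrite muleC !indicE; congr ((nat_of_bool _)%:R%:E * (nat_of_bool _)%:R%:E).
by apply: asbool_equiv_eq; rewrite /= in_itv/= andbT.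
Qed.

Lemma lebesgue_integral_indic D : measurable D ->
  \int[mu]_x (\1_D x)%:E = mu D.
Proof. by move=> mD; rewrite integral_indic// setIT. Qed.

Lemma measurable_layer g (w : R -> \bar R) :
  measurable_fun setT g -> (forall x, 0 <= g x) -> measurable_fun setT w ->
  measurable_fun setT (fun l : R => \int[mu]_(x in [set x : R | l%:E < w x]) g x).
Proof.
move=> mg g0 mw.
pose A : set (R * R) := [set z | z.2%:E < w z.1].
have mA : measurable A.
  rewrite [X in measurable X](_ : _ = setT `&` A); last by rewrite setTI.
  by apply: emeasurable_fun_lt => //; apply: measurableT_comp.
pose F (z : R * R) := g z.1 * (\1_A z)%:E.
have mF : measurable_fun setT F.
  apply: emeasurable_funM; first exact: measurableT_comp.
  by apply/measurable_EFinP; exact: measurable_indic.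
have F0 z : 0 <= F z by rewrite mule_ge0.
have := @measurable_fun_fubini_tonelli_G _ _ _ _ _ mu F mF F0.
by apply: eq_measurable_fun => l _; rewrite -integral_mul_indic.
Qed.

Lemma lebesgue_integral_cst (c : \bar R) D : measurable D ->
  \int[mu]_(x in D) c = c * mu D.
Proof. by move=> mD; exact: integral_cst. Qed.

Lemma ge0_layer_cake g (w : R -> \bar R) :
  measurable_fun setT g -> (forall x, 0 <= g x) ->
  measurable_fun setT w -> (forall x, 0 <= w x) ->
  \int[mu]_x (g x * w x) =
  \int[mu]_(l in `[0%R, +oo[) \int[mu]_(x in [set x : R | l%:E < w x]) g x.
Proof.
move=> mg g0 mw w0.
have := @ge0_layer_cake_weight g w (cst 1) mg g0 mw (measurable_cst _) (fun=> lee01).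
under [X in _ = X -> _]eq_integral do rewrite mul1e.
move=> <-; apply: eq_integral => x _; congr (_ * _).
move: (w0 x); case: (w x) => [r r0|_|//].
  have -> : [set l : R | (0 <= l)%R /\ l%:E < r%:E] = `[0%R, r[%classic.
    apply/seteqP; split => l /=; rewrite !in_itv/= lte_fin ?andbT; first by move=> [-> ->].
    by move=> /andP[-> ->].
  rewrite lebesgue_integral_cst// mul1e lebesgue_measure_itv/= lte_fin oppr0 adde0.
  case: ifPn => // rn; apply/eqP.
  by rewrite eq_le r0 andbT lee_fin leNgt.
have -> : [set l : R | (0 <= l)%R /\ l%:E < +oo] = `[0%R, +oo[%classic.
  by apply/seteqP; split => l /=; rewrite ?in_itv/= ?andbT ?ltry//; case.
by rewrite lebesgue_integral_cst// mul1e lebesgue_measure_itv/= ltry.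
Qed.

End Substitution.

Section IntegralMonotone.
Local Open Scope ereal_scope.
Context d (T : measurableType d) (R : realType).
Variable mu : {measure set T -> \bar R}.

(** The integral of a nonnegative function is a supremum over the simple functions below it, hence
    monotone on arbitrary nonnegative functions. *)
Lemma nneg_le_integral (D : set T) (f1 f2 : T -> \bar R) :
  (forall x, D x -> 0 <= f1 x) -> (forall x, D x -> f1 x <= f2 x) ->
  \int[mu]_(x in D) f1 x <= \int[mu]_(x in D) f2 x.
Proof.
move=> f10 f12; rewrite !ge0_integralE//; last first.
  by move=> x Dx; rewrite (le_trans (f10 x Dx))// f12.
apply: le_ereal_sup => _ /= [h hf <-]; exists h => // x.
by apply: le_trans (hf x) _; exact: lee_restrict.
Qed.

Lemma nneg_le_integral_dom (D E : set T) (f1 f2 : T -> \bar R) :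
  D `<=` E -> (forall x, E x -> 0 <= f2 x) ->
  (forall x, D x -> 0 <= f1 x) -> (forall x, D x -> f1 x <= f2 x) ->
  \int[mu]_(x in D) f1 x <= \int[mu]_(x in E) f2 x.
Proof.
move=> DE f20 f10 f12; rewrite integral_mkcond [leRHS]integral_mkcond.
apply: nneg_le_integral => x _; first exact: erestrict_ge0.
rewrite /patch; case: ifPn => [/set_mem Dx|_].
  by rewrite mem_set ?f12//; exact: DE.
by case: ifPn => // /set_mem; exact: f20.
Qed.

End IntegralMonotone.

(** * Integrals of powers at infinity and at the origin *)

Section PowerIntegral.
Variable R : realType.
Local Notation mu := (@lebesgue_measure R).
Local Open Scope ereal_scope.

Lemma cvg_powRN_y (r : R) : (0 < r)%R -> (x `^ (- r))%R @[x --> +oo%R] --> (0 : R)%R.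
Proof.
move=> r0; apply/cvgrPdist_le => /= e e0.
exists (e `^ (- r^-1))%R; split; first exact: num_real.
move=> x ex.
have x0 : (0 < x)%R by rewrite (le_lt_trans _ ex)// powR_ge0.
rewrite sub0r normrN ger0_norm ?powR_ge0//.
have -> : e = ((e `^ (- r^-1)) `^ (- r))%R.
  by rewrite -powRrM mulrNN mulVf ?gt_eqF// powRr1// ltW.
rewrite !(powRN _ r) lef_pV2 ?posrE ?powR_gt0//.
by rewrite ge0_ler_powR ?nnegrE ?powR_ge0// ltW.
Qed.

Lemma integral_powRN_y (c r : R) : (0 < c)%R -> (1 < r)%R ->
  \int[mu]_(x in `[c, +oo[) (x `^ (- r))%:E = (c `^ (1 - r) / (r - 1))%:E.
Proof.
move=> c0 r1; have r1' : (r - 1 != 0)%R by rewrite gt_eqF// subr_gt0.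
pose F (x : R) := (- (x `^ (1 - r) / (r - 1)))%R.
have dF (x : R) : (0 < x)%R -> is_derive x 1%R F (x `^ (- r))%R.
  move=> x0; rewrite /F.
  have h := is_derive1_powR (1 - r) x0.
  apply: is_derive_eq.
  rewrite !scaler0 add0r /GRing.scale/=.
  by rewrite [(1 - r - 1)%R]addrAC subrr add0r; field.
rewrite (@ge0_continuous_FTC2y _ _ F c 0%R).
- by rewrite /F sub0e -EFinN opprK.
- by move=> x _; exact: powR_ge0.
- apply: continuous_in_subspaceT => x; rewrite inE/= in_itv/= andbT => cx.
  have x0 : (0 < x)%R by exact: lt_le_trans cx.
  apply: differentiable_continuous; apply/derivable1_diffP.
  by apply: derivable_powR; rewrite in_itv/= x0.
- rewrite /F -[X in _ --> X]oppr0; apply: cvgN.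
  rewrite -[X in _ --> X](mul0r (r - 1)^-1)%R; apply: cvgMr_tmp.
  by rewrite -opprB; apply: cvg_powRN_y; rewrite subr_gt0.
- by move=> x cx; have := dF x (lt_trans c0 cx) => -[].
- apply: cvg_at_right_filter.
  apply: differentiable_continuous; apply/derivable1_diffP.
  by have := dF c c0 => -[].
- move=> x; rewrite in_itv/= andbT => cx.
  by rewrite derive1E; have [_ ->] := dF x (lt_trans c0 cx).
Qed.

(** The singularity at 0 is avoided by integrating over levels: below the height $t^{-s}$ the
    superlevel set has length at most [t], above it at most $l^{-1/s}$, and [integral_powRN_y]
    integrates the latter. *)
Lemma integral_powRN_0 (s t : R) : (0 < s < 1)%R -> (0 < t)%R ->
  \int[mu]_(x in `[0%R, t[) (x `^ (- s))%:E <= (t `^ (1 - s) / (1 - s))%:E.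
Proof.
move=> /andP[s0 s1] t0.
have ms : measurable_fun [set: R] (fun x : R => (x `^ (- s))%:E).
  by apply/measurable_EFinP; exact: measurable_powR.
have mi (a b : itv_bound R) : measurable_fun [set: R] (fun x => (\1_([set` Interval a b]) x)%:E : \bar R).
  by apply/measurable_EFinP; exact: measurable_indic.
pose c := (t `^ (- s))%R; have c0 : (0 < c)%R by exact: powR_gt0.
have sN0 : (- s != 0)%R by rewrite oppr_eq0 gt_eqF.
pose r := (s^-1)%R; have r1 : (1 < r)%R by rewrite invf_gt1.
rewrite -integral_mul_indic; under eq_integral do rewrite muleC.
rewrite ge0_layer_cake//; last by move=> x; rewrite lee_fin powR_ge0.
pose f1 (l : R) := t%:E * (\1_`[0%R, c[ l)%:E.
pose f2 (l : R) := (l `^ (- r))%:E * (\1_`[c, +oo[ l)%:E.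
apply: (@le_trans _ _ (\int[mu]_(l in `[0%R, +oo[) (f1 l + f2 l))).
  apply: nneg_le_integral => l; rewrite /= in_itv/= andbT => l0.
    by apply: integral_ge0 => x _; rewrite lee_fin.
  have [lc|cl] := ltP l c.
    have -> : f1 l + f2 l = t%:E.
      rewrite /f1 /f2 !indicE mem_set ?memNset/= ?in_itv/= ?l0 ?lc//.
        by rewrite mule1 mule0 adde0.
      by rewrite andbT; apply/negP; rewrite -ltNge.
    apply: (@le_trans _ _ (\int[mu]_x (\1_`[0%R, t[ x)%:E)).
      by apply: nneg_le_integral_dom => // x _; rewrite lee_fin.
    by rewrite lebesgue_integral_indic// lebesgue_measure_itv/= lte_fin t0 oppr0 adde0.
  have -> : f1 l + f2 l = (l `^ (- r))%:E.
    rewrite /f1 /f2 !indicE memNset ?mem_set/= ?in_itv/= ?cl//.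
      by rewrite mule1 mule0 add0e.
    by apply/negP; rewrite negb_and -leNgt cl orbT.
  have l0' : (0 < l)%R by exact: lt_le_trans cl.
  apply: (@le_trans _ _ (\int[mu]_x (\1_`[0%R, (l `^ (- r))%R] x)%:E)).
    apply: nneg_le_integral_dom => // x; rewrite ?lee_fin//= => lx.
    rewrite !indicE; case: (boolP (x \in `[0%R, t[%classic)); last by [].
    rewrite inE/= in_itv/= => /andP[x0 xt]; rewrite mem_set//= in_itv/= x0/=.
    rewrite leNgt; apply/negP => h; move: lx; rewrite lte_fin ltNge => /negP; apply.
    have h0 : (0 < l `^ (- r))%R by exact: powR_gt0.
    rewrite -[leRHS](_ : (l `^ (- r)) `^ (- s) = l)%R; last by rewrite -powRrM mulrNN mulVf ?gt_eqF// powRr1.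
    rewrite !(powRN _ s) lef_pV2 ?posrE ?powR_gt0 ?(lt_trans h0 h)//.
    by rewrite ge0_ler_powR ?nnegrE ?(ltW h0)// ltW.
  rewrite lebesgue_integral_indic// lebesgue_measure_itv/= lte_fin powR_gt0//.
  by rewrite oppr0 adde0.
rewrite ge0_integralD//; last 4 first.
- by move=> l _; rewrite mule_ge0// ?lee_fin// ltW.
- by apply: measurable_funTS; apply: emeasurable_funM; [exact: measurable_cst|exact: mi].
- by move=> l _; rewrite mule_ge0// ?lee_fin// powR_ge0.
- apply: measurable_funTS; apply: emeasurable_funM; last exact: mi.
  by apply/measurable_EFinP; exact: measurable_powR.
apply: (@le_trans _ _ (\int[mu]_l f1 l + \int[mu]_l f2 l)).
  apply: leeD; apply: nneg_le_integral_dom => // l _.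
  - by rewrite mule_ge0// ?lee_fin// ltW.
  - by rewrite mule_ge0// ?lee_fin// ltW.
  - by rewrite mule_ge0// ?lee_fin// powR_ge0.
  - by rewrite mule_ge0// ?lee_fin// powR_ge0.
rewrite !integral_mul_indic lebesgue_integral_cst// integral_powRN_y//.
rewrite lebesgue_measure_itv/= lte_fin c0 oppr0 adde0 -EFinM -EFinD lee_fin.
have -> : (c `^ (1 - r) = t `^ (1 - s))%R.
  by rewrite /c -powRrM /r; congr (_ `^ _)%R; field; rewrite gt_eqF.
have -> : (t * c = t `^ (1 - s))%R.
  by rewrite /c powRD ?powRr1 ?ltW// (gt_eqF t0) implybT.
apply: eq_ler; rewrite /r; field.
by rewrite subr_eq0 (gt_eqF s1) (gt_eqF s0).
Qed.

End PowerIntegral.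

(** * The maximal theorem in L^q *)

Section Maximal.
Variable R : realType.
Local Notation mu := (@lebesgue_measure R).
Local Notation HL := (@HL_maximal R).
Local Open Scope ereal_scope.

Lemma iavg_le_HL (v : R -> R) (x r : R) : (0 < r)%R -> iavg v (ball x r) <= HL v x.
Proof.
by move=> r0; apply: ereal_sup_ubound; exists r => //=; rewrite in_itv/= r0.
Qed.

(** Dropping the values at most [c] lowers any average by at most [c]. *)
Lemma HL_maximal_truncate (v : R -> R) (c : R) (x : R) :
  measurable_fun setT v -> (forall x, 0 <= v x)%R -> (0 <= c)%R ->
  HL v x <= HL (fun y => v y * \1_[set z | c < v z] y)%R x + c%:E.
Proof.
move=> mv v0 c0; apply: ge_ereal_sup => z [r]; rewrite /= in_itv/= andbT => r0 <-.
apply: le_trans (leeD2r _ (iavg_le_HL _ _ r0)).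
have mb : measurable (ball x r) by exact: measurable_ball.
have mI : measurable [set z | c < v z]%R.
  by rewrite -[X in measurable X]setTI; exact: measurable_fun_ltr.
set w := (fun y => _)%R.
have mw : measurable_fun setT w by apply: measurable_funM => //; exact: measurable_indic.
have mub : mu (ball x r) = (2 * r)%:E.
  by rewrite lebesgue_measure_ball ?ltW// mulr2n mulrDl mul1r.
have -> : c%:E = iavg (cst c) (ball x r).
  rewrite /iavg; under eq_integral do rewrite /= ger0_norm//.
  rewrite lebesgue_integral_cst// mub inver gt_eqF ?mulr_gt0// -!EFinM; congr (_%:E).
  by field; rewrite gt_eqF.
apply: le_trans (iavgD mb _ _ _); last 3 first.
- by rewrite mub ltry.
- exact: measurable_funTS.
- exact: measurable_cst.
rewrite /iavg; apply: lee_wpmul2l; first by rewrite mub inver gt_eqF ?mulr_gt0// lee_fin invr_ge0 mulr_ge0// ltW.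
apply: nneg_le_integral => y _ //; rewrite lee_fin /w/= indicE.
rewrite ger0_norm// ger0_norm ?addr_ge0 ?mulr_ge0//.
case: (boolP (_ \in _)) => [_|]; first by rewrite mulr1 lerDl.
by rewrite notin_setE/= mulr0 add0r => /negP; rewrite -leNgt.
Qed.

(** The weak-type inequality, with covering constant 3, is applied at height $l/2$ to the part of
    [v] above $l/2$; the discarded part contributes at most $l/2$ to the maximal function.
    Restricting the integral in this way is what permits interpolation. *)
Lemma HL_maximal_level (v : R -> R) (l : R) :
  measurable_fun setT v -> (forall x, 0 <= v x)%R ->
  mu.-integrable setT (EFin \o v) -> (0 < l)%R ->
  mu [set x | l%:E < HL v x] <=
  (6 / l)%:E * \int[mu]_(x in [set x | (l / 2 < v x)%R]) (v x)%:E.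
Proof.
move=> mv v0 iv l0.
have l2 : (0 < l / 2)%R by rewrite divr_gt0.
have mI : measurable [set z | l / 2 < v z]%R.
  by rewrite -[X in measurable X]setTI; exact: measurable_fun_ltr.
pose w y := (v y * \1_[set z | l / 2 < v z] y)%R.
have w0 y : (0 <= w y)%R by rewrite mulr_ge0.
have mw : measurable_fun setT w by apply: measurable_funM => //; exact: measurable_indic.
have iw : mu.-integrable setT (EFin \o w).
  apply: le_integrable iv => //; first exact/measurable_EFinP.
  move=> y _ /=; rewrite lee_fin !ger0_norm// /w indicE.
  by case: (_ \in _); rewrite ?mulr1 ?mulr0.
have lw : locally_integrable setT w by apply: open_integrable_locally => //; exact: openT.
have lv : locally_integrable setT v by apply: open_integrable_locally => //; exact: openT.
apply: (@le_trans _ _ (mu [set x | (l / 2)%:E < HL w x])).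
  have mHL (u : R -> R) (c : R) : locally_integrable setT u -> measurable [set x | c%:E < HL u x].
    move=> lu; rewrite -[X in measurable X]setTI.
    by apply: emeasurable_fun_o_infty => //; exact: measurable_HL_maximal.
  apply: le_measure; rewrite ?inE; [exact: mHL|exact: mHL|].
  move=> x /= lx; have := lt_le_trans lx (HL_maximal_truncate x mv v0 (ltW l2)).
  by rewrite [in X in X < _](splitr l) EFinD lteD2rE.
apply: le_trans (maximal_inequality lw l2) _.
have -> : (3 / (l / 2) = 6 / l)%R by field; rewrite gt_eqF.
apply: lee_wpmul2l; first by rewrite lee_fin divr_ge0// ltW.
rewrite -[leRHS]integral_mul_indic; apply: nneg_le_integral => x _ //.
by rewrite abse_EFin ger0_norm.
Qed.

(** Marcinkiewicz interpolation by hand: the level bound is integrated over the levels of the [q]-th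
    power and the order of integration is exchanged; then $\int_0^{(2v)^q} l^{-1/q}\,dl$ supplies
    the missing power $v^{q-1}$. *)
Lemma HL_maximal_Lp (q : R) : (1 < q)%R ->
  exists2 C : R, (0 <= C)%R & forall v : R -> R,
    measurable_fun setT v -> (forall x, 0 <= v x)%R ->
    mu.-integrable setT (EFin \o v) ->
    \int[mu]_x (HL v x `^ q) <= C%:E * \int[mu]_x (v x `^ q)%:E.
Proof.
move=> q1; have q0 : (0 < q)%R by exact: lt_trans q1.
pose s := (q^-1)%R.
have s01 : (0 < s < 1)%R by rewrite invr_gt0 q0 invf_lt1.
have /andP[s0 s1] := s01.
exists (6 * 2 `^ (q - 1) / (1 - s))%R.
  by rewrite divr_ge0 ?mulr_ge0 ?powR_ge0// subr_ge0 ltW.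
move=> v mv v0 iv.
have lv : locally_integrable setT v by apply: open_integrable_locally => //; exact: openT.
have mM := measurable_HL_maximal lv.
have M0 x : 0 <= HL v x by exact: HL_maximalT_ge0.
have mMq : measurable_fun setT (fun x => HL v x `^ q).
  exact: (measurableT_comp (measurable_poweR _)).
(* The level 0 is left out, since the level bound divides by $l^{1/q}$. *)
have -> : \int[mu]_x (HL v x `^ q) =
    \int[mu]_(l in `]0%R, +oo[) \int[mu]_(x in [set x : R | l%:E < HL v x `^ q]) 1.
  rewrite integral_itv_obnd_cbnd; last first.
    by apply: measurable_funTS; apply: (@measurable_layer R (cst 1)).
  have /= <- := @ge0_layer_cake R (cst 1) _ (measurable_cst _) (fun=> lee01) mMq (fun=> poweR_ge0 _ _).
  by apply: eq_integral => x _; rewrite mul1e.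
pose h (l : R) := (6 * l `^ (- s))%:E.
have h0 l : 0 <= h l by rewrite lee_fin mulr_ge0// powR_ge0.
have mh : measurable_fun setT h.
  by apply/measurable_EFinP; apply: measurable_funM => //; exact: measurable_powR.
have mvE : measurable_fun setT (EFin \o v) by exact/measurable_EFinP.
pose w x := (((2 * v x) `^ q)%R)%:E.
have mw : measurable_fun setT w.
  apply/measurable_EFinP; apply: (measurableT_comp (measurable_powR _)).
  exact: measurable_funM.
apply: (@le_trans _ _ (\int[mu]_(l in `[0%R, +oo[)
    (h l * \int[mu]_(x in [set x : R | l%:E < w x]) (v x)%:E))).
  apply: nneg_le_integral_dom.
  - by apply: subset_itvr; rewrite bnd_simp.
  - by move=> l _; rewrite mule_ge0// integral_ge0// => x _; rewrite lee_fin.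
  - by move=> l _; rewrite integral_ge0.
  move=> l; rewrite /= in_itv/= andbT => l0.
  have ls0 : (0 < l `^ s)%R by exact: powR_gt0.
  have sq : (s * q = 1)%R by rewrite mulVf// gt_eqF.
  rewrite lebesgue_integral_cst; last first.
    by rewrite -[X in measurable X]setTI; apply: emeasurable_fun_o_infty.
  rewrite mul1e.
  have -> : [set x | l%:E < HL v x `^ q] = [set x | (l `^ s)%:E < HL v x].
    apply/seteqP; split => x /=; move: (M0 x); case: (HL v x) => [y y0|_|//].
    - rewrite poweR_EFin !lte_fin => ly.
      rewrite ltNge; apply/negP => yl; move: ly; rewrite ltNge => /negP; apply.
      rewrite -[leRHS](_ : (l `^ s) `^ q = l)%R; last by rewrite -powRrM sq powRr1// ltW.
      by rewrite ge0_ler_powR ?nnegrE ?powR_ge0// ltW.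
    - by rewrite ltry.
    - rewrite poweR_EFin !lte_fin => ly.
      rewrite -[ltLHS](_ : (l `^ s) `^ q = l)%R; last by rewrite -powRrM sq powRr1// ltW.
      by rewrite gt0_ltr_powR ?nnegrE ?powR_ge0.
    - by move=> _; rewrite poweRyr ?gt_eqF// ltry.
  apply: le_trans (HL_maximal_level mv v0 iv ls0) _.
  rewrite /h powRN; apply: lee_wpmul2l; first by rewrite lee_fin divr_ge0// ltW.
  apply: nneg_le_integral_dom => // x /=; rewrite ?lee_fin// => lx.
  rewrite /w lte_fin -[ltLHS](_ : (l `^ s) `^ q = l)%R; last by rewrite -powRrM sq powRr1// ltW.
  rewrite gt0_ltr_powR ?nnegrE ?powR_ge0 ?mulr_ge0//.
  by rewrite mulrC -ltr_pdivrMr.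
rewrite -ge0_layer_cake_weight//.
rewrite -ge0_integralZl//; last 3 first.
- by apply/measurable_EFinP; apply: (measurableT_comp (measurable_powR _)).
- by move=> x _; rewrite lee_fin powR_ge0.
- by rewrite lee_fin divr_ge0 ?mulr_ge0 ?powR_ge0// subr_ge0 ltW.
apply: nneg_le_integral => x _.
  by rewrite mule_ge0 ?lee_fin// integral_ge0.
have [vx0|vx0] := eqVneq (v x) 0%R.
  by rewrite /= vx0 mul0e mule_ge0// lee_fin ?powR_ge0// divr_ge0 ?mulr_ge0 ?powR_ge0// subr_ge0 ltW.
have vx : (0 < v x)%R by rewrite lt_neqAle eq_sym vx0 v0.
have wx : (0 < (2 * v x) `^ q)%R by rewrite powR_gt0// mulr_gt0.
have -> : [set l : R | (0 <= l)%R /\ l%:E < w x] = `[0%R, ((2 * v x) `^ q)%R[%classic.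
  apply/seteqP; split => l /=; rewrite !in_itv/= lte_fin; first by move=> [-> ->].
  by move=> /andP[-> ->].
apply: (@le_trans _ _ ((v x)%:E * (6%:E * (((2 * v x) `^ q) `^ (1 - s) / (1 - s))%:E))).
  apply: lee_wpmul2l; first by rewrite lee_fin.
  rewrite /h; under eq_integral do rewrite EFinM.
  rewrite ge0_integralZl//.
  - by apply: lee_wpmul2l; [rewrite lee_fin|exact: integral_powRN_0].
  - by apply/measurable_EFinP; apply: measurable_funTS; exact: measurable_powR.
  - by move=> l _; rewrite lee_fin powR_ge0.
rewrite -!EFinM lee_fin -powRrM.
have -> : (q * (1 - s) = q - 1)%R by rewrite mulrBr mulr1 mulfV// gt_eqF.
rewrite powRM// ?v0// -(mulr_powRB1 (v0 x) q0).
by apply: eq_ler; field; rewrite subr_eq0 gt_eqF.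
Qed.

End Maximal.

Lemma lee_poweR (R : realType) (x y : \bar R) (r : R) :
  0 <= r -> (0 <= x)%E -> (x <= y)%E -> (x `^ r <= y `^ r)%E.
Proof.
move=> r0 x0 xy; apply: gt0_ler_poweR => //; rewrite in_itv/= leey andbT//.
exact: le_trans xy.
Qed.

Lemma sume_telescope_le (R : realType) (u v : nat -> \bar R) (n : nat) :
  (forall i, u i + v i <= v i.+1)%E -> (0 <= v 0%N)%E ->
  (\sum_(0 <= i < n) u i <= v n)%E.
Proof.
move=> uv v0; elim: n => [|n IH]; first by rewrite big_mkord big_ord0.
rewrite big_nat_recr//=; apply: le_trans (uv n).
by rewrite addeC leeD2l.
Qed.

(** * Hölder's inequality for functions with extended values *)

Section Hoelder.
Local Open Scope ereal_scope.
Context d (T : measurableType d) (R : realType).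
Variable mu : {measure set T -> \bar R}.
Implicit Types (a b : T -> \bar R) (p q : R).

Lemma ae_lty_of_integral_poweR a p : (0 < p)%R ->
  measurable_fun setT a -> (forall x, 0 <= a x) ->
  \int[mu]_x (a x `^ p) < +oo -> {ae mu, forall x, a x \is a fin_num}.
Proof.
move=> p0 ma a0 ioo.
have /integrable_ae : mu.-integrable setT (fun x => a x `^ p).
  apply/integrableP; split; first exact: (measurableT_comp (measurable_poweR _)).
  by under eq_integral do rewrite gee0_abs ?poweR_ge0//.
move=> /(_ measurableT); apply: filterS => x /(_ I) afin.
rewrite ge0_fin_numE//; apply: (@lty_poweRy _ _ p); first by rewrite gt_eqF.
by rewrite -ge0_fin_numE// poweR_ge0.
Qed.

Lemma ge0_ae_eq0_of_integral_poweR a p : (0 < p)%R ->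
  measurable_fun setT a -> (forall x, 0 <= a x) ->
  \int[mu]_x (a x `^ p) = 0 -> {ae mu, forall x, a x = 0}.
Proof.
move=> p0 ma a0 i0.
have map : measurable_fun setT (fun x => a x `^ p) by exact: (measurableT_comp (measurable_poweR _)).
have /(ae_eq_integral_abs _ measurableT map) : \int[mu]_x `|a x `^ p| = 0.
  by under eq_integral do rewrite gee0_abs ?poweR_ge0//.
by apply: filterS => x /(_ I) /=; exact: poweR_eq0_eq0.
Qed.

(** Maximal and square functions may be infinite, whence the extended values. If one norm is
    infinite, either the other one is positive and the right-hand side is infinite, or the other
    function vanishes almost everywhere. Otherwise both functions are finite almost everywhere and
    the real-valued inequality applies. *)
Lemma ge0_hoelder a b p q : measurable_fun setT a -> measurable_fun setT b ->
  (forall x, 0 <= a x) -> (forall x, 0 <= b x) ->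
  (0 < p)%R -> (0 < q)%R -> (p^-1 + q^-1 = 1)%R ->
  \int[mu]_x (a x * b x) <=
    (\int[mu]_x (a x `^ p)) `^ p^-1 * (\int[mu]_x (b x `^ q)) `^ q^-1.
Proof.
move=> ma mb a0 b0 p0 q0 pq.
have mab : measurable_fun setT (fun x => a x * b x) by exact: emeasurable_funM.
have ab0 (c e : T -> \bar R) (r s : R) : (0 < r)%R -> (0 < s)%R ->
    measurable_fun setT c -> measurable_fun setT e ->
    (forall x, 0 <= c x) -> (forall x, 0 <= e x) ->
    \int[mu]_x (c x `^ r) = +oo ->
  \int[mu]_x (c x * e x) <=
    (\int[mu]_x (c x `^ r)) `^ r^-1 * (\int[mu]_x (e x `^ s)) `^ s^-1.
  move=> r0 s0 mc me c0 e0 coo.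
  have : 0 <= \int[mu]_x (e x `^ s) by apply: integral_ge0 => x _; exact: poweR_ge0.
  rewrite le_eqVlt => /orP[/eqP E0|E0]; last first.
    rewrite coo poweRyr ?gt_eqF ?invr_gt0// gt0_mulye ?leey//.
    exact: poweR_gt0.
  rewrite (@ge0_ae_eq_integral _ _ _ mu setT _ (cst 0))//.
  - by rewrite integral0 mule_ge0// poweR_ge0.
  - exact: emeasurable_funM.
  - by move=> x _; rewrite mule_ge0.
  - have := ge0_ae_eq0_of_integral_poweR s0 me e0 (esym E0).
    by apply: filterS => x /= -> _; rewrite mule0.
have [Aoo|Aoo] := eqVneq (\int[mu]_x (a x `^ p)) +oo; first exact: ab0.
have [Boo|Boo] := eqVneq (\int[mu]_x (b x `^ q)) +oo.
  rewrite muleC; under eq_integral do rewrite muleC.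
  exact: ab0.
have afin := ae_lty_of_integral_poweR p0 ma a0 _.
have {}afin := afin _; rewrite ltey in afin; move: afin => /(_ Aoo) afin.
have := ae_lty_of_integral_poweR q0 mb b0; rewrite ltey => /(_ Boo) bfin.
pose f x := fine (a x); pose g x := fine (b x).
have mf : measurable_fun setT f by exact: measurableT_comp.
have mg : measurable_fun setT g by exact: measurableT_comp.
have f0 x : (0 <= f x)%R by exact: fine_ge0.
have g0 x : (0 <= g x)%R by exact: fine_ge0.
have fa x : (f x)%:E <= a x.
  by rewrite /f; move: (a0 x); case: (a x) => //=; rewrite leey.
have gb x : (g x)%:E <= b x.
  by rewrite /g; move: (b0 x); case: (b x) => //=; rewrite leey.
have h := hoelder mu mf mg p0 q0 pq.
apply: (@le_trans _ _ (\int[mu]_x (f x * g x)%:E)).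
  rewrite (@ge0_ae_eq_integral _ _ _ mu setT _ (fun x => (f x * g x)%:E))//.
  - by apply/measurable_EFinP; exact: measurable_funM.
  - by move=> x _; rewrite mule_ge0.
  - by move=> x _; rewrite lee_fin mulr_ge0.
  - apply: filterS2 afin bfin => x ax bx _.
    by rewrite EFinM /f /g !fineK.
have pw (r s : R) : (0 < r)%R -> forall (u : T -> R) (v : T -> \bar R), (forall x, 0 <= u x)%R ->
    (forall x, (u x)%:E <= v x) -> 'N[mu]_r%:E[EFin \o u] <= (\int[mu]_x (v x `^ r)) `^ r^-1.
  move=> r0 u v u0 uv; rewrite unlock.
  have v0 x : 0 <= v x by rewrite (le_trans _ (uv x))// lee_fin.
  have i0 : 0 <= \int[mu]_x (`|(EFin \o u) x| `^ r) by apply: integral_ge0 => x _; exact: poweR_ge0.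
  have i1 : 0 <= \int[mu]_x (v x `^ r) by apply: integral_ge0 => x _; exact: poweR_ge0.
  apply: lee_poweR => //; first by rewrite invr_ge0 ltW.
  apply: nneg_le_integral => x _; first exact: poweR_ge0.
  rewrite gee0_abs ?lee_fin//=.
  by rewrite -poweR_EFin; apply: lee_poweR; rewrite ?lee_fin// ltW.
apply: le_trans (lee_pmul _ _ (pw p q p0 f a f0 fa) (pw q p q0 g b g0 gb)); rewrite ?Lnorm_ge0//.
apply: le_trans h; rewrite Lnorm1.
by apply: nneg_le_integral => x _; rewrite ?lee_fin ?mulr_ge0//= ler_norm.
Qed.

End Hoelder.

(** * Dyadic averages *)

Section Windows.
Variable R : realType.
Local Notation mu := (@lebesgue_measure R).
Local Open Scope ereal_scope.
Implicit Types (g : R -> \bar R) (D E : set R).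

Let measurable_windowF g D : measurable D -> measurable_fun setT g ->
  measurable_fun setT (fun z : R * R => g (z.1 - z.2)%R * (\1_D z.2)%:E).
Proof.
move=> mD mg; apply: emeasurable_funM.
  by apply: measurableT_comp => //; exact: measurable_funB.
by apply/measurable_EFinP; apply: measurableT_comp.
Qed.

Lemma measurable_window g D : measurable D -> measurable_fun setT g ->
  (forall x, 0 <= g x) ->
  measurable_fun setT (fun x : R => \int[mu]_(t in D) g (x - t)%R).
Proof.
move=> mD mg g0.
have := @measurable_fun_fubini_tonelli_F _ _ _ _ _ mu _ (measurable_windowF mD mg) _.
move=> /(_ (fun z => mule_ge0 (g0 _) _)).
rewrite (_ : (fun x => _) = fubini_F mu (fun z : R * R => g (z.1 - z.2)%R * (\1_D z.2)%:E)).
  by apply=> z; rewrite lee_fin.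
by apply/funext => x; rewrite /fubini_F -integral_mul_indic.
Qed.

Lemma tonelli_window g D E : measurable D -> measurable E -> measurable_fun setT g ->
  (forall x, 0 <= g x) ->
  \int[mu]_(x in E) \int[mu]_(t in D) g (x - t)%R =
  \int[mu]_(t in D) \int[mu]_(x in E) g (x - t)%R.
Proof.
move=> mD mE mg g0.
pose F (z : R * R) := g (z.1 - z.2)%R * (\1_D z.2)%:E * (\1_E z.1)%:E.
have mgs (s : bool) (x : R) : measurable_fun setT (fun t : R => g (if s then x - t else t - x)%R).
  by case: s; apply: measurableT_comp => //; exact: measurable_funB.
have mi (A : set R) : measurable A -> measurable_fun setT (fun x => (\1_A x)%:E : \bar R).
  by move=> mA; apply/measurable_EFinP; exact: measurable_indic.
have mF : measurable_fun setT F.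
  apply: emeasurable_funM; first exact: measurable_windowF.
  by apply: (measurableT_comp (mi E mE)); exact: measurable_fst.
have F0 z : 0 <= F z by rewrite /F !mule_ge0.
transitivity (\int[mu]_x \int[mu]_t F (x, t)).
  rewrite -integral_mul_indic; apply: eq_integral => x _.
  rewrite -integral_mul_indic -ge0_integralZr//.
  - by apply: emeasurable_funM; [exact: (mgs true)|exact: mi].
  - by move=> t _; rewrite mule_ge0.
rewrite fubini_tonelli//.
rewrite -[RHS]integral_mul_indic; apply: eq_integral => t _.
rewrite -integral_mul_indic -ge0_integralZr//.
- by apply: eq_integral => x _; rewrite /F/= -!muleA; congr (_ * _); rewrite muleC.
- by apply: emeasurable_funM; [exact: (mgs false)|exact: mi].
- by move=> x _; rewrite mule_ge0.
Qed.

Lemma preimage_sub_itv (a b x : R) (s r : bool) :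
  (fun t => x - t)%R @^-1` [set` Interval (BSide s a) (BSide r b)] =
  [set` Interval (BSide (~~ r) (x - b)%R) (BSide (~~ s) (x - a)%R)].
Proof.
by apply/seteqP; split => t /=; case: s; case: r; rewrite /= !in_itv/= => /andP[? ?]; apply/andP; split; lra.
Qed.

Lemma window_itv g (a b x : R) : measurable_fun setT g -> (forall x, 0 <= g x) ->
  \int[mu]_(t in `[a, b]) g (x - t)%R = \int[mu]_(y in `[(x - b)%R, (x - a)%R]) g y.
Proof.
move=> mg g0; rewrite (@ge0_integral_reflect_dom _ x g)// preimage_sub_itv /=.
by rewrite !subKr.
Qed.

Lemma shift_itv g (a b c : R) : measurable_fun setT g -> (forall x, 0 <= g x) ->
  \int[mu]_(t in `[a, b]) g (t - c)%R = \int[mu]_(y in `[(a - c)%R, (b - c)%R]) g y.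
Proof.
move=> mg g0; rewrite [RHS](@ge0_integral_shift_dom _ (- c) g)//.
congr integral; apply/seteqP; split => t /=; rewrite !in_itv/= => /andP[? ?]; apply/andP; split; lra.
Qed.

Lemma integral_itv_split g (a b c : R) : (a <= b)%R -> (b <= c)%R ->
  measurable_fun setT g -> (forall x, 0 <= g x) ->
  \int[mu]_(t in `[a, c]) g t = \int[mu]_(t in `[a, b]) g t + \int[mu]_(t in `[b, c]) g t.
Proof.
move=> ab bc mg g0.
rewrite -[X in _ = _ + X]integral_itv_obnd_cbnd; last exact: measurable_funTS.
rewrite -ge0_integral_setU//; last 2 first.
- exact: measurable_funTS.
- rewrite disj_set2E; apply/eqP/seteqP; split => x //=; rewrite !in_itv/= => -[/andP[_ xb] /andP[bx _]].
  by move: (le_lt_trans xb bx); rewrite ltxx.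
congr integral; apply/seteqP; split => x /=; rewrite !in_itv/=.
  by move=> /andP[ax xc]; have [xb|bx] := leP x b; [left; rewrite ax|right].
by move=> [/andP[-> xb]|/andP[bx ->]]; rewrite ?andbT; lra.
Qed.

End Windows.

(** Under [nneg_locint] the integral is finite, so [fine] loses nothing. Locking keeps
    simplification from unfolding the integral; [dyavgE] is the working form. *)
HB.lock Definition dyavg (R : realType) (f : R -> R) (j : nat) (x : R) : R :=
  2 ^+ j * fine (\int[@lebesgue_measure R]_(t in `[0%R, (2 ^- j)%R]) (f (x - t))%:E)%E.
Canonical locked_dyavg := Unlockable dyavg.unlock.

Section DyadicAverages.
Variable R : realType.
Local Notation mu := (@lebesgue_measure R).
Implicit Types (f : R -> R) (p : R).

Definition nneg_locint f := [/\ measurable_fun setT f, (forall x, 0 <= f x) &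
  forall a b : R, (\int[mu]_(x in `[a, b]) (f x)%:E < +oo)%E].

Definition dydiff f (j : nat) (x : R) : R :=
  (dyavg f j.+1 x - dyavg f j.+1 (x - 2 ^- j.+1)) / 2.

Lemma exp2_gt0 j : 0 < 2 ^+ j :> R.
Proof. by rewrite exprn_gt0. Qed.

Lemma expN2_gt0 j : 0 < 2 ^- j :> R.
Proof. by rewrite invr_gt0 exp2_gt0. Qed.

Lemma expN2_le1 j : 2 ^- j <= 1 :> R.
Proof. by rewrite invf_le1 ?exp2_gt0// exprn_ege1// ler1n. Qed.

Lemma expN2S j : 2 ^- j.+1 = 2 ^- j / 2 :> R.
Proof. by rewrite exprS invfM mulrC. Qed.

Section Locint.
Variable f : R -> R.
Hypothesis lf : nneg_locint f.

Let mf : measurable_fun setT f. Proof. by case: lf. Qed.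
Let f0 x : 0 <= f x. Proof. by case: lf. Qed.
Let mfE : measurable_fun setT (fun x => (f x)%:E). Proof. exact/measurable_EFinP. Qed.
Let fE0 x : (0 <= (f x)%:E)%E. Proof. by rewrite lee_fin. Qed.

Lemma dyavgE j x : (dyavg f j x)%:E =
  ((2 ^+ j)%:E * \int[mu]_(y in `[(x - 2 ^- j)%R, x]) (f y)%:E)%E.
Proof.
rewrite unlock EFinM fineK; first by rewrite (@window_itv _ (fun x => (f x)%:E))// subr0.
rewrite (@window_itv _ (fun x => (f x)%:E))// ge0_fin_numE; first by case: lf.
exact: integral_ge0.
Qed.

Lemma dyavg_ge0 j x : 0 <= dyavg f j x.
Proof.
by rewrite unlock mulr_ge0 ?exprn_ge0// fine_ge0// integral_ge0.
Qed.

Lemma dyavg_split j x : dyavg f j x = (dyavg f j.+1 x + dyavg f j.+1 (x - 2 ^- j.+1)) / 2.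
Proof.
apply: EFin_inj; rewrite [in RHS]EFinM EFinD !dyavgE.
rewrite (@integral_itv_split _ _ _ (x - 2 ^- j.+1))//; last 2 first.
- by rewrite lerD2l lerN2 expN2S ler_pdivrMr// ler_peMr ?ler1n ?ltW// expN2_gt0.
- by rewrite gerBl ltW// expN2_gt0.
have -> : x - 2 ^- j.+1 - 2 ^- j.+1 = x - 2 ^- j by rewrite expN2S; field; rewrite gt_eqF ?exp2_gt0.
set A := (\int[mu]_(y in `[(x - 2 ^- j)%R, _]) _)%E; set B := (\int[mu]_(y in _) _)%E.
have A0 : (0 <= A)%E by exact: integral_ge0.
have B0 : (0 <= B)%E by exact: integral_ge0.
rewrite -ge0_muleDr// muleAC -EFinM addeC exprS.
by congr (_%:E * _)%E; rewrite mulrAC mulfV ?mul1r.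
Qed.

Lemma measurable_dyavg j : measurable_fun setT (dyavg f j).
Proof.
rewrite unlock; apply: measurable_funM => //; apply: measurableT_comp => //.
exact: (@measurable_window _ (fun x => (f x)%:E)).
Qed.

Lemma measurable_dydiff j : measurable_fun setT (dydiff f j).
Proof.
apply: measurable_funM => //; apply: measurable_funB; first exact: measurable_dyavg.
apply: measurableT_comp; first exact: measurable_dyavg.
exact: measurable_funB.
Qed.

(** Jensen's inequality as Hölder's inequality against the indicator of the window: its measure
    $2^{-j}$, to the power $p-1$, combines with $2^{jp}$ to leave $2^j$. *)
Lemma dyavg_jensen p j x : 1 < p ->
  ((dyavg f j x `^ p)%:E <=
   (2 ^+ j)%:E * \int[mu]_(t in `[0%R, (2 ^- j)%R]) ((f (x - t)) `^ p)%:E)%E.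
Proof.
move=> p1; have p0 : 0 < p by exact: lt_trans p1.
pose q := (1 - p^-1)^-1.
have p1' : 0 < 1 - p^-1 by rewrite subr_gt0 invf_lt1.
have q0 : 0 < q by rewrite invr_gt0.
have mw : measurable_fun setT (fun t : R => f (x - t)).
  by apply: measurableT_comp => //; exact: measurable_funB.
have mI : measurable_fun setT (fun t : R => (\1_(`[0%R, 2 ^- j]%classic : set R) t)%:E : \bar R).
  by apply/measurable_EFinP; exact: measurable_indic.
have := @ge0_hoelder _ _ _ mu (fun t => (f (x - t))%:E * (\1_(`[0%R, 2 ^- j]%classic : set R) t)%:E)%E
  (fun t : R => (\1_(`[0%R, 2 ^- j]%classic : set R) t)%:E)%E p q _ mI _ _ p0 q0.
rewrite invrK subrKC => /(_ _ _ _ erefl).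
set A := (\int[mu]_(t in _) ((f (x - t)) `^ p)%:E)%E.
have EA : (\int[mu]_t ((f (x - t))%:E * (\1_`[0%R, (2 ^- j)%R] t)%:E) `^ p = A)%E.
  rewrite /A -[RHS]integral_mul_indic; apply: eq_integral => t _.
  rewrite -!EFinM poweR_EFin powRM// indicE.
  by case: (_ \in _); rewrite ?powR1 ?powR0// gt_eqF.
have EB : (\int[mu]_t (\1_`[0%R, (2 ^- j)%R] t)%:E `^ q = (2 ^- j)%:E)%E.
  transitivity (\int[mu]_t (\1_`[0%R, (2 ^- j)%R] t)%:E)%E.
    apply: eq_integral => t _; rewrite poweR_EFin indicE.
    by case: (_ \in _); rewrite ?powR1 ?powR0// gt_eqF.
  rewrite lebesgue_integral_indic// lebesgue_measure_itv/= lte_fin expN2_gt0.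
  by rewrite oppr0 adde0.
have EC : (\int[mu]_t ((f (x - t))%:E * (\1_`[0%R, (2 ^- j)%R] t)%:E * (\1_`[0%R, (2 ^- j)%R] t)%:E)
    = \int[mu]_(t in `[0%R, (2 ^- j)%R]) (f (x - t))%:E)%E.
  rewrite -[RHS]integral_mul_indic; apply: eq_integral => t _.
  by rewrite -muleA -!EFinM !indicE; case: (_ \in _); rewrite ?mulr1 ?mulr0.
rewrite EA EB EC => h.
have {}h : ((dyavg f j x)%:E <= (2 ^+ j)%:E * (A `^ p^-1 * (2 ^- j)%:E `^ (1 - p^-1)))%E.
  rewrite unlock EFinM; apply: lee_wpmul2l; first by rewrite lee_fin exprn_ge0.
  rewrite fineK; first apply: h.
  - by apply: emeasurable_funM => //; exact/measurable_EFinP.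
  - by move=> t; rewrite mule_ge0 ?lee_fin.
  - by move=> t; rewrite lee_fin.
  rewrite (@window_itv _ (fun x => (f x)%:E))// ge0_fin_numE; first by case: lf.
  exact: integral_ge0.
rewrite -poweR_EFin.
have A0 : (0 <= A)%E by apply: integral_ge0 => t _; rewrite lee_fin powR_ge0.
apply: (le_trans (lee_poweR (ltW p0) _ h)); first by rewrite lee_fin dyavg_ge0.
rewrite poweRM ?mule_ge0 ?poweR_ge0 ?lee_fin ?exprn_ge0// poweRM ?poweR_ge0//.
rewrite -poweRrM mulVf ?gt_eqF// poweRe1// muleA muleAC.
apply: lee_wpmul2r => //.
rewrite !poweR_EFin -EFinM lee_fin -powRrM mulrBl mul1r mulVf ?gt_eqF//.
rewrite -[X in X `^ (p - 1)]powR_inv1 ?exprn_ge0// -powRrM mulN1r opprB -powRD.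
  by rewrite addrC subrK powRr1// exprn_ge0.
by rewrite (gt_eqF (exp2_gt0 j)) implybT.
Qed.

(** The discrete counterpart of $u^{p-2} |\nabla u|^2$ in the identity $\Delta u^p = p(p-1) u^{p-2}
    |\nabla u|^2$ for positive harmonic functions, on which Stein's proof of Littlewood-Paley
    inequalities rests. *)
Definition dyenergy p (j : nat) (x : R) : R := dydiff f j x ^+ 2 * dyavg f j x `^ (p - 2).

Lemma measurable_dyenergy p j : measurable_fun setT (dyenergy p j).
Proof.
apply: measurable_funM; first by apply: measurable_funX; exact: measurable_dydiff.
apply: (measurableT_comp (measurable_powR _)); exact: measurable_dyavg.
Qed.

Lemma dyenergy_ge0 p j x : 0 <= dyenergy p j x.
Proof. by rewrite mulr_ge0 ?sqr_ge0 ?powR_ge0. Qed.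

Let measurable_dyavgp p j : measurable_fun setT (fun x => (dyavg f j x `^ p)%:E).
Proof.
apply/measurable_EFinP; apply: (measurableT_comp (measurable_powR _)).
exact: measurable_dyavg.
Qed.

(** The left endpoint $a - 1 + 2^{-j}$ is such that the interval, and also its translate by
    $-2^{-(j+1)}$, lies in the interval of the next level. So each of the two values in
    [powR_mean_gap] integrates to at most the right-hand side. *)
Lemma dyenergy_step p (a b : R) j : 1 < p <= 2 ->
  (((p - 1) ^+ 2 / 2)%:E * \int[mu]_(x in `[(a - 1 + 2 ^- j)%R, b]) (dyenergy p j x)%:E +
   \int[mu]_(x in `[(a - 1 + 2 ^- j)%R, b]) (dyavg f j x `^ p)%:E <=
   \int[mu]_(x in `[(a - 1 + 2 ^- j.+1)%R, b]) (dyavg f j.+1 x `^ p)%:E)%E.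
Proof.
move=> p12; set c := (p - 1) ^+ 2 / 2.
have c0 : 0 <= c by rewrite divr_ge0// sqr_ge0.
have mE : measurable_fun setT (fun x => (dyenergy p j x)%:E).
  by apply/measurable_EFinP; exact: measurable_dyenergy.
have E0 x : (0 <= (dyenergy p j x)%:E)%E by rewrite lee_fin dyenergy_ge0.
have ms : measurable_fun setT (fun x : R => (dyavg f j.+1 (x - 2 ^- j.+1) `^ p)%:E).
  apply: (measurableT_comp (measurable_dyavgp p j.+1)).
  exact: measurable_funB.
rewrite -ge0_integralZl//; last exact: measurable_funTS.
rewrite -ge0_integralD//; last 4 first.
- by move=> x _; rewrite mule_ge0// lee_fin.
- by apply: measurable_funTS; apply: emeasurable_funM => //; exact: measurable_cst.
- by move=> x _; rewrite lee_fin powR_ge0.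
- apply: measurable_funTS; exact: measurable_dyavgp.
apply: (@le_trans _ _ (\int[mu]_(x in `[(a - 1 + 2 ^- j)%R, b])
   ((2^-1)%:E * ((dyavg f j.+1 x `^ p)%:E + (dyavg f j.+1 (x - 2 ^- j.+1) `^ p)%:E)))%E).
  apply: nneg_le_integral => x _.
    apply: adde_ge0; last by rewrite lee_fin powR_ge0.
    by apply: mule_ge0; rewrite lee_fin ?dyenergy_ge0.
  rewrite -EFinM -!EFinD -EFinM lee_fin mulrC /dyenergy dyavg_split [leRHS]mulrC mulrC.
  exact: powR_mean_gap (dyavg_ge0 _ _) (dyavg_ge0 _ _) p12.
rewrite ge0_integralZl//; last 2 first.
- by apply: measurable_funTS; apply: emeasurable_funD; [exact: measurable_dyavgp|exact: ms].
- by move=> x _; apply: adde_ge0; rewrite lee_fin powR_ge0.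
rewrite ge0_integralD//; last 4 first.
- by move=> x _; rewrite lee_fin powR_ge0.
- apply: measurable_funTS; exact: measurable_dyavgp.
- by move=> x _; rewrite lee_fin powR_ge0.
- apply: measurable_funTS; exact: ms.
rewrite (@shift_itv _ (fun x => (dyavg f j.+1 x `^ p)%:E))//; last first.
  by move=> x; rewrite lee_fin powR_ge0.
set X := (leRHS).
have X0 : (0 <= X)%E by apply: integral_ge0 => x _; rewrite lee_fin powR_ge0.
apply: (@le_trans _ _ ((2^-1)%:E * (X + X))%E).
  apply: lee_wpmul2l; first by rewrite lee_fin invr_ge0.
  have := expN2_gt0 j; have := expN2_gt0 j.+1; rewrite expN2S => h1 h2.
  apply: leeD; apply: nneg_le_integral_dom; rewrite ?lexx// => x; rewrite /= ?in_itv/= ?lee_fin ?powR_ge0//.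
  - by rewrite expN2S => /andP[ax ->]; rewrite andbT; lra.
  - by rewrite expN2S => /andP[ax bx]; apply/andP; split; lra.
rewrite ge0_muleDr// -ge0_muleDl ?lee_fin ?invr_ge0// -EFinD.
have -> : 2^-1 + 2^-1 = 1 :> R by field.
by rewrite mul1e.
Qed.

Lemma dyavg_Lp_bound p (a b : R) n : 1 < p ->
  (\int[mu]_(x in `[(a - 1)%R, b]) (dyavg f n x `^ p)%:E <=
   \int[mu]_(x in `[(a - 2)%R, b]) (f x `^ p)%:E)%E.
Proof.
move=> p1.
have mfp : measurable_fun setT (fun x => (f x `^ p)%:E).
  by apply/measurable_EFinP; exact: (measurableT_comp (measurable_powR _)).
have fp0 x : (0 <= (f x `^ p)%:E)%E by rewrite lee_fin powR_ge0.
apply: (@le_trans _ _ (\int[mu]_(x in `[(a - 1)%R, b])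
   ((2 ^+ n)%:E * \int[mu]_(t in `[0%R, (2 ^- n)%R]) ((f (x - t)) `^ p)%:E))%E).
  by apply: nneg_le_integral => x _; [rewrite lee_fin powR_ge0|exact: dyavg_jensen].
rewrite ge0_integralZl//; last 2 first.
- by apply: measurable_funTS; apply: (@measurable_window _ (fun x => (f x `^ p)%:E)).
- by move=> x _; exact: integral_ge0.
rewrite (@tonelli_window _ (fun x => (f x `^ p)%:E))//.
set X := (leRHS).
have X0 : (0 <= X)%E by exact: integral_ge0.
apply: (@le_trans _ _ ((2 ^+ n)%:E * \int[mu]_(t in `[0%R, (2 ^- n)%R]) X)%E).
  apply: lee_wpmul2l; first by rewrite lee_fin exprn_ge0.
  apply: nneg_le_integral => t; first by move=> _; exact: integral_ge0.
  rewrite /= in_itv/= => /andP[t0 t1].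
  rewrite (@shift_itv _ (fun x => (f x `^ p)%:E))//.
  apply: nneg_le_integral_dom => // x /=; rewrite !in_itv/= => /andP[ax xb].
  by have := expN2_le1 n => h; apply/andP; split; lra.
rewrite lebesgue_integral_cst// lebesgue_measure_itv/= lte_fin expN2_gt0 oppr0 adde0.
by rewrite muleCA -EFinM mulfV ?gt_eqF ?exp2_gt0// mule1.
Qed.

(** The left endpoint moves by 2: by 1 for the accumulated translations, and by 1 for the window of
    the last average in [dyavg_Lp_bound]. *)
Lemma dyenergy_sum p (a b : R) : 1 < p <= 2 ->
  (((p - 1) ^+ 2 / 2)%:E * \sum_(j <oo) \int[mu]_(x in `[a, b]) (dyenergy p j x)%:E <=
   \int[mu]_(x in `[(a - 2)%R, b]) (f x `^ p)%:E)%E.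
Proof.
move=> p12; set c := (p - 1) ^+ 2 / 2.
have c0 : 0 <= c by rewrite divr_ge0// sqr_ge0.
have i0 (g : R -> R) (D : set R) : (forall x, 0 <= g x) -> (0 <= \int[mu]_(x in D) (g x)%:E)%E.
  by move=> g0; apply: integral_ge0 => x _; rewrite lee_fin.
rewrite -nneseriesZl; last by move=> j _; apply: i0 => x; exact: dyenergy_ge0.
apply: lime_le.
  apply: is_cvg_nneseries => j _ _; rewrite mule_ge0// i0// => x.
  exact: dyenergy_ge0.
apply: nearW => n.
apply: (@le_trans _ _ (\int[mu]_(x in `[(a - 1 + 2 ^- n)%R, b]) (dyavg f n x `^ p)%:E)%E); last first.
  apply: le_trans (dyavg_Lp_bound a b n _); last by case/andP: p12.
  apply: nneg_le_integral_dom => // x; rewrite /= ?lee_fin ?powR_ge0// !in_itv/=.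
  by move=> /andP[h ->]; rewrite andbT; have := expN2_gt0 n; lra.
apply: (sume_telescope_le (v := fun n => \int[mu]_(x in `[(a - 1 + 2 ^- n)%R, b]) (dyavg f n x `^ p)%:E)%E).
  move=> k; apply: le_trans (dyenergy_step a b k p12).
  apply: leeD => //; apply: lee_wpmul2l => //.
  apply: nneg_le_integral_dom => // x; rewrite /= ?lee_fin ?dyenergy_ge0// !in_itv/=.
  by move=> /andP[h ->]; rewrite andbT; have := expN2_le1 k; lra.
by apply: i0 => x; exact: powR_ge0.
Qed.

End Locint.

End DyadicAverages.

(** * Local square function bounds *)

Section BallAverages.
Variable R : realType.
Local Notation mu := (@lebesgue_measure R).
Local Open Scope ereal_scope.
Implicit Types (g v : R -> \bar R) (r : R).

Definition bavg r g (x : R) : \bar R :=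
  ((2 * r)^-1)%:E * \int[mu]_(t in `[(- r)%R, r]) g (x - t)%R.

Lemma bavg_ge0 r g x : (0 <= r)%R -> (forall x, 0 <= g x) -> 0 <= bavg r g x.
Proof.
by move=> r0 g0; rewrite mule_ge0 ?integral_ge0// lee_fin invr_ge0 mulr_ge0.
Qed.

Lemma measurable_bavg r g : measurable_fun setT g -> (forall x, 0 <= g x) ->
  measurable_fun setT (bavg r g).
Proof. by move=> mg g0; apply: measurable_funeM; exact: measurable_window. Qed.

Lemma bavgE r g x : measurable_fun setT g -> (forall x, 0 <= g x) ->
  bavg r g x = ((2 * r)^-1)%:E * \int[mu]_(y in `[(x - r)%R, (x + r)%R]) g y.
Proof. by move=> mg g0; rewrite /bavg window_itv// opprK. Qed.

Lemma le_bavg r g h x : (0 <= r)%R -> (forall y, 0 <= g y) ->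
  (forall y, (`|x - y| <= r)%R -> g y <= h y) -> bavg r g x <= bavg r h x.
Proof.
move=> r0 g0 gh; apply: lee_wpmul2l; first by rewrite lee_fin invr_ge0 mulr_ge0.
apply: nneg_le_integral => t; rewrite //= in_itv/= => tr.
by apply: gh; rewrite subKr ler_norml.
Qed.

Lemma bavgZ (c : \bar R) r g x : (0 <= r)%R -> 0 <= c -> measurable_fun setT g -> (forall y, 0 <= g y) ->
  bavg r (fun y => c * g y) x = c * bavg r g x.
Proof.
move=> r0 c0 mg g0; rewrite /bavg ge0_integralZl//; first by rewrite muleCA.
apply: measurable_funTS; apply: measurableT_comp => //.
exact: measurable_funB.
Qed.

Lemma integral_bavg_itv r g (a b : R) : (0 < r)%R ->
  measurable_fun setT g -> (forall x, 0 <= g x) ->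
  \int[mu]_(x in `[a, b]) bavg r g x <= \int[mu]_(y in `[(a - r)%R, (b + r)%R]) g y.
Proof.
move=> r0 mg g0; rewrite /bavg ge0_integralZl//; last 3 first.
- by apply: measurable_funTS; exact: measurable_window.
- by move=> x _; exact: integral_ge0.
- by rewrite lee_fin invr_ge0 mulr_ge0// ltW.
rewrite tonelli_window//.
set X := leRHS.
have X0 : 0 <= X by exact: integral_ge0.
have r2 : (0 < 2 * r)%R by rewrite mulr_gt0.
apply: (@le_trans _ _ (((2 * r)^-1)%:E * \int[mu]_(t in `[(- r)%R, r]) X)).
  apply: lee_wpmul2l; first by rewrite lee_fin invr_ge0 ltW.
  apply: nneg_le_integral => t; first by move=> _; exact: integral_ge0.
  rewrite /= in_itv/= => /andP[t0 t1]; rewrite shift_itv//.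
  apply: nneg_le_integral_dom => // x /=; rewrite !in_itv/= => /andP[ax xb].
  by apply/andP; split; lra.
rewrite lebesgue_integral_cst// lebesgue_measure_itv/= lte_fin gtrN// -EFinD opprK.
rewrite muleCA -EFinM (_ : (_ * _)%R = 1%R) ?mule1//.
by field; rewrite gt_eqF.
Qed.

(** Averaging over balls is convolution with an even kernel, hence self-adjoint: after Tonelli, a
    translation in [x] and the reflection of [t] exchange the two functions. *)
Lemma bavg_duality r g v :
  measurable_fun setT g -> (forall x, 0 <= g x) ->
  measurable_fun setT v -> (forall x, 0 <= v x) -> (0 <= r)%R ->
  \int[mu]_x (v x * bavg r g x) = \int[mu]_y (g y * bavg r v y).
Proof.
move=> mg g0 mv v0 r0.
have ri : 0 <= ((2 * r)^-1)%:E by rewrite lee_fin invr_ge0 mulr_ge0.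
have mvg (t : R) : measurable_fun setT (fun x : R => v x * g (x - t)%R).
  by apply: emeasurable_funM => //; apply: measurableT_comp => //; exact: measurable_funB.
have mwg : measurable_fun setT (fun x : R => \int[mu]_(t in `[(- r)%R, r]) g (x - t)%R).
  exact: measurable_window.
have mwv : measurable_fun setT (fun x : R => \int[mu]_(t in `[(- r)%R, r]) v (x - t)%R).
  exact: measurable_window.
rewrite /bavg.
under eq_integral do rewrite muleCA.
under [in RHS]eq_integral do rewrite muleCA.
rewrite ge0_integralZl//; last 2 first.
- exact: emeasurable_funM.
- by move=> x _; rewrite mule_ge0// integral_ge0.
rewrite ge0_integralZl//; last 2 first.
- exact: emeasurable_funM.
- by move=> x _; rewrite mule_ge0// integral_ge0.
congr (_ * _).
pose F (z : R * R) := v z.1 * (g (z.1 - z.2)%R * (\1_`[(- r)%R, r] z.2)%:E).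
have mi : measurable_fun setT (fun t : R => (\1_(`[(- r)%R, r]%classic : set R) t)%:E : \bar R).
  by apply/measurable_EFinP; exact: measurable_indic.
have mF : measurable_fun setT F.
  apply: emeasurable_funM; first exact: measurableT_comp.
  apply: emeasurable_funM; first by apply: measurableT_comp => //; exact: measurable_funB.
  by apply: (measurableT_comp mi); exact: measurable_snd.
have F0 z : 0 <= F z by rewrite /F !mule_ge0.
transitivity (\int[mu]_x \int[mu]_t F (x, t)).
  apply: eq_integral => x _; rewrite -integral_mul_indic -ge0_integralZl//.
  - apply: emeasurable_funM; last exact: mi.
    by apply: measurableT_comp => //; exact: measurable_funB.
  - by move=> t _; rewrite mule_ge0.
rewrite fubini_tonelli//.
pose G (z : R * R) := g z.1 * (v (z.1 - z.2)%R * (\1_`[(- r)%R, r] z.2)%:E).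
have mG : measurable_fun setT G.
  apply: emeasurable_funM; first exact: measurableT_comp.
  apply: emeasurable_funM; first by apply: measurableT_comp => //; exact: measurable_funB.
  by apply: (measurableT_comp mi); exact: measurable_snd.
have G0 z : 0 <= G z by rewrite /G !mule_ge0.
transitivity (\int[mu]_x \int[mu]_t G (x, t)); last first.
  apply: eq_integral => x _; rewrite -[in RHS]integral_mul_indic -ge0_integralZl//.
  - apply: emeasurable_funM; last exact: mi.
    by apply: measurableT_comp => //; exact: measurable_funB.
  - by move=> t _; rewrite mule_ge0.
rewrite [RHS]fubini_tonelli//.
have mGy : measurable_fun setT (fun t : R => \int[mu]_x G (x, t)).
  exact: (@measurable_fun_fubini_tonelli_G _ _ _ _ _ mu G mG G0).
transitivity (\int[mu]_t \int[mu]_x G (x, - t)%R); last first.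
  apply/esym; apply: (ge0_integral_opp mGy) => t.
  by apply: integral_ge0 => x _; exact: G0.
apply: eq_integral => t _.
have mFt : measurable_fun setT (fun x : R => F (x, t)).
  by apply: (measurableT_comp mF); exact: pair2_measurable.
rewrite [LHS](ge0_integral_shift t mFt (fun x => F0 (x, t))).
apply: eq_integral => x _.
rewrite /F/G/= addrK opprK muleCA; congr (_ * (_ * _)).
by rewrite !indicE; congr (nat_of_bool _)%:R%:E; apply: asbool_equiv_eq; rewrite /= !in_itv/=; split => /andP[? ?]; apply/andP; split; lra.
Qed.

(** The interval of radius [r] around [y] lies in the ball of radius $4r$ around [z], which is four
    times as long. *)
Lemma bavg_le_HL (v : R -> R) r (y z : R) : measurable_fun setT v ->
  (forall x, 0 <= v x)%R -> (0 < r)%R -> (`|y - z| <= r)%R ->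
  bavg r (fun x => (v x)%:E) y <= 4%:E * HL_maximal v z.
Proof.
move=> mv v0 r0 yz; rewrite bavgE//; last by apply/measurable_EFinP.
have r4 : (0 < 4 * r)%R by rewrite mulr_gt0.
apply: le_trans (lee_wpmul2l _ (iavg_le_HL v z r4)); last by rewrite lee_fin.
rewrite /iavg lebesgue_measure_ball ?(ltW r4)// inver mulrn_eq0/= gt_eqF// muleA -EFinM.
have -> : (4 * (4 * r *+ 2)^-1 = (2 * r)^-1)%R by field; rewrite gt_eqF.
apply: lee_wpmul2l; first by rewrite lee_fin invr_ge0 mulr_ge0// ltW.
apply: nneg_le_integral_dom => // x /=; rewrite ?lee_fin ?v0//.
- rewrite in_itv/= => /andP[x1 x2]; rewrite /ball/= ltr_norml.
  move: yz; rewrite ler_norml => /andP[y1 y2]; apply/andP; split; lra.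
- by rewrite ger0_norm.
Qed.

End BallAverages.

(** * Sums over scales of ball averages *)

Section SquareSums.
Variable R : realType.
Local Notation mu := (@lebesgue_measure R).
Local Notation HL := (@HL_maximal R).
Implicit Types (f : R -> R) (p : R).

Lemma integral_itv_unit_bound (g : R -> \bar R) (M : \bar R) (a b : R) (n : nat) :
  measurable_fun setT g -> (forall x, 0 <= g x)%E ->
  (forall x, \int[mu]_(y in `[x, (x + 1)%R]) g y <= M)%E ->
  b <= a + n%:R -> (\int[mu]_(x in `[a, b]) g x <= n%:R%:E * M)%E.
Proof.
move=> mg g0 gM.
have M0 : (0 <= M)%E by apply: le_trans (gM 0); exact: integral_ge0.
elim: n b => [|n IH] b ab.
  rewrite mul0e; apply: (@le_trans _ _ (\int[mu]_(x in `[a, a]) g x)%E).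
    by apply: nneg_le_integral_dom => // x /=; rewrite !in_itv/= => /andP[-> xb]; lra.
  by rewrite set_itv1 integral_set1.
have [ba|ba] := leP b (a + n%:R).
  by apply: le_trans (IH _ ba) _; apply: lee_wpmul2r => //; rewrite lee_fin ler_nat.
rewrite (@integral_itv_split _ _ _ (a + n%:R))//; [|by rewrite lerDl|exact: ltW].
rewrite -addn1 natrD EFinD ge0_muleDl ?lee_fin// mul1e.
apply: leeD; first exact: IH.
apply: le_trans (gM (a + n%:R)); apply: nneg_le_integral_dom => // x /=.
rewrite !in_itv/= => /andP[-> xb]/=; apply: le_trans xb _.
by rewrite -addrA -natr1 in ab *.
Qed.

(** Hölder's inequality with the exponents $1/(1-t)$ and $1/t$; the endpoint $t = 1$ corresponds to
    $p = 2$. *)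
Lemma ge0_hoelder_interp (a b : R -> \bar R) (t : R) :
  measurable_fun setT a -> measurable_fun setT b ->
  (forall x, 0 <= a x)%E -> (forall x, 0 <= b x)%E -> 0 < t <= 1 ->
  (\int[mu]_x (a x `^ (1 - t) * b x `^ t) <=
   (\int[mu]_x a x) `^ (1 - t) * (\int[mu]_x b x) `^ t)%E.
Proof.
move=> ma mb a0 b0 /andP[t0]; rewrite le_eqVlt => /orP[/eqP->|t1].
  rewrite subrr !poweRe0 mul1e poweRe1 ?integral_ge0//.
  under eq_integral do rewrite poweRe0 mul1e poweRe1//.
  by [].
have t1' : 0 < 1 - t by rewrite subr_gt0.
have h := @ge0_hoelder _ _ _ mu (fun x => a x `^ (1 - t))%E (fun x => b x `^ t)%E (1 - t)^-1 t^-1.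
apply: le_trans (h _ _ _ _ _ _ _) _; rewrite ?invr_gt0//.
- exact: (measurableT_comp (measurable_poweR _)).
- exact: (measurableT_comp (measurable_poweR _)).
- by move=> x; exact: poweR_ge0.
- by move=> x; exact: poweR_ge0.
- by rewrite !invrK subrK.
rewrite !invrK.
under eq_integral do rewrite -poweRrM mulfV ?gt_eqF// poweRe1//.
under [X in (_ * X `^ _)%E]eq_integral do rewrite -poweRrM mulfV ?gt_eqF// poweRe1//.
by [].
Qed.

(** The delicate case is $u_j = 0$: by [dyavg_split] two nonnegative values then have mean zero, so
    both vanish, and with them the difference. *)
Lemma dydiff_sqr_le f p j x : nneg_locint f -> p <= 2 ->
  (dydiff f j x) ^+ 2 = dyavg f j x `^ (2 - p) * dyenergy f p j x.
Proof.
move=> lf p2; rewrite /dyenergy.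
have := dyavg_ge0 lf j x; rewrite le_eqVlt => /orP[/eqP u0|u0].
  have : dydiff f j x = 0.
    move: u0; rewrite (dyavg_split lf) /dydiff.
    by have := dyavg_ge0 lf j.+1 x; have := dyavg_ge0 lf j.+1 (x - 2 ^- j.+1); lra.
  by move=> ->; rewrite expr0n/= mul0r mulr0.
rewrite mulrCA -powRD ?(gt_eqF u0) ?implybT//.
by rewrite (_ : 2 - p + (p - 2) = 0) ?powRr0 ?mulr1//; ring.
Qed.

(** The window of length $2^{-(k+m)}$ lies in the ball of radius $4 \cdot 2^{i-k}$ around [x], and
    the ratio of the lengths is $8 \cdot 2^{m+i}$. The function [g] stands for a cut-off of [f], as
    the maximal theorem is stated for integrable functions. *)
Lemma dyavg_le_HL f g (D : set R) (k m i : nat) (x y : R) : nneg_locint f ->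
  (forall z, D z -> g z = f z) -> (forall z, 0 <= g z) -> measurable_fun setT g ->
  ball x (4 * (2 ^+ i * 2 ^- k)) `<=` D ->
  `|x - y| <= 2 ^+ i * 2 ^- k ->
  ((dyavg f (k + m) y)%:E <= (8 * 2 ^+ (m + i))%:E * HL g x)%E.
Proof.
move=> lf gf g0 mg BD xy.
have [mf f0 _] := lf.
set r := 2 ^+ i * 2 ^- k in BD xy.
have r0 : 0 < r by rewrite mulr_gt0 ?exp2_gt0 ?expN2_gt0.
have r4 : 0 < 4 * r by rewrite mulr_gt0.
have hr : 2 ^- (k + m) <= r.
  rewrite exprD invfM mulrC /r ler_pM2r ?expN2_gt0//.
  by rewrite (le_trans (expN2_le1 _ _))// exprn_ege1// ler1n.
rewrite dyavgE//.
apply: le_trans (lee_wpmul2l _ (iavg_le_HL g x r4)); last first.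
  by rewrite lee_fin mulr_ge0// exprn_ge0.
rewrite /iavg lebesgue_measure_ball ?(ltW r4)// inver mulrn_eq0/= gt_eqF// muleA -EFinM.
have -> : 8 * 2 ^+ (m + i) * (4 * r *+ 2)^-1 = 2 ^+ (k + m).
  rewrite /r !exprD; field; rewrite ?gt_eqF ?exp2_gt0//.
apply: lee_wpmul2l; first by rewrite lee_fin exprn_ge0.
have sub z : `[y - 2 ^- (k + m), y]%classic z -> ball x (4 * r) z.
  rewrite /ball/= in_itv/= => /andP[z1 z2]; rewrite ltr_norml.
  move: xy; rewrite ler_norml => /andP[y1 y2]; apply/andP; split; lra.
apply: nneg_le_integral_dom => // z; rewrite ?lee_fin ?f0// => zy.
by rewrite gf ?ger0_norm ?f0//; apply: BD; exact: sub.
Qed.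

(** Level [k] is averaged at the scale $2^{i-k}$ of the [i]-th shell of the kernel; the offset [m]
    enters through [g], as a shift of the level of the difference. *)
Definition dysum (g : nat -> R -> R) (i : nat) (x : R) : \bar R :=
  (\sum_(k <oo) bavg (2 ^+ i * 2 ^- k) (fun y => (g k y)%:E) x)%E.

Lemma dyrad_gt0 i k : 0 < 2 ^+ i * 2 ^- k :> R.
Proof. by rewrite mulr_gt0 ?exp2_gt0 ?expN2_gt0. Qed.

Lemma measurable_dysum (g : nat -> R -> R) i : (forall k, measurable_fun setT (g k)) ->
  (forall k x, 0 <= g k x) -> measurable_fun setT (dysum g i).
Proof.
move=> mg g0; apply: ge0_emeasurable_sum.
  by move=> k x _ _; apply: bavg_ge0 => [|y]; rewrite ?lee_fin// ltW// dyrad_gt0.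
by move=> k _; apply: measurable_bavg => [|y]; [exact/measurable_EFinP|rewrite lee_fin].
Qed.

Lemma dysum_ge0 g i x : (forall k x, 0 <= g k x) -> (0 <= dysum g i x)%E.
Proof.
move=> g0; apply: nneseries_ge0 => k _ _; by apply: bavg_ge0 => [|y]; rewrite ?lee_fin// ltW// dyrad_gt0.
Qed.

Lemma integral_dysum (g : nat -> R -> R) i (a b : R) : (forall k, measurable_fun setT (g k)) ->
  (forall k x, 0 <= g k x) ->
  (\int[mu]_(x in `[a, b]) dysum g i x <=
   \sum_(k <oo) \int[mu]_(x in `[(a - 2 ^+ i)%R, (b + 2 ^+ i)%R]) (g k x)%:E)%E.
Proof.
move=> mg g0.
have mgE k : measurable_fun setT (fun y => (g k y)%:E) by exact/measurable_EFinP.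
have gE0 k y : (0 <= (g k y)%:E)%E by rewrite lee_fin.
rewrite integral_nneseries//; last 2 first.
- by move=> k; apply: measurable_funTS; exact: measurable_bavg.
- by move=> k x _; apply: bavg_ge0 => //; rewrite ltW// dyrad_gt0.
apply: lee_nneseries => k _.
  by move=> _; apply: integral_ge0 => x _; apply: bavg_ge0 => //; rewrite ltW// dyrad_gt0.
apply: le_trans (integral_bavg_itv _ _ (dyrad_gt0 i k) (mgE k) (gE0 k)) _.
have h : 2 ^+ i * 2 ^- k <= 2 ^+ i :> R by rewrite ler_piMr ?expN2_le1// exprn_ge0.
apply: nneg_le_integral_dom => // x /=; rewrite !in_itv/= => /andP[ax xb].
by apply/andP; split; lra.
Qed.

Definition cutoff f (D : set R) (x : R) : R := f x * \1_D x.

(** Contains every ball of radius $4 \cdot 2^{i-k}$, $k \ge 0$, centred in the unit interval that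
    starts at [x0]. *)
Definition dywide (x0 : R) (i : nat) : set R :=
  `[x0 - 4 * 2 ^+ i, x0 + 1 + 4 * 2 ^+ i]%classic.

(** The factor $u^{2-p}$ of [dydiff_sqr_le] is bounded by one value of the maximal function, the
    same for all levels and all points of the balls, and can therefore be taken out of the sum. *)
Lemma dysum_sqr_le f p (m i : nat) (x0 x : R) : nneg_locint f -> 1 < p <= 2 ->
  x0 <= x <= x0 + 1 ->
  (dysum (fun k y => dydiff f (k + m) y ^+ 2)%R i x <=
   ((8 * 2 ^+ (m + i))%:E * HL (cutoff f (dywide x0 i)) x) `^ (2 - p) *
   dysum (fun k => dyenergy f p (k + m)) i x)%E.
Proof.
move=> lf /andP[p1 p2] /andP[x0x xx0].
have [mf f0 _] := lf.
set D := dywide x0 i; set g := cutoff f D.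
have g0 z : 0 <= g z by rewrite mulr_ge0.
have mD : measurable D by exact: measurable_itv.
have mg : measurable_fun setT g by apply: measurable_funM => //; exact: measurable_indic.
have lg : locally_integrable setT g.
  split => //; first exact: openT.
  move=> K _ cK.
  have [_ _ /(_ (x0 - 4 * 2 ^+ i) (x0 + 1 + 4 * 2 ^+ i))] := lf.
  apply: le_lt_trans; rewrite -[leRHS]integral_mul_indic.
  apply: nneg_le_integral_dom => // z _; rewrite ?lee_fin ?mulr_ge0//.
  by rewrite ger0_norm.
set c := (_ `^ (2 - p))%E.
have c0 : (0 <= c)%E by exact: poweR_ge0.
have mE k : measurable_fun setT (fun y => (dyenergy f p (k + m) y)%:E).
  by apply/measurable_EFinP; exact: measurable_dyenergy.
have E0 k y : (0 <= (dyenergy f p (k + m) y)%:E)%E by rewrite lee_fin dyenergy_ge0.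
have key k : (bavg (2 ^+ i * 2 ^- k) (fun y => (dydiff f (k + m) y ^+ 2)%:E) x <=
    c * bavg (2 ^+ i * 2 ^- k) (fun y => (dyenergy f p (k + m) y)%:E) x)%E.
  rewrite -(bavgZ x (ltW (dyrad_gt0 i k)) c0 (mE k) (E0 k)).
  apply: le_bavg => [|y|y xy]; first by rewrite ltW// dyrad_gt0.
    by rewrite lee_fin sqr_ge0.
  rewrite (dydiff_sqr_le _ _ lf p2) EFinM; apply: lee_wpmul2r => //.
  rewrite -poweR_EFin; apply: lee_poweR; rewrite ?subr_ge0 ?lee_fin ?dyavg_ge0//.
  apply: (dyavg_le_HL (D := D)) => //.
    by move=> z Dz; rewrite /g /cutoff indicE mem_set// mulr1.
  move=> z; rewrite /ball/= /D/dywide/= in_itv/= ltr_norml => /andP[z1 z2].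
  have h : 2 ^+ i * 2 ^- k <= 2 ^+ i :> R by rewrite ler_piMr ?expN2_le1// exprn_ge0.
  by apply/andP; split; lra.
rewrite /dysum.
(* Where the factor is infinite, the bound is trivial unless the sum of the energies vanishes; then
   every term on the left vanishes too. *)
have [coo|cfin] := eqVneq c +oo%E; last first.
  have cf : c \is a fin_num by rewrite ge0_fin_numE// ltey.
  rewrite -[in leRHS](fineK cf) -nneseriesZl; last first.
    by move=> k _; apply: bavg_ge0 => //; rewrite ltW// dyrad_gt0.
  apply: lee_nneseries => k _.
    by move=> _; apply: bavg_ge0 => [|y]; rewrite ?lee_fin ?sqr_ge0// ltW// dyrad_gt0.
  by rewrite fineK.
set S := (X in (_ <= _ * X)%E).
have : (0 <= S)%E by apply: dysum_ge0 => k y; exact: dyenergy_ge0.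
rewrite le_eqVlt => /orP[/eqP S0|S0]; last by rewrite coo gt0_mulye// leey.
rewrite -S0 mule0.
have bz k : bavg (2 ^+ i * 2 ^- k) (fun y => (dyenergy f p (k + m) y)%:E) x = 0%E.
  apply/eqP; rewrite eq_le; apply/andP; split; last first.
    by apply: bavg_ge0 => //; rewrite ltW// dyrad_gt0.
  rewrite S0 /S; apply: le_trans (nneseries_lim_ge k.+1 _); last first.
    by move=> n _ _; apply: bavg_ge0 => //; rewrite ltW// dyrad_gt0.
  rewrite big_nat_recr//= leeDr// sume_ge0// => n _.
  by apply: bavg_ge0 => //; rewrite ltW// dyrad_gt0.
rewrite eseries0// => k _ _; apply/eqP; rewrite eq_le; apply/andP; split.
  by apply: le_trans (key k) _; rewrite bz mule0.
by apply: bavg_ge0 => [|y]; rewrite ?lee_fin ?sqr_ge0// ltW// dyrad_gt0.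
Qed.

End SquareSums.

(** * Local bounds for a fixed pair of offsets *)

Section LocalBounds.
Variable R : realType.
Local Notation mu := (@lebesgue_measure R).
Local Notation HL := (@HL_maximal R).
Implicit Types (f : R -> R) (p : R).

Lemma le_nneseries_shift (u : nat -> \bar R) (m : nat) : (forall k, 0 <= u k)%E ->
  (\sum_(k <oo) u (k + m)%N <= \sum_(k <oo) u k)%E.
Proof.
move=> u0; apply: lime_le; first by apply: is_cvg_nneseries.
apply: nearW => n; apply: le_trans (nneseries_lim_ge (n + m) _) => //.
elim: n => [|n IH]; first by rewrite [leLHS]big_mkord big_ord0 sume_ge0.
by rewrite addSn big_nat_recr//= [leRHS]big_nat_recr//= leeD2r.
Qed.

Lemma measurable_cutoff f (D : set R) : measurable D -> measurable_fun setT f ->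
  measurable_fun setT (cutoff f D).
Proof. by move=> mD mf; apply: measurable_funM => //; exact: measurable_indic. Qed.

Lemma integral_cutoff_powR f (D : set R) p : 0 < p -> (forall x, 0 <= f x) ->
  (\int[mu]_x (cutoff f D x `^ p)%:E = \int[mu]_(x in D) (f x `^ p)%:E)%E.
Proof.
move=> p0 f0; rewrite -[RHS]integral_mul_indic; apply: eq_integral => x _.
rewrite /cutoff indicE -EFinM; case: (_ \in _); rewrite ?mulr1// !mulr0.
by rewrite powR0// gt_eqF.
Qed.

Lemma integrable_cutoff f (a b : R) : nneg_locint f ->
  mu.-integrable setT (EFin \o cutoff f `[a, b]%classic).
Proof.
move=> [mf f0 fi]; apply/integrableP; split.
  by apply/measurable_EFinP; apply: measurable_cutoff.
apply: le_lt_trans (fi a b); rewrite -[leRHS]integral_mul_indic.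
apply: nneg_le_integral => x _ //=.
by rewrite lee_fin ger0_norm// mulr_ge0.
Qed.

Lemma nneg_locint_cutoff f (D : set R) : measurable D -> nneg_locint f ->
  nneg_locint (cutoff f D).
Proof.
move=> mD [mf f0 fi]; split => [||a b].
- exact: measurable_cutoff.
- by move=> x; rewrite mulr_ge0.
apply: le_lt_trans (fi a b); apply: nneg_le_integral => x _; rewrite lee_fin ?mulr_ge0//.
by rewrite /cutoff indicE; case: (_ \in _); rewrite ?mulr1 ?mulr0.
Qed.

(** The constant 10 arises because the enlarged interval has length $3 + 2 \cdot 2^i$ and is covered
    by $5 \cdot 2^i$ unit intervals, while the gap constant is $(p-1)^2/2$. *)
Lemma integral_dysum_energy f p (M : R) (x0 : R) (m i : nat) :
  nneg_locint f -> 1 < p <= 2 ->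
  (forall x, \int[mu]_(y in `[x, (x + 1)%R]) (f y `^ p)%:E <= M%:E)%E ->
  (\int[mu]_(x in `[x0, (x0 + 1)%R]) dysum (fun k => dyenergy f p (k + m)) i x <=
   (10 / (p - 1) ^+ 2 * (2 ^+ i * M))%:E)%E.
Proof.
move=> lf p12 fM; have /andP[p1 p2] := p12.
have [mf f0 _] := lf.
have mfp : measurable_fun setT (fun x => (f x `^ p)%:E).
  by apply/measurable_EFinP; exact: (measurableT_comp (measurable_powR _)).
have fp0 x : (0 <= (f x `^ p)%:E)%E by rewrite lee_fin powR_ge0.
have p1' : 0 < (p - 1) ^+ 2 by rewrite exprn_gt0// subr_gt0.
apply: le_trans (integral_dysum _ _ _ _ _) _.
- by move=> k; exact: measurable_dyenergy.
- by move=> k x; exact: dyenergy_ge0.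
set a := x0 - 2 ^+ i; set b := x0 + 1 + 2 ^+ i.
apply: le_trans (@le_nneseries_shift (fun j => \int[mu]_(x in `[a, b]) (dyenergy f p j x)%:E)%E m _) _.
  by move=> k; apply: integral_ge0 => x _; rewrite lee_fin dyenergy_ge0.
have := dyenergy_sum lf a b p12.
set S := (\sum_(j <oo) _)%E => h.
have {}h : (((p - 1) ^+ 2 / 2)%:E * S <= (5 * (2 ^+ i * M))%:E)%E.
  apply: le_trans h _; apply: le_trans (integral_itv_unit_bound (n := 5 * 2 ^ i) mfp fp0 fM _) _.
    rewrite natrM natrX /a /b.
    have : 1 <= 2 ^+ i :> R by rewrite exprn_ege1// ler1n.
    by move=> h; lra.
  by rewrite natrM natrX -EFinM mulrA.
rewrite -(@lee_pmul2l _ ((p - 1) ^+ 2 / 2)%:E)//; last by rewrite lte_fin divr_gt0.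
apply: le_trans h _; rewrite -EFinM lee_fin; apply: eq_ler.
by field; rewrite gt_eqF// subr_gt0.
Qed.

Lemma powR_interp (K A B X t : R) : 0 <= K -> 0 <= A -> 0 <= B -> 0 <= X ->
  (K * (A * X)) `^ (1 - t) * (B * X) `^ t = K `^ (1 - t) * A `^ (1 - t) * B `^ t * X.
Proof.
move=> K0 A0 B0 X0; rewrite !powRM ?mulr_ge0//.
have {3}-> : X = X `^ (1 - t) * X `^ t by rewrite -powRD ?subrK ?powRr1 ?oner_eq0.
by ring.
Qed.

(** Hölder's inequality with $t = p/2$ separates the maximal function, which is controlled in $L^p$,
    from the energies, which telescope. Both integrals are multiples of $2^i M$ and their powers
    recombine to one such factor; a loss comes only from $K = 8 \cdot 2^{m+i}$, to the power
    $p(1-t)$. *)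
Lemma local_square_bound_le2 p : 1 < p <= 2 ->
  exists2 C : R, 0 <= C & forall f (M : R) (x0 : R) (m i : nat), nneg_locint f ->
    (forall x, \int[mu]_(y in `[x, (x + 1)%R]) (f y `^ p)%:E <= M%:E)%E ->
    (\int[mu]_(x in `[x0, (x0 + 1)%R])
       (dysum (fun k y => dydiff f (k + m) y ^+ 2)%R i x `^ (p / 2)%R) <=
     (C * (2 ^+ (m + i)) `^ (p * (2 - p) / 2) * (2 ^+ i * M))%:E)%E.
Proof.
move=> p12; have /andP[p1 p2] := p12.
have p0 : 0 < p by exact: lt_trans p1.
have [C1 C10 hHL] := HL_maximal_Lp p1.
pose c := 10 / (p - 1) ^+ 2.
have c0 : 0 <= c by rewrite divr_ge0// sqr_ge0.
pose t := p / 2.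
have t01 : 0 < t <= 1 by rewrite /t; lra.
have /andP[t0 t1] := t01.
have t1' : 0 <= 1 - t by rewrite subr_ge0.
exists (8 `^ (p * (1 - t)) * (9 * C1) `^ (1 - t) * c `^ t).
  by rewrite !mulr_ge0 ?powR_ge0.
move=> f M x0 m i lf fM; have [mf f0 _] := lf.
have mfp : measurable_fun setT (fun x => (f x `^ p)%:E).
  by apply/measurable_EFinP; exact: (measurableT_comp (measurable_powR _)).
have fp0 x : (0 <= (f x `^ p)%:E)%E by rewrite lee_fin powR_ge0.
have M0 : 0 <= M by rewrite -lee_fin; apply: le_trans (fM 0); exact: integral_ge0.
pose K : R := 8 * 2 ^+ (m + i).
have K0 : 0 <= K by rewrite mulr_ge0// exprn_ge0.
pose D := dywide x0 i; pose g := cutoff f D.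
have mD : measurable D by exact: measurable_itv.
have mg : measurable_fun setT g by exact: measurable_cutoff.
have g0 x : 0 <= g x by rewrite mulr_ge0.
have ig : mu.-integrable setT (EFin \o g) by exact: integrable_cutoff.
have lg : locally_integrable setT g by apply: open_integrable_locally => //; exact: openT.
have mH := measurable_HL_maximal lg.
have H0 x : (0 <= HL g x)%E by exact: HL_maximalT_ge0.
pose I : set R := `[x0, x0 + 1]%classic.
pose E := dysum (fun k => dyenergy f p (k + m)) i.
have mE : measurable_fun setT E.
  by apply: measurable_dysum => [k|k x]; [exact: measurable_dyenergy|exact: dyenergy_ge0].
have E0 x : (0 <= E x)%E by apply: dysum_ge0 => k y; exact: dyenergy_ge0.
pose a x := ((K%:E * HL g x) `^ p)%E.
pose b x := (E x * (\1_I x)%:E)%E.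
have mI : measurable_fun setT (fun x => (\1_I x)%:E : \bar R).
  by apply/measurable_EFinP; apply: measurable_indic; exact: measurable_itv.
have mKH : measurable_fun setT (fun x => (K%:E * HL g x)%E) by exact: measurable_funeM.
have ma : measurable_fun setT a by exact: (measurableT_comp (measurable_poweR _)).
have mb : measurable_fun setT b by exact: emeasurable_funM.
have a0 x : (0 <= a x)%E by exact: poweR_ge0.
have b0 x : (0 <= b x)%E by rewrite mule_ge0.
apply: (@le_trans _ _ (\int[mu]_x (a x `^ (1 - t) * b x `^ t))%E).
  apply: nneg_le_integral_dom => //.
  - by move=> x _; rewrite mule_ge0// poweR_ge0.
  - by move=> x _; exact: poweR_ge0.
  move=> x xI; rewrite -/t.
  have -> : (a x `^ (1 - t) * b x `^ t = (((K%:E * HL g x) `^ (2 - p)) * E x) `^ t)%E.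
    rewrite poweRM ?poweR_ge0// /b indicE mem_set// mule1 /a -!poweRrM; congr (_ `^ _ * _)%E.
    by rewrite /t; field.
  apply: lee_poweR; first exact: ltW.
    by apply: dysum_ge0 => k y; exact: sqr_ge0.
  by apply: (dysum_sqr_le _ _ lf p12 (x0 := x0)); move: xI; rewrite /= in_itv.
apply: le_trans (ge0_hoelder_interp ma mb a0 b0 t01) _.
have ia : (\int[mu]_x a x <= (K `^ p * (9 * C1 * (2 ^+ i * M)))%:E)%E.
  rewrite /a; under eq_integral do rewrite poweRM// poweR_EFin.
  rewrite ge0_integralZl//; last 3 first.
  - exact: (measurableT_comp (measurable_poweR _)).
  - by move=> x _; exact: poweR_ge0.
  - by rewrite lee_fin powR_ge0.
  rewrite EFinM; apply: lee_wpmul2l; first by rewrite lee_fin powR_ge0.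
  apply: le_trans (hHL g mg g0 ig) _.
  rewrite integral_cutoff_powR//.
  (* The interval [D] has length $1 + 8 \cdot 2^i \le 9 \cdot 2^i$. *)
  apply: (@le_trans _ _ (C1%:E * ((9 * 2 ^ i)%:R%:E * M%:E))%E).
    apply: lee_wpmul2l => //; apply: (integral_itv_unit_bound mfp fp0 fM).
    rewrite natrM natrX.
    have : 1 <= 2 ^+ i :> R by rewrite exprn_ege1// ler1n.
    by move=> h; lra.
  by rewrite natrM natrX -!EFinM lee_fin; apply: eq_ler; ring.
have ib : (\int[mu]_x b x <= (c * (2 ^+ i * M))%:E)%E.
  by rewrite integral_mul_indic; exact: integral_dysum_energy.
set X := 2 ^+ i * M in ia ib *.
have X0 : 0 <= X by rewrite mulr_ge0// exprn_ge0.
apply: le_trans (lee_pmul _ _ (lee_poweR t1' _ ia) (lee_poweR (ltW t0) _ ib)) _.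
- exact: poweR_ge0.
- exact: poweR_ge0.
- by apply: integral_ge0 => x _.
- by apply: integral_ge0 => x _.
rewrite !poweR_EFin -EFinM lee_fin; apply: eq_ler.
rewrite (powR_interp t (powR_ge0 K p) (mulr_ge0 (ler0n R 9) C10) c0 X0).
rewrite /K powRM ?exprn_ge0// powRM ?powR_ge0// -!powRrM.
have -> : p * (2 - p) / 2 = p * (1 - t) by rewrite /t; field.
by ring.
Qed.

Lemma dyavg_local f g j (x : R) :
  (forall z, x - 2 ^- j <= z <= x -> g z = f z) -> dyavg g j x = dyavg f j x.
Proof.
move=> gf; rewrite unlock; congr (_ * fine _)%R; apply: eq_integral => t.
rewrite inE/= in_itv/= => /andP[t0 t1]; rewrite gf//.
by apply/andP; split; lra.
Qed.

Lemma dydiff_local f g j (x : R) :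
  (forall z, x - 2 ^- j <= z <= x -> g z = f z) -> dydiff g j x = dydiff f j x.
Proof.
move=> gf; rewrite /dydiff !(@dyavg_local f g)//.
- move=> z; rewrite expN2S => /andP[z1 z2]; apply: gf.
  by have := expN2_gt0 R j => h; apply/andP; split; lra.
- move=> z; rewrite expN2S => /andP[z1 z2]; apply: gf.
  by have := expN2_gt0 R j => h; apply/andP; split; lra.
Qed.

(* Where the weight exceeds l, the difference only sees f on the set where
   W exceeds l; the unweighted estimate for this cut-off function is then
   integrated over the level l. *)
Lemma weighted_dydiff_bound f (W : R -> \bar R) (w : nat -> R -> \bar R)
    (m : nat) (a b : R) :
  nneg_locint f -> measurable_fun setT W -> (forall x, 0 <= W x)%E ->
  (forall k, measurable_fun setT (w k)) -> (forall k x, 0 <= w k x)%E ->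
  (forall k y z, (y - 2 ^- (k + m) <= z <= y)%R -> w k y <= W z)%E ->
  (\sum_(k <oo) \int[mu]_(x in `[a, b]) ((dydiff f (k + m) x ^+ 2)%:E * w k x) <=
   2%:E * \int[mu]_(x in `[(a - 2)%R, b]) ((f x `^ 2)%:E * W x))%E.
Proof.
move=> lf mW W0 mw w0 wW; have [mf f0 _] := lf.
have mind (c e : R) : measurable_fun setT (fun x => (\1_(`[c, e]%classic : set R) x)%:E : \bar R).
  by apply/measurable_EFinP; apply: measurable_indic; exact: measurable_itv.
pose d k x := ((dydiff f (k + m) x ^+ 2)%:E * (\1_(`[a, b]%classic : set R) x)%:E)%E.
have d0 k x : (0 <= d k x)%E by rewrite mule_ge0// lee_fin sqr_ge0.
have md k : measurable_fun setT (d k).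
  apply: emeasurable_funM; last exact: mind.
  by apply/measurable_EFinP; apply: measurable_funX; exact: measurable_dydiff.
pose h x := ((f x `^ 2)%:E * (\1_(`[a - 2, b]%classic : set R) x)%:E)%E.
have h0 x : (0 <= h x)%E by rewrite mule_ge0// lee_fin powR_ge0.
have mh : measurable_fun setT h.
  apply: emeasurable_funM; last exact: mind.
  by apply/measurable_EFinP; exact: (measurableT_comp (measurable_powR _)).
have -> : (\int[mu]_(x in `[(a - 2)%R, b]) ((f x `^ 2)%:E * W x) =
    \int[mu]_(l in `[0%R, +oo[) \int[mu]_(x in [set x : R | l%:E < W x]) h x)%E.
  rewrite -ge0_layer_cake// -integral_mul_indic; apply: eq_integral => x _.
  by rewrite /h muleAC.
rewrite -ge0_integralZl//; last 2 first.
- by apply: measurable_funTS; exact: measurable_layer.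
- by move=> l _; exact: integral_ge0.
have -> : (\sum_(k <oo) \int[mu]_(x in `[a, b]) ((dydiff f (k + m) x ^+ 2)%:E * w k x) =
    \sum_(k <oo) \int[mu]_(l in `[0%R, +oo[) \int[mu]_(x in [set x : R | l%:E < w k x]) d k x)%E.
  apply: eq_eseriesr => k _; rewrite -ge0_layer_cake// -integral_mul_indic.
  by apply: eq_integral => x _; rewrite /d muleAC.
rewrite -integral_nneseries//; last 2 first.
- by move=> k; apply: measurable_funTS; exact: measurable_layer.
- by move=> k l _; exact: integral_ge0.
apply: nneg_le_integral => l _.
  by apply: nneseries_ge0 => k _ _; exact: integral_ge0.
pose A := [set x : R | (l%:E < W x)%E].
have mA : measurable A by rewrite -[X in measurable X]setTI; exact: emeasurable_fun_lt.
pose g := cutoff f A.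
have lg : nneg_locint g by exact: nneg_locint_cutoff.
have g0 x : 0 <= g x by case: lg.
have E0 k x : 0 <= dyenergy g 2 k x by exact: dyenergy_ge0.
apply: (@le_trans _ _ (\sum_(k <oo) \int[mu]_(x in `[a, b]) (dyenergy g 2 (k + m) x)%:E)%E).
  apply: lee_nneseries => k _; first by move=> _; exact: integral_ge0.
  rewrite -[leRHS]integral_mul_indic; apply: nneg_le_integral_dom => // x lx.
    by rewrite mule_ge0// lee_fin.
  rewrite /d; apply: lee_wpmul2r => //.
  rewrite lee_fin /dyenergy subrr powRr0 mulr1 (dydiff_local (f := f))//.
  move=> z hz; rewrite /g /cutoff indicE mem_set ?mulr1//.
  by apply: lt_le_trans (wW k x z hz).
apply: le_trans (@le_nneseries_shift (fun j => \int[mu]_(x in `[a, b]) (dyenergy g 2 j x)%:E)%E m _) _.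
  by move=> k; apply: integral_ge0 => x _; rewrite lee_fin.
have p12 : (1 < 2 :> R) && (2 <= 2 :> R) by rewrite lexx andbT ltr1n.
have := dyenergy_sum lg a b p12.
(* At exponent 2 the energy is the squared difference, and the gap constant $1/2$ accounts for the
   factor 2 in the conclusion. *)
have -> : (2 - 1) ^+ 2 / 2 = 2^-1 :> R by field.
set S := (\sum_(j <oo) _)%E => hS.
rewrite -[S]mul1e -[in leLHS](@mulfV _ (2 : R))// EFinM -muleA.
apply: lee_wpmul2l => //; apply: le_trans hS _.
rewrite -integral_mul_indic -[leRHS]integral_mul_indic.
apply: nneg_le_integral => x _; first by rewrite mule_ge0// lee_fin powR_ge0.
rewrite /h -!EFinM lee_fin /g /cutoff !indicE /A.
case: (_ \in [set _ | _]); first by rewrite mulr1 mulr1.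
by rewrite !mulr0 powR0// mul0r.
Qed.

Lemma hoelder_sqr_weight p f (M : R) (W : R -> \bar R) (a b : R) (n : nat) : 2 < p ->
  measurable_fun setT f -> (forall x, 0 <= f x) ->
  (forall x, \int[mu]_(y in `[x, (x + 1)%R]) (f y `^ p)%:E <= M%:E)%E ->
  measurable_fun setT W -> (forall x, 0 <= W x)%E -> b <= a + n%:R ->
  (\int[mu]_(x in `[a, b]) ((f x `^ 2)%:E * W x) <=
   (n%:R * M)%:E `^ (2 / p) * (\int[mu]_x W x `^ (p / (p - 2))) `^ (1 - 2 / p))%E.
Proof.
move=> p2 mf f0 fM mW W0 ab; have p0 : 0 < p by exact: lt_trans p2.
have pm2 : 0 < p - 2 by rewrite subr_gt0.
pose q := p / (p - 2).
have q0 : 0 < q by rewrite divr_gt0.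
have qV : q^-1 = 1 - 2 / p by rewrite /q invf_div mulrBl mulfV// gt_eqF.
have tp0 : 0 < 2 / p by rewrite divr_gt0.
have mfp : measurable_fun setT (fun x => (f x `^ p)%:E).
  by apply/measurable_EFinP; exact: (measurableT_comp (measurable_powR _)).
have fp0 x : (0 <= (f x `^ p)%:E)%E by rewrite lee_fin powR_ge0.
pose D := `[a, b]%classic; have mD : measurable D by exact: measurable_itv.
pose f2 x := ((cutoff f D x `^ 2)%:E)%E.
have mf2 : measurable_fun setT f2.
  apply/measurable_EFinP; apply: (measurableT_comp (measurable_powR _)).
  exact: measurable_cutoff.
have f20 x : (0 <= f2 x)%E by rewrite lee_fin powR_ge0.
have p20 : 0 < p / 2 by rewrite divr_gt0.
have pV : (p / 2)^-1 + q^-1 = 1 by rewrite qV invf_div subrKC.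
have h2 : (\int[mu]_x f2 x `^ (p / 2) <= (n%:R * M)%:E)%E.
  under eq_integral do rewrite poweR_EFin -powRrM.
  have -> : 2 * (p / 2) = p by field.
  rewrite (integral_cutoff_powR _ p0 f0).
  exact: (integral_itv_unit_bound mfp fp0 fM ab).
have h1 : (\int[mu]_x (f2 x * W x) = \int[mu]_(x in D) ((f x `^ 2)%:E * W x))%E.
  rewrite -[RHS]integral_mul_indic; apply: eq_integral => x _.
  rewrite /f2 /cutoff !indicE; case: (_ \in D); first by rewrite mulr1 mule1.
  by rewrite mulr0 powR0// mul0e mule0.
rewrite -h1; apply: le_trans (ge0_hoelder mu mf2 mW f20 W0 p20 q0 pV) _.
rewrite qV invf_div; apply: lee_wpmul2r; first exact: poweR_ge0.
by apply: lee_poweR h2; [exact: ltW|apply: integral_ge0 => x _; exact: poweR_ge0].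
Qed.

Lemma HL_maximal_Lp_scaled (q : R) : 1 < q ->
  exists2 C : R, 0 <= C & forall v : R -> R,
    measurable_fun setT v -> (forall x, 0 <= v x)%R ->
    mu.-integrable setT (EFin \o v) ->
    (\int[mu]_x ((4%:E * HL v x) `^ q) <= (4 `^ q * C)%:E * \int[mu]_x (v x `^ q)%:E)%E.
Proof.
move=> q1; have [C C0 hC] := HL_maximal_Lp q1; exists C => // v mv v0 iv.
have lv : locally_integrable setT v by apply: open_integrable_locally => //; exact: openT.
under eq_integral do rewrite poweRM ?HL_maximalT_ge0// poweR_EFin.
rewrite ge0_integralZl//; last 2 first.
- by apply: (measurableT_comp (measurable_poweR _)); exact: measurable_HL_maximal.
- by move=> x _; exact: poweR_ge0.
rewrite EFinM -muleA; apply: lee_wpmul2l; first by rewrite lee_fin powR_ge0.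
exact: hC.
Qed.

(** By [bavg_duality] the ball averages move from the squared differences to [v]. There they are at
    most four times the maximal function of [v], at every point of the window on which $d_{k+m}$
    depends, as [weighted_dydiff_bound] demands. Hölder's inequality and the maximal theorem for
    $p/(p-2)$ conclude. *)
Lemma local_square_bound_gt2 p : 2 < p ->
  exists2 C : R, 0 <= C & forall f (M : R) (x0 : R) (m i : nat) (v : R -> R), nneg_locint f ->
    (forall x, \int[mu]_(y in `[x, (x + 1)%R]) (f y `^ p)%:E <= M%:E)%E ->
    measurable_fun setT v -> (forall x, 0 <= v x) ->
    (forall x, ~ (x0 <= x <= x0 + 1) -> v x = 0) ->
    mu.-integrable setT (EFin \o v) ->
    (\int[mu]_x ((v x)%:E * dysum (fun k y => dydiff f (k + m) y ^+ 2)%R i x) <=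
     (C * 2 ^+ i * M `^ (2 / p))%:E *
     (\int[mu]_x (v x `^ (p / (p - 2)))%:E) `^ (1 - 2 / p))%E.
Proof.
move=> p2; have p0 : 0 < p by exact: lt_trans p2.
have pm2 : 0 < p - 2 by rewrite subr_gt0.
pose q := p / (p - 2).
have q1 : 1 < q by rewrite /q ltr_pdivlMr// mul1r; lra.
have q0 : 0 < q by exact: lt_trans q1.
have qV : q^-1 = 1 - 2 / p by rewrite /q invf_div mulrBl mulfV// gt_eqF.
have [C1 C10 hC1] := HL_maximal_Lp_scaled q1.
have qV0 : 0 <= 1 - 2 / p by rewrite -qV invr_ge0 ltW.
have tp0 : 0 < 2 / p by rewrite divr_gt0.
(* The factor 40 is $2 \cdot 5 \cdot 4$: the weighted bound, the covering of the enlarged interval,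
   and the factor 4 in the weight [W]. *)
exists (40 * C1 `^ (1 - 2 / p)).
  by rewrite mulr_ge0// powR_ge0.
move=> f M x0 m i v lf fM mv v0 vI iv; have [mf f0 _] := lf.
have mvE : measurable_fun setT (EFin \o v) by exact/measurable_EFinP.
have vE0 x : (0 <= (v x)%:E)%E by rewrite lee_fin.
have mfp : measurable_fun setT (fun x => (f x `^ p)%:E).
  by apply/measurable_EFinP; exact: (measurableT_comp (measurable_powR _)).
have fp0 x : (0 <= (f x `^ p)%:E)%E by rewrite lee_fin powR_ge0.
have M0 : 0 <= M by rewrite -lee_fin; apply: le_trans (fM 0); exact: integral_ge0.
pose d k x := ((dydiff f (k + m) x ^+ 2)%:E)%E.
have d0 k x : (0 <= d k x)%E by rewrite lee_fin sqr_ge0.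
have md k : measurable_fun setT (d k).
  by apply/measurable_EFinP; apply: measurable_funX; exact: measurable_dydiff.
have b0 k x : (0 <= bavg (2 ^+ i * 2 ^- k) (d k) x)%E.
  by apply: bavg_ge0 => //; rewrite ltW// dyrad_gt0.
pose a := x0 - 2 ^+ i; pose b := x0 + 1 + 2 ^+ i.
pose w k := bavg (2 ^+ i * 2 ^- k) (EFin \o v).
have w0 k x : (0 <= w k x)%E by apply: bavg_ge0 => //; rewrite ltW// dyrad_gt0.
have mw k : measurable_fun setT (w k) by exact: measurable_bavg.
have lv : locally_integrable setT v by apply: open_integrable_locally => //; exact: openT.
pose W x := (4%:E * HL v x)%E.
have W0 x : (0 <= W x)%E by rewrite mule_ge0//; exact: HL_maximalT_ge0.
have mW : measurable_fun setT W by apply: measurable_funeM; exact: measurable_HL_maximal.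
have wW k (y z : R) : y - 2 ^- (k + m) <= z <= y -> (w k y <= W z)%E.
  move=> /andP[z1 z2]; apply: (bavg_le_HL mv v0 (dyrad_gt0 R i k)).
  rewrite ger0_norm ?subr_ge0//.
  have : 2 ^- (k + m) <= 2 ^+ i * 2 ^- k :> R.
    rewrite exprD invfM mulrC ler_pM2r ?expN2_gt0//.
    by rewrite (le_trans (expN2_le1 _ _))// exprn_ege1// ler1n.
  by lra.
have -> : (\int[mu]_x ((v x)%:E * dysum (fun k y => dydiff f (k + m) y ^+ 2)%R i x) =
    \sum_(k <oo) \int[mu]_(x in `[a, b]) (d k x * w k x))%E.
  transitivity (\int[mu]_x \sum_(k <oo) ((v x)%:E * bavg (2 ^+ i * 2 ^- k) (d k) x))%E.
    by apply: eq_integral => x _; rewrite nneseriesZl.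
  have mvb k : measurable_fun setT (fun x => ((v x)%:E * bavg (2 ^+ i * 2 ^- k) (d k) x)%E).
    by apply: emeasurable_funM => //; exact: measurable_bavg.
  have vb0 k x : setT x -> (0 <= (v x)%:E * bavg (2 ^+ i * 2 ^- k) (d k) x)%E.
    by move=> _; rewrite mule_ge0.
  rewrite (integral_nneseries mu measurableT mvb vb0).
  apply: eq_eseriesr => k _; rewrite (bavg_duality (md k) (d0 k) mvE vE0 (ltW (dyrad_gt0 R i k))).
  rewrite -[RHS]integral_mul_indic; apply: eq_integral => x _.
  rewrite -/(w k x) indicE; case: (boolP (x \in _)) => [_|]; first by rewrite mule1.
  rewrite notin_setE/= in_itv/= => /negP xab.
  (* The radius is at most $2^i$, so the ball around a point outside [[a, b]] misses the support of
     [v]. *)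
  suff -> : w k x = 0%E by rewrite mule0 mul0e.
  rewrite /w /bavg integral0_eq ?mule0// => t; rewrite /= in_itv/= => /andP[t1 t2].
  rewrite vI// => /andP[z1 z2]; move: xab; rewrite /a /b.
  have h : 2 ^+ i * 2 ^- k <= 2 ^+ i :> R by rewrite ler_piMr ?expN2_le1// exprn_ge0.
  by move=> /negP; apply; apply/andP; split; lra.
apply: le_trans (weighted_dydiff_bound a b lf mW W0 mw w0 wW) _.
have h1 : b <= a - 2 + (5 * 2 ^ i)%:R.
  have h : 1 <= 2 ^+ i :> R by rewrite exprn_ege1// ler1n.
  by rewrite natrM natrX /a /b; lra.
have h2 := hoelder_sqr_weight p2 mf f0 fM mW W0 h1.
have h3 := hC1 v mv v0 iv.
set N := (\int[mu]_x (v x `^ _)%:E)%E in h3 *.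
clear -h2 h3 C10 M0 qV0 tp0 p2 qV q0 p0.
have N0 : (0 <= N)%E by apply: integral_ge0 => x _; rewrite lee_fin powR_ge0.
clearbody N.
apply: (@le_trans _ _ (2%:E * (((5 * 2 ^ i)%:R * M)%:E `^ (2 / p) * ((4 `^ q * C1)%:E * N) `^ (1 - 2 / p))))%E.
  apply: lee_wpmul2l => //; apply: le_trans h2 _.
  apply: lee_wpmul2l; first exact: poweR_ge0.
  by apply: lee_poweR => //; apply: integral_ge0 => x _; exact: poweR_ge0.
rewrite (poweRM _ _ N0) ?lee_fin ?mulr_ge0 ?powR_ge0//.
rewrite !muleA; apply: lee_wpmul2r; first exact: poweR_ge0.
rewrite !poweR_EFin -!EFinM lee_fin.
have iM : 0 <= 5 * 2 ^+ i :> R by rewrite mulr_ge0// exprn_ge0.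
rewrite natrM natrX (powRM _ iM M0) (@powRM _ (4 `^ q)) ?powR_ge0// -powRrM -qV mulfV ?gt_eqF//.
rewrite powRr1// qV.
have h5 : (5 * 2 ^+ i) `^ (2 / p) <= 5 * 2 ^+ i :> R.
  rewrite -[leRHS]powRr1//; apply: ler_powR.
    have : 1 <= 2 ^+ i :> R by rewrite exprn_ege1// ler1n.
    by lra.
  by rewrite ler_pdivrMr// mul1r ltW.
have k1 : 0 <= C1 `^ (1 - 2 / p) by exact: powR_ge0.
have k2 : 0 <= M `^ (2 / p) by exact: powR_ge0.
have k3 := mulr_ge0 k1 k2.
have := ler_wpM2r k3 h5.
by nra.
Qed.

End LocalBounds.

(** * Pointwise bound of convolutions by dyadic differences *)

Section Convolution.
Variable R : realType.
Local Notation mu := (@lebesgue_measure R).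
Implicit Types (f g phi : R -> R) (C : R).

Lemma integral_shift (c : R) (g : R -> \bar R) : measurable_fun setT g ->
  (\int[mu]_x g (x + c)%R = \int[mu]_x g x)%E.
Proof.
move=> mg; rewrite integralE [RHS]integralE; congr (_ - _)%E; symmetry.
- by rewrite (ge0_integral_shift c (measurable_funepos mg) (funepos_ge0 _)); apply: eq_integral => x _; rewrite !funeposE.
- by rewrite (ge0_integral_shift c (measurable_funeneg mg) (funeneg_ge0 _)); apply: eq_integral => x _; rewrite !funenegE.
Qed.

(* Encodes |phi y| <= C 2^k (1 + 2^k |y|)^-N, the index [i] being the dyadic size
   of [2^k y]. *)
Definition kernel_decay C (N : nat) phi (k : nat) := forall y : R, exists2 i : nat,
  `|y| <= 2 ^+ i * 2 ^- k & `|phi y| <= C * 2 ^+ k * 2 ^- (N * i).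

(** Each [y] is charged to the index that [kernel_decay] provides for it; adding the other indices
    only increases the bound. Of the $n+1$ powers of decay, one is spent on the length $2 \cdot
    2^{i-k}$ of the interval. *)
Lemma kernel_integral_le C (n : nat) phi k (g : R -> \bar R) x :
  measurable_fun setT phi -> 0 <= C -> kernel_decay C n.+1 phi k ->
  measurable_fun setT g -> (forall x, 0 <= g x)%E ->
  (\int[mu]_y (`|phi y|%:E * g (x - y)%R) <=
   \sum_(i <oo) ((2 * C * 2 ^- (n * i))%:E * bavg (2 ^+ i * 2 ^- k) g x))%E.
Proof.
move=> mphi C0 dphi mg g0.
pose r i : R := 2 ^+ i * 2 ^- k.
have r0 i : 0 < r i by exact: dyrad_gt0.
have c0 i : 0 <= C * 2 ^+ k * 2 ^- (n.+1 * i) by rewrite !mulr_ge0 ?exprn_ge0// invr_ge0 exprn_ge0.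
pose F i (y : R) := ((C * 2 ^+ k * 2 ^- (n.+1 * i))%:E *
  (g (x - y)%R * (\1_(`[- r i, r i]%classic : set R) y)%:E))%E.
have mgx : measurable_fun setT (fun y : R => g (x - y)%R).
  by apply: measurableT_comp => //; exact: measurable_funB.
have mgi i : measurable_fun setT (fun y : R => g (x - y)%R * (\1_(`[- r i, r i]%classic : set R) y)%:E)%E.
  apply: emeasurable_funM => //.
  by apply/measurable_EFinP; apply: measurable_indic; exact: measurable_itv.
have F0 i y : (0 <= F i y)%E by rewrite !mule_ge0// lee_fin.
apply: (@le_trans _ _ (\int[mu]_y \sum_(i <oo) F i y)%E).
  apply: nneg_le_integral => y _; first by rewrite mule_ge0.
  have [i yi phii] := dphi y.
  apply: le_trans (nneseries_lim_ge i.+1 _); last by move=> j _ _.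
  rewrite big_nat_recr//=; apply: (@le_trans _ _ (F i y)); last by rewrite leeDr// sume_ge0.
  rewrite /F indicE mem_set/= ?mule1; last by rewrite in_itv/= -ler_norml.
  by apply: lee_wpmul2r.
have mF i : measurable_fun setT (F i) by exact: measurable_funeM.
rewrite integral_nneseries//.
apply: lee_nneseries => i _; first by move=> _; apply: integral_ge0.
rewrite /F ge0_integralZl ?lee_fin//; last by move=> y _; rewrite mule_ge0// lee_fin.
rewrite integral_mul_indic /bavg muleA -EFinM; apply: lee_wpmul2r; first exact: integral_ge0.
rewrite lee_fin; apply: eq_ler.
rewrite mulSn exprD; field.
  by rewrite !gt_eqF ?exp2_gt0.
exact: mgi.
Qed.

(** Uniform local $L^1$ control, enough for convolutions with decaying kernels to converge. *)
Definition unit_bounded (L : R) g := nneg_locint g /\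
  forall x, (\int[mu]_(y in `[x, (x + 1)%R]) (g y)%:E <= L%:E)%E.

Lemma bavg_unit_bounded L g i k x : unit_bounded L g ->
  (bavg (2 ^+ i * 2 ^- k) (fun y => (g y)%:E) x <= (2 * 2 ^+ k * L)%:E)%E.
Proof.
move=> [[mg g0 gi] gL].
have mgE : measurable_fun setT (fun y => (g y)%:E) by exact/measurable_EFinP.
have gE0 y : (0 <= (g y)%:E)%E by rewrite lee_fin.
have L0 : 0 <= L by rewrite -lee_fin; apply: le_trans (gL 0); exact: integral_ge0.
have h : 2 ^+ i * 2 ^- k <= 2 ^+ i :> R by rewrite ler_piMr ?expN2_le1// exprn_ge0.
have r0 := dyrad_gt0 R i k.
have e0 := exp2_gt0 R i.
rewrite bavgE//.
apply: (@le_trans _ _ ((2 * (2 ^+ i * 2 ^- k))^-1%:E * ((3 * 2 ^ i)%:R%:E * L%:E))%E).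
  apply: lee_wpmul2l; first by rewrite lee_fin invr_ge0 mulr_ge0// ltW.
  apply: (integral_itv_unit_bound mgE gE0 gL).
  rewrite natrM natrX.
  have : 1 <= 2 ^+ i :> R by rewrite exprn_ege1// ler1n.
  by move=> h1; lra.
rewrite -!EFinM lee_fin natrM natrX.
have -> : (2 * (2 ^+ i / 2 ^+ k))^-1 * (3 * 2 ^+ i * L) = 3 / 2 * 2 ^+ k * L.
  by field; rewrite ?gt_eqF ?exp2_gt0.
by rewrite ler_wpM2r// ler_wpM2r ?exprn_ge0//; lra.
Qed.

Lemma sum_expN2_le (n i : nat) : (0 < n)%N -> \sum_(0 <= j < i) 2 ^- (n * j) <= 2 :> R.
Proof.
move=> n0; suff : \sum_(0 <= j < i) 2 ^- (n * j) <= 2 - 2 * 2 ^- i :> R.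
  by move=> h; apply: le_trans h _; rewrite gerBl mulr_ge0// ltW// expN2_gt0.
elim: i => [|i IH]; first by rewrite big_nil expr0 invr1; lra.
rewrite big_nat_recr//= expN2S.
have : 2 ^- (n * i) <= 2 ^- i :> R.
  by rewrite lef_pV2 ?posrE ?exp2_gt0// ler_eXn2l ?ltr1n// leq_pmull.
by lra.
Qed.

Lemma nneseries_expN2_le (n : nat) (c : R) (u : nat -> \bar R) (M : \bar R) : (0 < n)%N -> 0 <= c ->
  (forall i, 0 <= u i <= M)%E ->
  (\sum_(i <oo) ((c * 2 ^- (n * i))%:E * u i) <= (2 * c)%:E * M)%E.
Proof.
move=> n0 c0 uM.
have M0 : (0 <= M)%E by have /andP[h1 h2] := uM 0%N; exact: le_trans h2.
have p0 i : 0 <= c * 2 ^- (n * i) by rewrite mulr_ge0// ltW// expN2_gt0.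
apply: lime_le.
  apply: is_cvg_nneseries => i _ _; have /andP[h1 h2] := uM i.
  by apply: mule_ge0; rewrite ?lee_fin.
apply: nearW => m.
apply: (@le_trans _ _ (\sum_(0 <= i < m) ((c * 2 ^- (n * i))%:E * M))%E).
  apply: lee_sum => i _; have /andP[h1 h2] := uM i.
  by apply: lee_wpmul2l; rewrite ?lee_fin.
rewrite -ge0_sume_distrl//.
apply: lee_wpmul2r => //; rewrite sumEFin lee_fin -mulr_sumr mulrC.
  by rewrite ler_wpM2r// sum_expN2_le.
by move=> i _; rewrite lee_fin.
Qed.

Lemma kernel_integral_bound C (n : nat) phi k L g x :
  measurable_fun setT phi -> 0 <= C -> (0 < n)%N -> kernel_decay C n.+1 phi k ->
  unit_bounded L g ->
  (\int[mu]_y (`|phi y|%:E * (g (x - y)%R)%:E) <= (8 * C * 2 ^+ k * L)%:E)%E.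
Proof.
move=> mphi C0 n0 dphi gL; have [[mg g0 gi] _] := gL.
apply: le_trans (@kernel_integral_le C n phi k (fun y => (g y)%:E) x mphi C0 dphi _ _) _.
- exact/measurable_EFinP.
- by move=> y; rewrite lee_fin.
apply: le_trans (nneseries_expN2_le (M := (2 * 2 ^+ k * L)%:E) n0 _ _) _.
- by rewrite mulr_ge0.
- move=> i; rewrite bavg_unit_bounded// andbT; apply: bavg_ge0.
    by rewrite ltW// dyrad_gt0.
  by move=> y; rewrite lee_fin.
by rewrite -EFinM lee_fin; apply: eq_ler; ring.
Qed.

Definition conv g phi (x : R) : R := \int[mu]_y (g (x - y) * phi y).

Section Conv.
Variables (C : R) (n : nat) (phi : R -> R) (k : nat) (L : R) (g : R -> R).
Hypotheses (mphi : measurable_fun setT phi) (C0 : 0 <= C) (n0 : (0 < n)%N).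
Hypotheses (dphi : kernel_decay C n.+1 phi k) (gL : unit_bounded L g).

Lemma conv_integrable x : mu.-integrable setT (fun y => (g (x - y) * phi y)%:E).
Proof.
have [[mg g0 gi] _] := gL.
apply/integrableP; split.
  apply/measurable_EFinP; apply: measurable_funM => //.
  by apply: measurableT_comp => //; exact: measurable_funB.
apply: (@le_lt_trans _ _ (\int[mu]_y (`|phi y|%:E * (g (x - y)%R)%:E))%E).
  apply: nneg_le_integral => y _ //.
  by rewrite /= normrM (ger0_norm (g0 _)) mulrC.
by apply: le_lt_trans (kernel_integral_bound x mphi C0 n0 dphi gL) _; rewrite ltry.
Qed.

Lemma conv_shiftE x c : conv g phi (x + c) = \int[mu]_y (g (x - y) * phi (y + c)).
Proof.
have [[mg g0 gi] _] := gL.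
rewrite /conv /Rintegral; congr fine.
rewrite -(integral_shift c); last first.
  apply/measurable_EFinP; apply: measurable_funM => //.
  by apply: measurableT_comp => //; exact: measurable_funB.
by apply: eq_integral => y _; congr ((g _ * _)%:E); ring.
Qed.

End Conv.

Lemma nneg_locint_le f g : measurable_fun setT f -> (forall x, 0 <= f x <= g x) ->
  nneg_locint g -> nneg_locint f.
Proof.
move=> mf fg [mg g0 gi]; split=> // [x|a b]; first by have /andP[] := fg x.
apply: le_lt_trans (gi a b); apply: nneg_le_integral => y _; rewrite lee_fin.
  by have /andP[] := fg y.
by have /andP[] := fg y.
Qed.

Lemma nneg_locint_add f g : nneg_locint f -> nneg_locint g ->
  nneg_locint (fun x => f x + g x).
Proof.
move=> [mf f0 fi] [mg g0 gi]; split=> [|x|a b]; first exact: measurable_funD.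
  by rewrite addr_ge0.
under eq_integral do rewrite EFinD.
rewrite ge0_integralD//; [exact: lte_add_pinfty| | | |].
- by move=> y _; rewrite lee_fin.
- by apply/measurable_EFinP; exact: measurable_funS mf.
- by move=> y _; rewrite lee_fin.
- by apply/measurable_EFinP; exact: measurable_funS mg.
Qed.

Lemma measurable_shift f c : measurable_fun setT f -> measurable_fun setT (fun x : R => f (x + c)).
Proof. by move=> mf; apply: measurableT_comp => //; exact: measurable_funD. Qed.

Lemma nneg_locint_shift f c : nneg_locint f -> nneg_locint (fun x => f (x + c)).
Proof.
move=> [mf f0 fi]; split=> [|//|a b]; first exact: measurable_shift.
have := @shift_itv R (fun y => (f y)%:E) a b (- c); rewrite !opprK.
by move=> ->//; exact/measurable_EFinP.
Qed.

Lemma integral_dyavg_itv f j (a b : R) : nneg_locint f ->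
  (\int[mu]_(x in `[a, b]) (dyavg f j x)%:E <=
   \int[mu]_(x in `[(a - 2 ^- j)%R, b]) (f x)%:E)%E.
Proof.
move=> lf; have [mf f0 fi] := lf.
have mfE : measurable_fun setT (fun y => (f y)%:E) by exact/measurable_EFinP.
have f0E y : (0 <= (f y)%:E)%E by rewrite lee_fin.
have E x : ((dyavg f j x)%:E =
    (2 ^+ j)%:E * \int[mu]_(t in `[0%R, (2 ^- j)%R]) (f (x - t)%R)%:E)%E.
  by rewrite dyavgE// (window_itv 0 (2 ^- j) x mfE f0E) subr0.
under eq_integral do rewrite E.
rewrite ge0_integralZl//; last 2 first.
- by apply: measurable_funS (measurable_window _ mfE f0E) => //; exact: measurable_itv.
- by move=> y _; apply: integral_ge0.
rewrite (tonelli_window _ _ mfE f0E); [|exact: measurable_itv|exact: measurable_itv].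
apply: (@le_trans _ _ ((2 ^+ j)%:E * \int[mu]_(t in `[0%R, (2 ^- j)%R])
   (\int[mu]_(x in `[(a - 2 ^- j)%R, b]) (f x)%:E))%E).
  apply: lee_wpmul2l; first by rewrite lee_fin exprn_ge0.
  apply: nneg_le_integral => t; first by move=> _; apply: integral_ge0.
  rewrite /= in_itv/= => /andP[t0 t1].
  rewrite (shift_itv a b t mfE f0E); apply: nneg_le_integral_dom => // y.
  by rewrite /= !in_itv/= => /andP[h1 h2]; apply/andP; split; lra.
rewrite lebesgue_integral_cst; last exact: measurable_itv.
rewrite lebesgue_measure_itv/= lte_fin expN2_gt0 sube0 muleC -muleA -EFinM.
by rewrite mulVf ?mule1// gt_eqF// exp2_gt0.
Qed.

Lemma nneg_locint_dyavg f j : nneg_locint f -> nneg_locint (dyavg f j).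
Proof.
move=> lf; split; [exact: measurable_dyavg|move=> x; exact: dyavg_ge0|move=> a b].
by apply: le_lt_trans (integral_dyavg_itv j a b lf) _; have [_ _] := lf; apply.
Qed.

Lemma unit_bounded_dyavg L f j : unit_bounded L f -> unit_bounded (2 * L) (dyavg f j).
Proof.
move=> [lf fL]; split; first exact: nneg_locint_dyavg.
move=> x; apply: le_trans (integral_dyavg_itv j x (x + 1) lf) _.
have [mf f0 fi] := lf.
apply: (integral_itv_unit_bound _ _ fL).
- exact/measurable_EFinP.
- by move=> y; rewrite lee_fin.
- by have := expN2_le1 R j; rewrite -[2%:R]/(1+1); lra.
Qed.

Lemma dyavg_shift f j x c : dyavg f j (x + c) = dyavg (fun y => f (y + c)) j x.
Proof.
rewrite dyavg.unlock; congr (_ * fine _).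
by apply: eq_integral => t _; rewrite addrAC.
Qed.

Lemma le_dyavg f g j x : nneg_locint f -> nneg_locint g -> (forall y, f y <= g y) ->
  dyavg f j x <= dyavg g j x.
Proof.
move=> lf lg fg; rewrite -lee_fin !dyavgE//; have [_ f0 _] := lf.
apply: lee_wpmul2l; first by rewrite lee_fin exprn_ge0.
by apply: nneg_le_integral => y _; rewrite lee_fin.
Qed.

Lemma dyavgD f g j x : nneg_locint f -> nneg_locint g ->
  dyavg (fun y => f y + g y) j x = dyavg f j x + dyavg g j x.
Proof.
move=> lf lg; apply: EFin_inj; rewrite EFinD !dyavgE//; last exact: nneg_locint_add.
have [mf f0 _] := lf; have [mg g0 _] := lg.
rewrite -ge0_muleDr; [|by apply: integral_ge0 => y _; rewrite lee_fin..].
congr (_ * _)%E; under eq_integral do rewrite EFinD.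
rewrite ge0_integralD//.
- by move=> y _; rewrite lee_fin.
- by apply/measurable_EFinP; exact: measurable_funS mf.
- by move=> y _; rewrite lee_fin.
- by apply/measurable_EFinP; exact: measurable_funS mg.
Qed.

Lemma nneg_locint_abs_dydiff f j : nneg_locint f -> nneg_locint (fun y => `|dydiff f j y|).
Proof.
move=> lf; have lu := nneg_locint_dyavg j.+1 lf.
have lu' := nneg_locint_shift (- 2 ^- j.+1) lu.
apply: nneg_locint_le (nneg_locint_add lu lu').
  by apply: measurableT_comp => //; exact: measurable_dydiff.
move=> x; rewrite normr_ge0/= /dydiff normrM [ `|2^-1|]ger0_norm ?invr_ge0//.
have [_ u0 _] := lu.
have h1 := u0 x; have h2 := u0 (x - 2 ^- j.+1).
rewrite ler_pdivrMr//; apply: le_trans (ler_normB _ _) _.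
by rewrite !ger0_norm//; lra.
Qed.

(* With this second averaging, two consecutive levels differ by a second
   difference, so that in the convolution with [phi] one difference falls on the
   averages (producing [dydiff]) and the other one on [phi] (producing decay). *)
Definition dyavg2 f j := dyavg (dyavg f j) j.

(** Splitting both averages gives the weights $1, 2, 1$, the convolution square of the two-point
    mean. *)
Lemma dyavg2_step f j z : nneg_locint f ->
  dyavg2 f j z = (dyavg2 f j.+1 z + 2 * dyavg2 f j.+1 (z - 2 ^- j.+1) +
                  dyavg2 f j.+1 (z - 2 ^- j.+1 - 2 ^- j.+1)) / 4.
Proof.
move=> lf; have lu := nneg_locint_dyavg j.+1 lf.
have lu' := nneg_locint_shift (- 2 ^- j.+1) lu.
have H y : dyavg (dyavg f j) j.+1 y =
    (dyavg2 f j.+1 y + dyavg2 f j.+1 (y - 2 ^- j.+1)) / 2.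
  rewrite /dyavg2 dyavg_shift -dyavgD//.
  have lv : nneg_locint (dyavg f j) by exact: nneg_locint_dyavg.
  apply: (@mulIf _ (2:R)); first by rewrite pnatr_eq0.
  rewrite divfK ?pnatr_eq0// mulrDr mulr1 -dyavgD//.
  by congr (dyavg _ _ _); apply/funext => t; rewrite (dyavg_split lf j t); field.
rewrite {1}/dyavg2 (dyavg_split (nneg_locint_dyavg j lf)) !H; field; rewrite ?pnatr_eq0//.
Qed.

(** One averaging turns into the difference $d_j$, the other one stays. Two one-sided comparisons
    replace a triangle inequality, because [le_dyavg] and [dyavgD] concern nonnegative functions. *)
Lemma dyavg2_diff f j z : nneg_locint f ->
  `|dyavg2 f j.+1 z - dyavg2 f j.+1 (z - 2 ^- j.+1)| <=
  2 * dyavg (fun y => `|dydiff f j y|) j.+1 z.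
Proof.
move=> lf; have lu := nneg_locint_dyavg j.+1 lf.
have lu' := nneg_locint_shift (- 2 ^- j.+1) lu.
have ld := nneg_locint_abs_dydiff j lf.
rewrite /dyavg2 dyavg_shift mulrDl mul1r -(dyavgD _ _ ld ld).
have ldd := nneg_locint_add ld ld.
have Ed y : dyavg f j.+1 y - dyavg f j.+1 (y - 2 ^- j.+1) = 2 * dydiff f j y.
  by rewrite /dydiff; field.
have h1 : dyavg (dyavg f j.+1) j.+1 z <=
   dyavg (fun y => dyavg f j.+1 (y - 2 ^- j.+1)) j.+1 z +
   dyavg (fun y => `|dydiff f j y| + `|dydiff f j y|) j.+1 z.
  rewrite -dyavgD//; apply: le_dyavg => //; first exact: nneg_locint_add.
  by move=> y; have := Ed y; have := ler_norm (dydiff f j y); lra.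
have h2 : dyavg (fun y => dyavg f j.+1 (y - 2 ^- j.+1)) j.+1 z <=
   dyavg (dyavg f j.+1) j.+1 z +
   dyavg (fun y => `|dydiff f j y| + `|dydiff f j y|) j.+1 z.
  rewrite -dyavgD//; apply: le_dyavg => //; first exact: nneg_locint_add.
  by move=> y; have := Ed y; have := ler_norm (- dydiff f j y); rewrite normrN; lra.
by rewrite ler_norml; apply/andP; split; lra.
Qed.

End Convolution.

(** * Convolution against double averages, and the approximation of [f] by them *)

Section Smoothing.
Variable R : realType.
Local Notation mu := (@lebesgue_measure R).
Implicit Types (f g phi kap : R -> R) (C L : R).

(** Meant for nonnegative arguments, where Tonelli applies directly; signed kernels are recovered
    through their positive parts in [conv_nconvE]. *)
Definition nconv g kap (x : R) : \bar R := (\int[mu]_y ((g (x - y))%:E * (kap y)%:E))%E.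

(** Averaging is itself a convolution, so by Tonelli it can be carried out after the convolution
    with [kap]. *)
Lemma nconv_dyavg g kap j x : nneg_locint g -> measurable_fun setT kap ->
  (forall y, 0 <= kap y) ->
  nconv (dyavg g j) kap x =
  ((2 ^+ j)%:E * \int[mu]_(t in `[0%R, (2 ^- j)%R]) nconv g kap (x - t)%R)%E.
Proof.
move=> lg mkap kap0; have [mg g0 _] := lg.
have mgE : measurable_fun setT (fun y => (g y)%:E) by exact/measurable_EFinP.
have g0E y : (0 <= (g y)%:E)%E by rewrite lee_fin.
have mkE : measurable_fun setT (fun y => (kap y)%:E) by exact/measurable_EFinP.
have k0E y : (0 <= (kap y)%:E)%E by rewrite lee_fin.
have j0 : (0 <= (2 ^+ j)%:E :> \bar R)%E by rewrite lee_fin exprn_ge0.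
have E z : ((dyavg g j z)%:E =
    (2 ^+ j)%:E * \int[mu]_(t in `[0%R, (2 ^- j)%R]) (g (z - t)%R)%:E)%E.
  by rewrite dyavgE// (window_itv 0 (2 ^- j) z mgE g0E) subr0.
set D := (`[0%R, (2 ^- j)%R]%classic : set R).
have mi : measurable_fun setT (fun t : R => (\1_D t)%:E : \bar R).
  by apply/measurable_EFinP; apply: measurable_indic; exact: measurable_itv.
pose F (z : R * R) := ((kap z.1)%:E * ((g (x - z.1 - z.2))%:E * (\1_D z.2)%:E))%E.
have mF : measurable_fun setT F.
  apply: emeasurable_funM; first exact: (measurableT_comp mkE).
  apply: emeasurable_funM; last by apply: (measurableT_comp mi); exact: measurable_snd.
  apply: (measurableT_comp mgE).
  by apply: measurable_funB => //; exact: measurable_funB.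
have F0 z : (0 <= F z)%E by rewrite /F !mule_ge0.
have mw : measurable_fun setT (fun y : R => \int[mu]_(t in D) (g (y - t)%R)%:E)%E.
  exact: (measurable_window (measurable_itv _) mgE g0E).
rewrite /nconv; transitivity ((2 ^+ j)%:E * \int[mu]_y \int[mu]_t F (y, t))%E.
  rewrite -ge0_integralZl//; last 2 first.
  - exact: (@measurable_fun_fubini_tonelli_F _ _ _ _ _ mu F mF F0).
  - by move=> y _; apply: integral_ge0 => t _; exact: F0.
  apply: eq_integral => y _; rewrite E -muleA; congr (_ * _)%E.
  rewrite -integral_mul_indic -ge0_integralZr//.
  - by apply: eq_integral => t _; rewrite /F/= muleC.
  - apply: emeasurable_funM; last exact: mi.
    by apply: (measurableT_comp mgE); exact: measurable_funB.
  - by move=> t _; rewrite mule_ge0.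
rewrite (@fubini_tonelli _ _ _ _ _ mu mu F mF F0); congr (_ * _)%E.
rewrite -integral_mul_indic; apply: eq_integral => t _.
rewrite -ge0_integralZr//.
- by apply: eq_integral => y _; rewrite /F/= muleCA addrAC muleA.
- apply: emeasurable_funM => //; apply: (measurableT_comp mgE).
  exact: measurable_funB.
- by move=> y _; rewrite mule_ge0.
Qed.

Lemma dyadic_mean_cst j (c : \bar R) :
  ((2 ^+ j)%:E * \int[mu]_(t in `[0%R, (2 ^- j)%R]) c = c)%E.
Proof.
rewrite lebesgue_integral_cst; last exact: measurable_itv.
rewrite lebesgue_measure_itv/= lte_fin expN2_gt0 sube0 muleCA -EFinM.
by rewrite mulfV ?mule1// gt_eqF// exp2_gt0.
Qed.

Lemma nconv_ge0 g kap x : (forall y, 0 <= g y) -> (forall y, 0 <= kap y) ->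
  (0 <= nconv g kap x)%E.
Proof. by move=> g0 k0; apply: integral_ge0 => y _; rewrite mule_ge0// lee_fin. Qed.

Lemma nconv_dyavg_le g kap j x v : nneg_locint g -> measurable_fun setT kap ->
  (forall y, 0 <= kap y) ->
  (forall t, 0 <= t <= 2 ^- j -> (nconv g kap (x - t)%R <= v)%E) ->
  (nconv (dyavg g j) kap x <= v)%E.
Proof.
move=> lg mkap k0 h; have [_ g0 _] := lg.
rewrite nconv_dyavg// -[leRHS](dyadic_mean_cst j).
apply: lee_wpmul2l; first by rewrite lee_fin exprn_ge0.
apply: nneg_le_integral => t; rewrite /= in_itv/= => ht; first exact: nconv_ge0.
exact: h.
Qed.

Lemma nconv_dyavg_ge g kap j x v : nneg_locint g -> measurable_fun setT kap ->
  (forall y, 0 <= kap y) -> (0 <= v)%E ->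
  (forall t, 0 <= t <= 2 ^- j -> (v <= nconv g kap (x - t)%R)%E) ->
  (v <= nconv (dyavg g j) kap x)%E.
Proof.
move=> lg mkap k0 v0 h; have [_ g0 _] := lg.
rewrite nconv_dyavg// -[leLHS](dyadic_mean_cst j).
apply: lee_wpmul2l; first by rewrite lee_fin exprn_ge0.
by apply: nneg_le_integral => t; rewrite /= in_itv/= => ht //; exact: h.
Qed.

Definition pos_part phi y := Num.max (phi y) 0.

Lemma pos_part_ge0 phi y : 0 <= pos_part phi y.
Proof. by rewrite /pos_part le_max lexx orbT. Qed.

Lemma measurable_pos_part phi : measurable_fun setT phi -> measurable_fun setT (pos_part phi).
Proof. by move=> mphi; apply: measurable_maxr. Qed.

Lemma pos_part_dist phi y z : pos_part phi y <= pos_part phi z + `|phi y - phi z|.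
Proof.
rewrite /pos_part; have := ler_norm (phi y - phi z); have := normr_ge0 (phi y - phi z).
by case: (ltP (phi y) 0); case: (ltP (phi z) 0); lra.
Qed.

Lemma pos_part_le_norm phi y : pos_part phi y <= `|phi y|.
Proof.
rewrite /pos_part; have := ler_norm (phi y); have := normr_ge0 (phi y).
by case: (ltP (phi y) 0); lra.
Qed.

(* In the application [phi] is the dilation [psi_(k+1)]: the length scale of
   level [k] is [2^-k], one step coarser than that of the kernel. *)
Definition bump C N phi k := [/\ measurable_fun setT phi, 0 <= C, kernel_decay C N phi k,
  (forall (m : nat) (tau : R), `|tau| <= 2 ^- (k + m) ->
     kernel_decay (C * 2 ^- m) N (fun y => phi (y + tau) - phi y) k) &
  \int[mu]_y phi y = 0].


Section Bump.
Variables (C : R) (n k : nat) (phi : R -> R) (L : R) (f : R -> R).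
Hypotheses (n0 : (0 < n)%N) (bphi : bump C n.+1 phi k) (fL : unit_bounded L f).

(** The bound of [kernel_integral_bound] for the increment of [phi] under a translation by at most
    $2^{-(k+m)}$, whose decay constant is $C 2^{-m}$. *)
Let eta m : R := 8 * (C * 2 ^- m) * 2 ^+ k * L.

(** The translation is moved from [f] to the kernel, whose increment is small by the smoothness
    clause of [bump]. *)
Lemma nconv_shift_le kap m (tau x : R) : measurable_fun setT kap -> (forall y, 0 <= kap y) ->
  (forall y, kap (y + tau) <= kap y + `|phi (y + tau) - phi y|) ->
  `|tau| <= 2 ^- (k + m) ->
  (nconv f kap (x + tau)%R <= nconv f kap x + (eta m)%:E)%E.
Proof.
move=> mk k0 kphi ht; have [mphi C0 _ dphi _] := bphi; have [[mf f0 _] _] := fL.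
have mfx : measurable_fun setT (fun y : R => (f (x - y))%:E).
  by apply/measurable_EFinP; apply: measurableT_comp => //; exact: measurable_funB.
have mkE : measurable_fun setT (fun y : R => (kap y)%:E) by exact/measurable_EFinP.
have mdphi : measurable_fun setT (fun y : R => phi (y + tau) - phi y).
  by apply: measurable_funB => //; exact: measurable_shift.
have mdE : measurable_fun setT (fun y : R => `|phi (y + tau) - phi y|%:E).
  by apply/measurable_EFinP; exact: measurableT_comp.
have -> : nconv f kap (x + tau) = (\int[mu]_y ((f (x - y))%:E * (kap (y + tau))%:E))%E.
  rewrite /nconv -(integral_shift tau).
    by apply: eq_integral => y _; congr ((f _)%:E * _)%E; ring.
  apply: emeasurable_funM => //; apply/measurable_EFinP.
  by apply: measurableT_comp => //; exact: measurable_funB.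
apply: (@le_trans _ _ (\int[mu]_y ((f (x - y))%:E * (kap y)%:E +
    `|phi (y + tau) - phi y|%:E * (f (x - y))%:E))%E).
  apply: nneg_le_integral => y _; first by rewrite mule_ge0// lee_fin.
  rewrite -!EFinM -EFinD lee_fin [(`|phi (y + tau) - phi y| * _)%R]mulrC -mulrDr.
  by rewrite ler_wpM2l.
rewrite ge0_integralD//; last 4 first.
- by move=> y _; rewrite mule_ge0// lee_fin.
- exact: emeasurable_funM.
- by move=> y _; rewrite mule_ge0// lee_fin.
- exact: emeasurable_funM.
apply: leeD => //; apply: (@kernel_integral_bound R _ n) => //.
- by rewrite mulr_ge0// ltW// expN2_gt0.
- exact: dphi.
Qed.

(** The double average at [z] involves the points $z - t - s$ with $0 \le t, s \le 2^{-(k+m)}$.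
    Evaluating at $z = x + 2^{-(k+m)}$ centres them at [x], so that [nconv_shift_le] compares each
    of them with [x]. *)
Lemma nconv_dyavg2_close kap m (x : R) : measurable_fun setT kap -> (forall y, 0 <= kap y) ->
  (forall tau y, kap (y + tau) <= kap y + `|phi (y + tau) - phi y|) ->
  (nconv (dyavg2 f (k + m)) kap (x + 2 ^- (k + m))%R <= nconv f kap x + (eta m)%:E /\
   nconv f kap x <= nconv (dyavg2 f (k + m)) kap (x + 2 ^- (k + m))%R + (eta m)%:E)%E.
Proof.
move=> mk k0 kphi; have [lf _] := fL; have [_ f0 _] := lf.
have lu := nneg_locint_dyavg (k + m) lf.
have h t s : 0 <= t <= 2 ^- (k + m) -> 0 <= s <= 2 ^- (k + m) ->
    `|2 ^- (k + m) - t - s| <= 2 ^- (k + m) :> R.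
  by move=> /andP[? ?] /andP[? ?]; rewrite ler_norml; apply/andP; split; lra.
have E (t s : R) : x + 2 ^- (k + m) - t - s = x + (2 ^- (k + m) - t - s) by ring.
split.
- apply: nconv_dyavg_le => // t ht; apply: nconv_dyavg_le => // s hs.
  by rewrite E; apply: nconv_shift_le => //; exact: h.
- rewrite -leeBlDr//; set v := (X in (X <= _)%E).
  have [v0|v0] := leP 0%E v; last first.
    apply: (le_trans (ltW v0)); apply: nconv_ge0 => // y.
    by have [_ + _] := nneg_locint_dyavg (k + m) lu; apply.
  apply: nconv_dyavg_ge => // t ht; apply: nconv_dyavg_ge => // s hs.
  rewrite E /v leeBlDr//.
  set tau := (2 ^- (k + m) - t - s : R).
  have := @nconv_shift_le kap m (- tau) (x + tau) mk k0 (kphi (- tau)).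
  by rewrite addrK; apply; rewrite normrN; exact: h.
Qed.

Lemma conv_nconvE x g L' : unit_bounded L' g ->
  [/\ nconv g (pos_part phi) x \is a fin_num,
      nconv g (pos_part (fun y => - phi y)) x \is a fin_num &
      ((conv g phi x)%:E =
        nconv g (pos_part phi) x - nconv g (pos_part (fun y => - phi y)%R) x)%E].
Proof.
move=> gL; have [mphi C0 dphi _ _] := bphi; have [[mg g0 _] _] := gL.
have b := kernel_integral_bound x mphi C0 n0 dphi gL.
have fin kap : (forall y, 0 <= kap y <= `|phi y|) -> nconv g kap x \is a fin_num.
  move=> hk; rewrite ge0_fin_numE; last first.
    by apply: nconv_ge0 => // y; have /andP[] := hk y.
  apply: le_lt_trans (ltry (8 * C * 2 ^+ k * L')); apply: le_trans b.
  apply: nneg_le_integral => y _; have /andP[h1 h2] := hk y.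
    by rewrite mule_ge0// lee_fin.
  by rewrite -!EFinM lee_fin mulrC ler_wpM2r.
have f1 : nconv g (pos_part phi) x \is a fin_num.
  by apply: fin => y; rewrite pos_part_ge0 pos_part_le_norm.
have f2 : nconv g (pos_part (fun y => - phi y)) x \is a fin_num.
  by apply: fin => y; rewrite pos_part_ge0 -normrN (pos_part_le_norm (fun y => - phi y)).
split=> //.
have Eint : (\int[mu]_y (g (x - y) * phi y)%:E =
   nconv g (pos_part phi) x - nconv g (pos_part (fun y => - phi y)%R) x)%E.
  rewrite integralE /nconv; congr (_ - _)%E; apply: eq_integral => y _.
  - rewrite funeposE -EFinM -EFin_max; congr EFin.
    by rewrite -[X in Num.max _ X](mulr0 (g (x - y))) maxr_pMr.
  - rewrite funenegE -EFinM -EFinN -EFin_max; congr EFin.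
    by rewrite -mulrN -[X in Num.max _ X](mulr0 (g (x - y))) maxr_pMr.
by rewrite /conv /Rintegral Eint fineK// fin_numB f1 f2.
Qed.

(** Each sign of the kernel contributes one [eta m]. As this tends to 0 with [m], the lemma provides
    the limit of the telescoping sum in [conv_pointwise]; the error is small by the smoothness of
    the kernel, not of [f]. *)
Lemma conv_dyavg2_close m x :
  `|conv f phi x - conv (dyavg2 f (k + m)) phi (x + 2 ^- (k + m))| <= 2 * eta m.
Proof.
have [mphi C0 _ _ _] := bphi.
have wL : unit_bounded (2 * (2 * L)) (dyavg2 f (k + m)).
  by do 2 apply: unit_bounded_dyavg.
have [a1 b1 E1] := conv_nconvE x fL.
have [a2 b2 E2] := conv_nconvE (x + 2 ^- (k + m)) wL.
have [] := @nconv_dyavg2_close (pos_part phi) m x.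
- exact: measurable_pos_part.
- by move=> y; exact: pos_part_ge0.
- by move=> tau y; exact: pos_part_dist.
have [] := @nconv_dyavg2_close (pos_part (fun y => - phi y)) m x.
- by apply: measurable_pos_part; apply: measurableT_comp.
- by move=> y; exact: pos_part_ge0.
- move=> tau y; apply: le_trans (pos_part_dist _ (y + tau) y) _.
  by rewrite -opprD normrN.
move: E1 E2; rewrite -(fineK a1) -(fineK a2) -(fineK b1) -(fineK b2).
rewrite -!EFinB -!EFinD !lee_fin => /(congr1 fine)/= E1 /(congr1 fine)/= E2 h1 h2 h3 h4.
by rewrite ler_norml E1 E2; apply/andP; split; lra.
Qed.

End Bump.

End Smoothing.

(** * Telescoping the smoothed convolutions over the scales *)

Section Pointwise.
Variable R : realType.
Local Notation mu := (@lebesgue_measure R).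
Implicit Types (f g phi kap : R -> R) (C L : R).

Lemma integrable_shift (g : R -> \bar R) (c : R) : mu.-integrable setT g ->
  mu.-integrable setT (fun y : R => g (y + c)%R).
Proof.
move=> /integrableP[mg ig].
have mgc : measurable_fun setT (fun y : R => g (y + c)%R).
  by apply: (measurableT_comp mg); exact: measurable_funD.
apply/integrableP; split=> //.
rewrite -(@ge0_integral_shift R c (fun x => `|g x|)%E)//.
exact: measurableT_comp.
Qed.

Lemma normr_Rintegral_le (h : R -> R) : measurable_fun setT h ->
  ((`|\int[mu]_y h y|)%:E <= \int[mu]_y (`|h y|)%:E)%E.
Proof.
move=> mh; apply: (@le_trans _ _ `|\int[mu]_y (h y)%:E|%E); last first.
  by apply: le_abse_integral => //; exact/measurable_EFinP.
by rewrite /Rintegral; case: (\int[mu]_y (h y)%:E)%E => [r| |]//=; rewrite normr0 leey.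
Qed.

(** A discrete fundamental theorem of calculus: with $h = 2^{-(k+1)}$ and $u = u_{k+1}$, the
    difference of the two window integrals equals $\int_{a+h}^{b+h} (u(s) - u(s-h))\,ds$, with
    integrand $2 d_k$. *)
Lemma dyavg2_osc f k (a b : R) : nneg_locint f -> a <= b ->
  ((`|dyavg2 f k.+1 (b + 2 ^- k.+1) - dyavg2 f k.+1 (a + 2 ^- k.+1)|)%:E <=
   (2 ^+ k.+2)%:E *
     \int[mu]_(s in `[(a + 2 ^- k.+1)%R, (b + 2 ^- k.+1)%R]) `|dydiff f k s|%:E)%E.
Proof.
move=> lf ab; set h := 2 ^- k.+1; have h0 : 0 < h := expN2_gt0 R k.+1.
have lu := nneg_locint_dyavg k.+1 lf; have ld := nneg_locint_abs_dydiff k lf.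
set u := dyavg f k.+1 in lu *.
have [mu_ u0 ui] := lu; have [md d0 di] := ld.
have muE : measurable_fun setT (fun y => (u y)%:E) by exact/measurable_EFinP.
have u0E y : (0 <= (u y)%:E)%E by rewrite lee_fin.
have mdE : measurable_fun setT (fun y => `|dydiff f k y|%:E) by exact/measurable_EFinP.
have d0E y : (0 <= `|dydiff f k y|%:E)%E by rewrite lee_fin.
pose U (a b : R) := (\int[mu]_(s in `[a, b]) (u s)%:E)%E.
set D := (\int[mu]_(s in _) _)%E.
have UE c d : (fine (U c d))%:E = U c d.
  by rewrite fineK// ge0_fin_numE ?ui//; apply: integral_ge0.
have DE : (fine D)%:E = D by rewrite fineK// ge0_fin_numE ?di//; apply: integral_ge0.
have AE z : dyavg2 f k.+1 (z + h) = 2 ^+ k.+1 * fine (U z (z + h)).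
  apply: EFin_inj; rewrite /dyavg2 (dyavgE lu) EFinM UE.
  by rewrite addrK.
(* Both sides integrate over $[a, b+h]$, split at [b] and at $a + h$. *)
have add : fine (U a b) + fine (U b (b + h)) = fine (U a (a + h)) + fine (U (a + h) (b + h)).
  apply: EFin_inj; rewrite !EFinD !UE /U -!integral_itv_split//; lra.
have sh : (\int[mu]_(t in `[(a + h)%R, (b + h)%R]) (u (t - h)%R)%:E)%E = U a b.
  by rewrite (shift_itv _ _ h muE u0E) !addrK.
have muh : measurable_fun setT (fun y : R => (u (y - h))%:E).
  by apply: (measurableT_comp muE); exact: measurable_funB.
have ud s : u s - u (s - h) = dydiff f k s + dydiff f k s by rewrite /dydiff -/u -/h; field.
have D2 : (\int[mu]_(t in `[(a + h)%R, (b + h)%R])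
    (`|dydiff f k t|%:E + `|dydiff f k t|%:E) = D + D)%E.
  rewrite ge0_integralD//; exact: measurable_funS mdE.
have lo : fine (U (a + h) (b + h)) <= fine (U a b) + (fine D + fine D).
  rewrite -lee_fin !EFinD !UE DE -D2 -sh -ge0_integralD//.
  - apply: nneg_le_integral => s _ //; rewrite -!EFinD lee_fin.
    by have := ud s; have := ler_norm (dydiff f k s); lra.
  - exact: measurable_funS muh.
  - by move=> s _; rewrite adde_ge0.
  - by apply: emeasurable_funD; exact: measurable_funS mdE.
have hi : fine (U a b) <= fine (U (a + h) (b + h)) + (fine D + fine D).
  rewrite -lee_fin !EFinD !UE DE -D2 -sh -ge0_integralD//.
  - apply: nneg_le_integral => s _ //; rewrite -!EFinD lee_fin.
    by have := ud s; have := ler_norm (- dydiff f k s); rewrite normrN; lra.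
  - exact: measurable_funS muE.
  - by move=> s _; rewrite adde_ge0.
  - by apply: emeasurable_funD; exact: measurable_funS mdE.
rewrite -DE -EFinM lee_fin !AE -mulrBr normrM ger0_norm ?exprn_ge0//.
rewrite [2 ^+ k.+2]exprSr -mulrA ler_wpM2l ?exprn_ge0// ler_norml; apply/andP; split; lra.
Qed.

(** Shifted forward by its own length, the window at [y] stays within $2^{-j} \le r$ of [y], so the
    ball of doubled radius contains all the windows involved. *)
Lemma bavg_dyavg_shift_le g j r x : nneg_locint g -> 0 < r -> 2 ^- j <= r ->
  (bavg r (fun y => (dyavg g j (y + 2 ^- j))%:E) x <= 2%:E * bavg (2 * r) (fun y => (g y)%:E) x)%E.
Proof.
move=> lg r0 jr; have [mg g0 _] := lg.
have [mG G0 _] := nneg_locint_dyavg j lg.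
have mGE : measurable_fun setT (fun y => (dyavg g j y)%:E) by exact/measurable_EFinP.
have mgE : measurable_fun setT (fun y => (g y)%:E) by exact/measurable_EFinP.
have mGs : measurable_fun setT (fun y : R => (dyavg g j (y + 2 ^- j))%:E).
  by apply/measurable_EFinP; exact: measurable_shift.
rewrite [in leRHS]bavgE// bavgE//; last by move=> y; rewrite lee_fin.
have h0 := expN2_gt0 R j.
rewrite muleA -EFinM.
have -> : 2 * (2 * (2 * r))^-1 = (2 * r)^-1 by field; rewrite gt_eqF.
apply: lee_wpmul2l; first by rewrite lee_fin invr_ge0 mulr_ge0// ltW.
have -> : (\int[mu]_(y in `[(x - r)%R, (x + r)%R]) (dyavg g j (y + 2 ^- j))%:E =
   \int[mu]_(y in `[(x - r + 2 ^- j)%R, (x + r + 2 ^- j)%R]) (dyavg g j y)%:E)%E.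
  have := @shift_itv R (fun y => (dyavg g j y)%:E) (x - r) (x + r) (- 2 ^- j).
  by rewrite !opprK => ->.
apply: le_trans (integral_dyavg_itv j _ _ lg) _.
apply: nneg_le_integral_dom => // y; try by move=> _; rewrite lee_fin.
by rewrite /= !in_itv/= => /andP[h1 h2]; apply/andP; split; lra.
Qed.

Section Bump.
Variables (C : R) (n k : nat) (phi : R -> R).
Hypotheses (n0 : (0 < n)%N) (bphi : bump C n.+1 phi k).

Lemma bump_integrable L g x c : unit_bounded L g ->
  mu.-integrable setT (fun y => (g (x - y) * phi (y + c))%:E).
Proof.
move=> gL; have [mphi C0 dphi _ _] := bphi.
have /(integrable_shift c) := conv_integrable mphi C0 n0 dphi gL (x + c).
by apply: eq_integrable => // y _; congr ((g _ * _)%:E); ring.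
Qed.

(** Expanding the product gives four convolutions, because translating [phi] by [d] shifts the point
    of evaluation by [d]; two of the four coincide. *)
Lemma conv_second_difference L g x (d : R) : unit_bounded L g ->
  2 * conv g phi (x + d) - conv g phi (x + d + d) - conv g phi x =
  \int[mu]_y ((g (x - y) - g (x + d - y)) * (phi (y + d) - phi y)).
Proof.
move=> gL; have [mphi C0 dphi _ _] := bphi.
have i1 := bump_integrable x d gL.
have i2 := bump_integrable (x + d) d gL.
have i3 : mu.-integrable setT (fun y => (g (x - y) * phi y)%:E).
  exact: (conv_integrable mphi C0 n0 dphi gL).
have i4 : mu.-integrable setT (fun y => (g (x + d - y) * phi y)%:E).
  exact: (conv_integrable mphi C0 n0 dphi gL).
have E1 := conv_shiftE mphi gL x d.
have E2 := conv_shiftE mphi gL (x + d) d.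
transitivity (\int[mu]_y ((g (x - y) * phi (y + d) - g (x - y) * phi y)
    - (g (x + d - y) * phi (y + d) - g (x + d - y) * phi y))).
  have j1 : mu.-integrable setT (EFin \o (fun y => g (x - y) * phi (y + d) - g (x - y) * phi y)).
    by have := integrableB measurableT i1 i3; apply: eq_integrable.
  have j2 : mu.-integrable setT (EFin \o (fun y => g (x + d - y) * phi (y + d) - g (x + d - y) * phi y)).
    by have := integrableB measurableT i2 i4; apply: eq_integrable.
  rewrite RintegralB//.
  rewrite RintegralB// RintegralB// -E1 -E2 /conv mulrDl mul1r; ring.
by apply: eq_Rintegral => y _; ring.
Qed.

(** The argument $x + 2^{-j}$ centres the double window at [x]. This makes the increment between
    consecutive levels a symmetric second difference, to which [conv_second_difference] applies. *)
Definition dysmooth f j x : R := conv (dyavg2 f j) phi (x + 2 ^- j).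

Lemma unit_bounded_dyavg2 L f j : unit_bounded L f -> unit_bounded (2 * (2 * L)) (dyavg2 f j).
Proof. by move=> fL; do 2 apply: unit_bounded_dyavg. Qed.

Lemma dysmooth_step L f j x : unit_bounded L f ->
  dysmooth f j.+1 x - dysmooth f j x = 4^-1 * \int[mu]_y
    ((dyavg2 f j.+1 (x - y) - dyavg2 f j.+1 (x + 2 ^- j.+1 - y)) *
     (phi (y + 2 ^- j.+1) - phi y)).
Proof.
move=> fL; have [mphi C0 dphi _ _] := bphi; have [lf _] := fL.
have AL := unit_bounded_dyavg2 j.+1 fL; rewrite -(conv_second_difference _ _ AL).
set d := 2 ^- j.+1; set A := dyavg2 f j.+1.
have dd : 2 ^- j = d + d :> R by rewrite /d expN2S; field; rewrite gt_eqF// exp2_gt0.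
have I z : mu.-integrable setT (EFin \o (fun y => (A (z - y) * phi y))).
  exact: (conv_integrable mphi C0 n0 dphi AL).
have -> : dysmooth f j x = (conv A phi (x + d + d) + 2 * conv A phi (x + d) + conv A phi x) / 4.
  rewrite /dysmooth dd addrA.
  transitivity (\int[mu]_y (4^-1 * (A (x + d + d - y) * phi y + 2 * (A (x + d - y) * phi y) + A (x - y) * phi y))).
    apply: eq_Rintegral => y _; rewrite (dyavg2_step _ _ lf) -/A -/d.
    have -> : x + d + d - y - d = x + d - y by ring.
    have -> : x + d - y - d = x - y by ring.
    by field.
  have I2 : mu.-integrable setT (EFin \o (fun y => 2 * (A (x + d - y) * phi y))).
    by have := integrableZl measurableT 2 (I (x + d)); apply: eq_integrable.
  have I3 : mu.-integrable setT (EFin \o (fun y => A (x + d + d - y) * phi y + 2 * (A (x + d - y) * phi y))).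
    by have := integrableD measurableT (I (x + d + d)) I2; apply: eq_integrable.
  rewrite RintegralZl//; last first.
    by have := integrableD measurableT I3 (I x); apply: eq_integrable.
  by rewrite RintegralD// RintegralD// RintegralZl// mulrC.
by rewrite /dysmooth -/d -/A; field.
Qed.

(** The difference of double averages is bounded by an average of $|d_{k+m}|$ and the increment of
    the kernel has decay constant $C 2^{-m}$. The radius $2^{i+1-k}$ comes from absorbing the inner
    average with [bavg_dyavg_shift_le]. *)
Lemma dysmooth_step_le L f m x : unit_bounded L f ->
  ((`|dysmooth f (k + m).+1 x - dysmooth f (k + m) x|)%:E <=
   \sum_(i <oo) ((2 * C * 2 ^- m * 2 ^- (n * i))%:E *
     bavg (2 ^+ i.+1 * 2 ^- k) (fun y => `|dydiff f (k + m) y|%:E) x))%E.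
Proof.
move=> fL; have [mphi C0 dphi d2phi _] := bphi; have [lf _] := fL.
rewrite (dysmooth_step _ _ fL); set j := (k + m)%N; set d := 2 ^- j.+1.
have d0 : 0 < d := expN2_gt0 R j.+1.
have djm : d <= 2 ^- (k + m) by rewrite /d expN2S ler_pdivrMr//; have := expN2_gt0 R j; lra.
have AL := unit_bounded_dyavg2 j.+1 fL; set A := dyavg2 f j.+1 in AL *.
have [[mA A0 _] _] := AL.
pose G y := dyavg (fun y => `|dydiff f j y|) j.+1 (y + d).
have lD := nneg_locint_abs_dydiff j lf.
have lG : nneg_locint G by apply: nneg_locint_shift; exact: nneg_locint_dyavg.
have [mG G0 _] := lG.
have kd : kernel_decay (C * 2 ^- m) n.+1 (fun y => phi (y + d) - phi y) k.
  by apply: d2phi; rewrite ger0_norm// ltW.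
have mkd : measurable_fun setT (fun y : R => phi (y + d) - phi y).
  by apply: measurable_funB => //; exact: measurable_shift.
have mAx z : measurable_fun setT (fun y : R => A (z - y)).
  by apply: (measurableT_comp mA); exact: measurable_funB.
set W := \int[mu]_y _.
have WE : (`|W|%:E <= \int[mu]_y (2%:E * (`|phi (y + d) - phi y|%:E * (G (x - y))%:E)))%E.
  have mI : measurable_fun setT (fun y : R => (A (x - y) - A (x + d - y)) * (phi (y + d) - phi y)).
    by apply: measurable_funM => //; exact: measurable_funB.
  apply: le_trans (normr_Rintegral_le mI) _.
  apply: nneg_le_integral => y _ //=.
  rewrite -!EFinM lee_fin normrM mulrCA mulrC ler_wpM2l// distrC.
  have := dyavg2_diff j (x + d - y) lf; rewrite -/A -/d /G.
  have -> : x + d - y - d = x - y by ring.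
  by have -> : x - y + d = x + d - y by ring.
rewrite normrM [ `|4^-1|]ger0_norm ?invr_ge0// EFinM.
have h4 : (0 <= (4^-1 : R)%:E)%E by rewrite lee_fin invr_ge0.
apply: le_trans (lee_wpmul2l h4 WE) _.
have mGx : measurable_fun setT (fun y : R => (G (x - y))%:E).
  by apply/measurable_EFinP; apply: (measurableT_comp mG); exact: measurable_funB.
have mkE : measurable_fun setT (fun y : R => `|phi (y + d) - phi y|%:E).
  by apply/measurable_EFinP; exact: measurableT_comp.
have Cm0 : 0 <= C * 2 ^- m by rewrite mulr_ge0// ltW// expN2_gt0.
have mGE : measurable_fun setT (fun y : R => (G y)%:E) by exact/measurable_EFinP.
have G0E y : (0 <= (G y)%:E)%E by rewrite lee_fin.
rewrite ge0_integralZl//; last 2 first.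
- exact: emeasurable_funM.
- by move=> y _; rewrite mule_ge0// lee_fin.
rewrite muleA -EFinM.
have KI := @kernel_integral_le R (C * 2 ^- m) n _ k (fun y => (G y)%:E) x mkd Cm0 kd mGE G0E.
have h2 : (0 <= (4^-1 * 2 : R)%:E)%E by rewrite lee_fin mulr_ge0// invr_ge0.
apply: le_trans (lee_wpmul2l h2 KI) _.
have bp i : (0 <= (2 * (C * 2 ^- m) * 2 ^- (n * i))%:E * bavg (2 ^+ i * 2 ^- k) (fun y => (G y)%:E) x)%E.
  rewrite mule_ge0//; first by rewrite lee_fin !mulr_ge0// ltW// expN2_gt0.
  by apply: bavg_ge0 => //; rewrite ltW// dyrad_gt0.
rewrite -nneseriesZl//.
apply: lee_nneseries => i _; first by rewrite mule_ge0.
have drad : 2 ^- j.+1 <= 2 ^+ i * 2 ^- k :> R.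
  apply: (@le_trans _ _ (2 ^- k)).
    by rewrite lef_pV2 ?posrE ?exp2_gt0// ler_eXn2l ?ltr1n// /j -addnS leq_addr.
  by rewrite ler_peMl// ?(ltW (expN2_gt0 R k))// exprn_ege1// ler1n.
have B := bavg_dyavg_shift_le x lD (dyrad_gt0 R i k) drad.
rewrite muleA -EFinM.
have hc : (0 <= (4^-1 * 2 * (2 * (C * 2 ^- m) * 2 ^- (n * i)) : R)%:E)%E.
  by rewrite lee_fin !mulr_ge0// ltW// expN2_gt0.
apply: le_trans (lee_wpmul2l hc B) _.
have -> : 2 ^+ i.+1 * 2 ^- k = 2 * (2 ^+ i * 2 ^- k) :> R by rewrite exprS mulrA.
rewrite muleA -EFinM; apply: lee_wpmul2r.
  apply: bavg_ge0; last by move=> y; rewrite lee_fin.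
  by rewrite mulr_ge0// ltW// dyrad_gt0.
rewrite lee_fin; apply: eq_ler.
by field; rewrite ?gt_eqF ?exp2_gt0.
Qed.

(** At the starting level the cancellation of [phi] replaces telescoping: subtracting the value at
    $x + h$ leaves an oscillation, which [dyavg2_osc] bounds by $d_k$; hence the start at $k+1$. The
    bound grows like $2^i$, and this costs one more power of decay than [dysmooth_step_le]. *)
Lemma dysmooth_low_le L f x : kernel_decay C n.+2 phi k -> unit_bounded L f ->
  ((`|dysmooth f k.+1 x|)%:E <=
   \sum_(i <oo) ((32 * C * 2 ^- (n * i))%:E *
     bavg (2 ^+ i.+1 * 2 ^- k) (fun y => `|dydiff f k y|%:E) x))%E.
Proof.
move=> d3phi fL; have [mphi C0 dphi _ phi0] := bphi; have [lf _] := fL.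
pose h : R := 2 ^- k.+1; have h0 : 0 < h := expN2_gt0 R k.+1.
have AL := unit_bounded_dyavg2 k.+1 fL; rewrite /dysmooth -/h; set A := dyavg2 f k.+1 in AL *.
have [[mA A0 _] _] := AL.
pose r i : R := 2 ^+ i * 2 ^- k.
have r0 i : 0 < r i by exact: dyrad_gt0.
pose b i := bavg (2 ^+ i.+1 * 2 ^- k) (fun y => `|dydiff f k y|%:E) x.
have b0 i : (0 <= b i)%E.
  by apply: bavg_ge0 => [|y]; [rewrite ltW// dyrad_gt0|rewrite lee_fin].
have lD := nneg_locint_abs_dydiff k lf; have [mD D0 _] := lD.
have mDE : measurable_fun setT (fun y => `|dydiff f k y|%:E) by exact/measurable_EFinP.
have D0E y : (0 <= `|dydiff f k y|%:E)%E by rewrite lee_fin.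
have bE i : (\int[mu]_(s in `[(x - 2 * r i)%R, (x + 2 * r i)%R]) `|dydiff f k s|%:E =
    (4 * r i)%:E * b i)%E.
  rewrite /b bavgE// exprS -mulrA -/(r i) muleA -EFinM.
  have -> : 4 * r i * (2 * (2 * r i))^-1 = 1 by field; rewrite gt_eqF.
  by rewrite mul1e.
have I : mu.-integrable setT (EFin \o (fun y => A (x + h - y) * phi y)).
  exact: (conv_integrable mphi C0 n0 dphi AL).
(* Integrability of [phi] is read off from its convolution with the constant 1. *)
have uc : unit_bounded 1 (cst 1 : R -> R).
  split; first (split=> // a c).
    rewrite (lebesgue_integral_cst 1%:E); last exact: measurable_itv.
    rewrite mul1e lebesgue_measure_itv/=; case: ifP => _; rewrite ?ltry//.
  move=> z; rewrite (lebesgue_integral_cst 1%:E); last exact: measurable_itv.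
  by rewrite mul1e lebesgue_measure_itv/= lte_fin ltrDl ltr01 -EFinB addrAC subrr add0r.
have I1 : mu.-integrable setT (EFin \o phi).
  have := conv_integrable mphi C0 n0 dphi uc 0.
  by apply: eq_integrable => // y _ /=; rewrite mul1r.
have I2 : mu.-integrable setT (EFin \o (fun y => A (x + h) * phi y)).
  by have := integrableZl measurableT (A (x + h)) I1; apply: eq_integrable.
have -> : conv A phi (x + h) = \int[mu]_y ((A (x - y + h) - A (x + h)) * phi y).
  transitivity (\int[mu]_y (A (x + h - y) * phi y - A (x + h) * phi y)).
    by rewrite RintegralB// RintegralZl// phi0 mulr0 subr0.
  by apply: eq_Rintegral => y _; rewrite -mulrBl addrAC.
have mI : measurable_fun setT (fun y : R => (A (x - y + h) - A (x + h)) * phi y).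
  apply: measurable_funM => //; apply: measurable_funB => //.
  apply: (measurableT_comp mA); apply: measurable_funD => //; exact: measurable_funB.
apply: le_trans (normr_Rintegral_le mI) _.
(* Here $2^{k+2} \cdot 4 r_i = 16 \cdot 2^i$. Integrating over an interval of length $2 r_i$ then
   turns 16 into 32 and uses the second spare power of decay. *)
pose c i : R := 16 * C * 2 ^+ k * 2 ^+ i * 2 ^- (n.+2 * i).
have c0 i : 0 <= c i.
  rewrite /c !mulr_ge0 ?exprn_ge0//; exact: ltW (expN2_gt0 R _).
pose F i (y : R) := ((c i)%:E * b i * (\1_(`[- r i, r i]%classic : set R) y)%:E)%E.
have mi i : measurable_fun setT (fun y : R => (\1_(`[- r i, r i]%classic : set R) y)%:E : \bar R).
  by apply/measurable_EFinP; apply: measurable_indic; exact: measurable_itv.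
have mF i : measurable_fun setT (F i) by exact: measurable_funeM.
have cb0 i : (0 <= (c i)%:E * b i)%E by rewrite mule_ge0// lee_fin.
have F0 i y : (0 <= F i y)%E by rewrite mule_ge0.
apply: (@le_trans _ _ (\int[mu]_y \sum_(i <oo) F i y)%E).
  apply: nneg_le_integral => y _ //.
  have [i yi phii] := d3phi y.
  apply: le_trans (nneseries_lim_ge i.+1 _); last by move=> j _ _.
  rewrite big_nat_recr//=; apply: (@le_trans _ _ (F i y)); last by rewrite leeDr// sume_ge0.
  have yr : - r i <= y <= r i by rewrite -ler_norml.
  rewrite /F indicE mem_set/= ?mule1; last by rewrite in_itv/=.
  rewrite normrM EFinM.
  have hr : h <= r i.
    rewrite /h expN2S; apply: (@le_trans _ _ (2 ^- k)).
      by have := expN2_gt0 R k; lra.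
    by rewrite ler_peMl// ?(ltW (expN2_gt0 R k))// exprn_ege1// ler1n.
  have osc : ((`|A (x - y + h) - A (x + h)|)%:E <= (2 ^+ k.+2)%:E * ((4 * r i)%:E * b i))%E.
    rewrite -bE; have [y0|y0] := leP 0 y.
    - have xy : x - y <= x by lra.
      rewrite distrC; apply: le_trans (dyavg2_osc k lf xy) _.
      apply: lee_wpmul2l; first by rewrite lee_fin exprn_ge0.
      apply: nneg_le_integral_dom => // s; rewrite /= !in_itv/= -/h => /andP[s1 s2].
      by apply/andP; split; lra.
    - have xy : x <= x - y by lra.
      apply: le_trans (dyavg2_osc k lf xy) _.
      apply: lee_wpmul2l; first by rewrite lee_fin exprn_ge0.
      apply: nneg_le_integral_dom => // s; rewrite /= !in_itv/= -/h => /andP[s1 s2].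
      by apply/andP; split; lra.
  apply: (@le_trans _ _ ((2 ^+ k.+2)%:E * ((4 * r i)%:E * b i) * (C * 2 ^+ k * 2 ^- (n.+2 * i))%:E)%E).
    by apply: lee_pmul => //; rewrite ?lee_fin.
  rewrite muleA -EFinM muleAC -EFinM; apply: lee_wpmul2r => //.
  rewrite lee_fin; apply: eq_ler.
  by rewrite /c /r !exprS; field; rewrite ?gt_eqF ?exp2_gt0.
rewrite integral_nneseries//; apply: lee_nneseries => i _; first by move=> _; apply: integral_ge0.
rewrite /F ge0_integralZl ?lee_fin//.
rewrite lebesgue_integral_indic; last exact: measurable_itv.
rewrite lebesgue_measure_itv/= lte_fin gtrN// -EFinB opprK muleAC -EFinM; apply: lee_wpmul2r => //.
rewrite lee_fin; apply: eq_ler.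
rewrite /c /r !mulSn !exprD; field.
  by rewrite ?gt_eqF ?exp2_gt0.
exact: mi.
Qed.

(** Along the telescoping sum from level $k+1$, [dysmooth_low_le] bounds the term $m = 0$ and
    [dysmooth_step_le] the increments; the distance of the convolution from a late level is below
    any given [e]. *)
Lemma conv_pointwise L f x : kernel_decay C n.+2 phi k -> unit_bounded L f ->
  ((`|conv f phi x|)%:E <=
   \sum_(m <oo) \sum_(i <oo) ((32 * C * 2 ^- m * 2 ^- (n * i))%:E *
     bavg (2 ^+ i.+1 * 2 ^- k) (fun y => `|dydiff f (k + m) y|%:E) x))%E.
Proof.
move=> d3phi fL; have [mphi C0 dphi _ phi0] := bphi; have [lf _] := fL.
set S := (\sum_(m <oo) _)%E.
pose T m : \bar R := (\sum_(i <oo) ((32 * C * 2 ^- m * 2 ^- (n * i))%:E *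
     bavg (2 ^+ i.+1 * 2 ^- k) (fun y => `|dydiff f (k + m) y|%:E) x))%E.
have t0 (c : R) m i : 0 <= c -> (0 <= (c * 2 ^- m * 2 ^- (n * i))%:E *
     bavg (2 ^+ i.+1 * 2 ^- k) (fun y => `|dydiff f (k + m) y|%:E) x)%E.
  move=> c0; rewrite mule_ge0//.
    by rewrite lee_fin !mulr_ge0// ltW// expN2_gt0.
  by apply: bavg_ge0 => [|y]; [rewrite ltW// dyrad_gt0|rewrite lee_fin].
have C32 : 0 <= 32 * C by rewrite mulr_ge0.
have T0 m : (0 <= T m)%E by apply: nneseries_ge0 => i _ _; exact: t0.
have part m : ((`|dysmooth f (k + m).+1 x|)%:E <= \sum_(0 <= j < m.+1) T j)%E.
  elim: m => [|m IH].
    rewrite addn0 big_nat1; apply: le_trans (dysmooth_low_le x d3phi fL) _.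
    by rewrite /T expr0 invr1 mulr1 addn0.
  rewrite big_nat_recr//=; apply: (@le_trans _ _ ((`|dysmooth f (k + m).+1 x|)%:E +
     (`|dysmooth f (k + m.+1).+1 x - dysmooth f (k + m.+1) x|)%:E)%E).
    rewrite -EFinD lee_fin addnS.
    have -> : dysmooth f (k + m).+2 x = dysmooth f (k + m).+1 x +
      (dysmooth f (k + m).+2 x - dysmooth f (k + m).+1 x) by ring.
    apply: le_trans (ler_normD _ _) _; rewrite lerD2l.
    by rewrite addrCA subrr addr0.
  apply: leeD; first exact: IH.
  apply: le_trans (dysmooth_step_le m.+1 x fL) _.
  apply: lee_nneseries => i _; first by move=> _; apply: t0; rewrite mulr_ge0.
  apply: lee_wpmul2r.
    by apply: bavg_ge0 => [|y]; [rewrite ltW// dyrad_gt0|rewrite lee_fin].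
  rewrite lee_fin; apply: ler_wpM2r; first exact: ltW (expN2_gt0 R _).
  apply: ler_wpM2r; first exact: ltW (expN2_gt0 R _).
  by apply: ler_wpM2r; rewrite // ler_nat.
have partS m : ((`|dysmooth f (k + m).+1 x|)%:E <= S)%E.
  by apply: le_trans (part m) _; apply: nneseries_lim_ge.
apply/lee_addgt0Pr => e e0.
(* Twice the error [eta] without its factor $2^{-m}$. *)
pose B := 16 * C * 2 ^+ k * L.
have L0 : 0 <= L.
  rewrite -lee_fin; have [_ fL0] := fL; apply: le_trans (fL0 0).
  by apply: integral_ge0 => y _; rewrite lee_fin; have [_ ->] := lf.
have B0 : 0 <= B by rewrite /B !mulr_ge0// exprn_ge0.
have [m Bm] : exists m, B * 2 ^- m.+1 <= e.
  have [m hm] := ltr_add_invr (x := e / (B + 1)) (y := 0 : R) (divr_gt0 e0 (ltr_wpDl B0 ltr01)).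
  exists m; rewrite add0r in hm.
  have : 2 ^- m.+1 <= m.+1%:R^-1 :> R.
    rewrite lef_pV2 ?posrE ?exp2_gt0//.
    by rewrite -natrX ler_nat ltnW// ltn_expl.
  move: hm; rewrite ltr_pdivlMr; last by lra.
  move=> h1 h2; have h3 := expN2_gt0 R m.+1.
  apply: ltW; apply: le_lt_trans h1; rewrite mulrC.
  by apply: ler_pM => //; lra.
apply: (@le_trans _ _ ((`|dysmooth f (k + m.+1) x|)%:E + e%:E)%E); last first.
  by apply: leeD => //; rewrite addnS; exact: partS.
rewrite -EFinD lee_fin.
have := conv_dyavg2_close n0 bphi fL m.+1 x; rewrite -/(dysmooth f (k + m.+1) x) => h.
have -> : conv f phi x = dysmooth f (k + m.+1) x + (conv f phi x - dysmooth f (k + m.+1) x) by ring.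
apply: le_trans (ler_normD _ _) _; rewrite lerD2l; apply: le_trans h _.
apply: le_trans Bm; apply: eq_ler.
by rewrite /B; ring.
Qed.

End Bump.

End Pointwise.

(** * Summation over scales *)

Section Series.
Variable R : realType.
Implicit Types (u b : nat -> \bar R) (r : R).

(** Undoing the power on both sides with the exponent $1/r$ reduces the claim to partial sums, so
    that monotonicity of the power is enough. *)
Lemma nneseries_poweR_le u r (T : \bar R) : (forall n, 0 <= u n)%E -> 0 < r ->
  (forall N, (\sum_(0 <= n < N) u n) `^ r <= T)%E -> ((\sum_(n <oo) u n) `^ r <= T)%E.
Proof.
move=> u0 r0 h.
have T0 : (0 <= T)%E by apply: le_trans (h 0%N); exact: poweR_ge0.
have S0 N : (0 <= \sum_(0 <= n < N) u n)%E by exact: sume_ge0.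
have inv (x : \bar R) : (0 <= x)%E -> ((x `^ r^-1) `^ r = x)%E.
  by move=> x0; rewrite -poweRrM mulVf ?gt_eqF// poweRe1.
have inv' (x : \bar R) : (0 <= x)%E -> ((x `^ r) `^ r^-1 = x)%E.
  by move=> x0; rewrite -poweRrM mulfV ?gt_eqF// poweRe1.
rewrite -(inv T T0); apply: lee_poweR; first exact: ltW.
  exact: nneseries_ge0.
apply: lime_le; first exact: is_cvg_nneseries.
apply: nearW => N; rewrite -(inv' _ (S0 N)); apply: lee_poweR.
- by rewrite invr_ge0 ltW.
- exact: poweR_ge0.
- exact: h.
Qed.

Lemma mule_self_poweR (x : \bar R) : (0 <= x)%E -> (x * x = x `^ 2)%E.
Proof.
case: x => [x| |] x0 //; last by rewrite mulyy poweRyr// pnatr_eq0.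
by rewrite -EFinM poweR_EFin powR_mulrn// expr2.
Qed.

Lemma sqr_adde_le (x y : \bar R) : (0 <= x)%E -> (0 <= y)%E ->
  ((x + y) * (x + y) <= 2%:E * (x * x) + 2%:E * (y * y))%E.
Proof.
have top (z : \bar R) : (0 <= z)%E -> (2%:E * (+oo * +oo) + z = +oo)%E.
  move=> z0; rewrite mulyy gt0_muley ?lte_fin// addye//.
  by rewrite gt_eqF// (lt_le_trans _ z0)// ltNy0.
move=> x0 y0; case: x x0 => [x| |]//= x0.
- case: y y0 => [y| |]//= y0.
  + rewrite -!EFinM -!EFinD lee_fin -subr_ge0.
    have -> : 2 * (x * x) + 2 * (y * y) - (x + y) * (x + y) = (x - y) ^+ 2 by ring.
    exact: sqr_ge0.
  + by rewrite [leRHS]addeC top ?leey// mule_ge0// mule_ge0.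
- by rewrite top ?leey// mule_ge0// mule_ge0.
Qed.

(** Cauchy-Schwarz for the weights $2^{-n}$, of total mass at most 2. Splitting off the first term
    writes the sum as $b_0 + S/2$, and $(x+y)^2 \le 2x^2 + 2y^2$ reproduces the constant 2 in the
    induction. *)
Lemma sum_dyadic_sqr_le b N : (forall n, 0 <= b n)%E ->
  ((\sum_(0 <= n < N) (2 ^- n)%:E * b n) * (\sum_(0 <= n < N) (2 ^- n)%:E * b n) <=
   2%:E * \sum_(0 <= n < N) ((2 ^- n)%:E * (b n * b n)))%E.
Proof.
elim: N b => [|N IH] b b0; first by rewrite !big_nil mul0e mule0.
have w0 n : (0 <= (2 ^- n)%:E :> \bar R)%E by rewrite lee_fin ltW// expN2_gt0.
have half (F : nat -> \bar R) : (forall n, 0 <= F n)%E ->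
    (\sum_(0 <= n < N) ((2 ^- n.+1)%:E * F n) =
     (2^-1)%:E * \sum_(0 <= n < N) ((2 ^- n)%:E * F n))%E.
  move=> F0; rewrite ge0_sume_distrr; last by move=> n _; rewrite mule_ge0.
  by apply: eq_bigr => n _; rewrite muleA -EFinM expN2S mulrC.
rewrite !big_nat_recl//= half; last by move=> n; exact: b0.
rewrite (half (fun n => b n.+1 * b n.+1)%E); last by move=> n; rewrite mule_ge0.
rewrite expr0 invr1 !mul1e.
set S := (\sum_(0 <= i < N) _)%E; set T := (\sum_(0 <= i < N) _)%E.
have S0 : (0 <= S)%E by apply: sume_ge0 => n _; rewrite mule_ge0.
have T0 : (0 <= T)%E by apply: sume_ge0 => n _; rewrite mule_ge0// mule_ge0.
have h : (S * S <= 2%:E * T)%E by exact: IH (fun n => b0 n.+1).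
have h2 : (0 <= (2^-1 : R)%:E)%E by rewrite lee_fin invr_ge0.
apply: le_trans (sqr_adde_le (b0 0%N) (mule_ge0 h2 S0)) _.
rewrite [leRHS]ge0_muleDr ?mule_ge0//; apply: leeD => //.
rewrite [((2^-1)%:E * S * _)%E]muleACA -EFinM [leLHS]muleA -EFinM.
apply: (@le_trans _ _ ((2 * (2^-1 * 2^-1))%:E * (2%:E * T))%E).
  by apply: lee_wpmul2l => //; rewrite lee_fin.
rewrite muleA -EFinM [leRHS]muleA -EFinM; apply: lee_wpmul2r => //.
by rewrite lee_fin; apply: eq_ler; field.
Qed.

Lemma nneseries_dyadic_sqr_le b : (forall n, 0 <= b n)%E ->
  ((\sum_(n <oo) (2 ^- n)%:E * b n) * (\sum_(n <oo) (2 ^- n)%:E * b n) <=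
   2%:E * \sum_(n <oo) ((2 ^- n)%:E * (b n * b n)))%E.
Proof.
move=> b0.
have w0 n : (0 <= (2 ^- n)%:E :> \bar R)%E by rewrite lee_fin ltW// expN2_gt0.
rewrite mule_self_poweR; last by apply: nneseries_ge0 => n _ _; rewrite mule_ge0.
apply: nneseries_poweR_le => [n|//|N]; first by rewrite mule_ge0.
rewrite -mule_self_poweR; last by apply: sume_ge0 => n _; rewrite mule_ge0.
apply: le_trans (sum_dyadic_sqr_le N b0) _; apply: lee_wpmul2l => //.
by apply: nneseries_lim_ge => n _ _; rewrite mule_ge0// mule_ge0.
Qed.

(** The shares $\theta = x/(x+y)$ and $\theta = y/(x+y)$ are at most 1, hence $\theta \le
    \theta^r$. *)
Lemma powR_subadd (x y r : R) : 0 <= x -> 0 <= y -> 0 < r <= 1 ->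
  (x + y) `^ r <= x `^ r + y `^ r.
Proof.
move=> x0 y0 /andP[r0 r1].
have [->|s0] := eqVneq (x + y) 0.
  by rewrite powR0 ?gt_eqF// addr_ge0// powR_ge0.
have {}s0 : 0 < x + y by rewrite lt_neqAle eq_sym s0 addr_ge0.
have h z : 0 <= z <= x + y -> z / (x + y) * (x + y) `^ r <= z `^ r.
  move=> /andP[z0 zs].
  have {2}-> : z = (z / (x + y)) * (x + y) by rewrite divfK// gt_eqF.
  have q0 : 0 <= z / (x + y) by rewrite divr_ge0// ltW.
  have q1 : z / (x + y) <= 1 by rewrite ler_pdivrMr// mul1r.
  rewrite powRM//; last exact: ltW.
  rewrite ler_wpM2r ?powR_ge0//.
  have [->|qn0] := eqVneq (z / (x + y)) 0; first exact: powR_ge0.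
  have {}q0 : 0 < z / (x + y) by rewrite lt_neqAle eq_sym qn0.
  by rewrite -[leLHS]powRr1 ?(ltW q0)//; apply: ger_powR => //; rewrite q0.
have -> : (x + y) `^ r = x / (x + y) * (x + y) `^ r + y / (x + y) * (x + y) `^ r.
  by rewrite -mulrDl -mulrDl divff ?mul1r// gt_eqF.
by apply: lerD; apply: h; rewrite ?x0 ?y0 ?lerDl ?lerDr.
Qed.

Lemma poweR_subadd (x y : \bar R) r : (0 <= x)%E -> (0 <= y)%E -> 0 < r <= 1 ->
  ((x + y) `^ r <= x `^ r + y `^ r)%E.
Proof.
move=> x0 y0 r01; have /andP[r0 _] := r01; have rn0 : r != 0 by rewrite gt_eqF.
have ny (z : \bar R) : (z `^ r != -oo)%E by rewrite gt_eqF// (lt_le_trans _ (poweR_ge0 _ _)).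
case: x x0 => [x| |] x0 //; last first.
  have -> : (+oo + y = +oo)%E by rewrite addye// gt_eqF// (lt_le_trans _ y0).
  by rewrite poweRyr// addye.
case: y y0 => [y| |] y0 //; last by rewrite [(x%:E + +oo)%E]addey// poweRyr// addey.
by rewrite -EFinD !poweR_EFin -EFinD lee_fin powR_subadd.
Qed.

Lemma nneseries_poweR_subadd u r : (forall n, 0 <= u n)%E -> 0 < r <= 1 ->
  ((\sum_(n <oo) u n) `^ r <= \sum_(n <oo) u n `^ r)%E.
Proof.
move=> u0 r01; have /andP[r0 _] := r01.
apply: nneseries_poweR_le => // N.
apply: (@le_trans _ _ (\sum_(0 <= n < N) u n `^ r)%E).
  elim: N => [|N IH]; first by rewrite !big_nil poweR0r// gt_eqF.
  rewrite !big_nat_recr//=; apply: le_trans (poweR_subadd _ _ r01) _ => //.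
    exact: sume_ge0.
  by apply: leeD.
by apply: nneseries_lim_ge => n _ _; exact: poweR_ge0.
Qed.

Lemma nneseries_geometric_le (c rho : R) u (M : \bar R) : 0 <= rho < 1 -> 0 <= c ->
  (forall i, 0 <= u i <= M)%E ->
  (\sum_(i <oo) ((c * rho ^+ i)%:E * u i) <= (c / (1 - rho))%:E * M)%E.
Proof.
move=> /andP[rho0 rho1] c0 uM.
have M0 : (0 <= M)%E by have /andP[h1 h2] := uM 0%N; exact: le_trans h2.
have p0 i : 0 <= c * rho ^+ i by rewrite mulr_ge0// exprn_ge0.
apply: lime_le.
  apply: is_cvg_nneseries => i _ _; have /andP[h1 h2] := uM i.
  by apply: mule_ge0; rewrite ?lee_fin.
apply: nearW => m.
apply: (@le_trans _ _ (\sum_(0 <= i < m) ((c * rho ^+ i)%:E * M))%E).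
  apply: lee_sum => i _; have /andP[h1 h2] := uM i.
  by apply: lee_wpmul2l; rewrite ?lee_fin.
rewrite -ge0_sume_distrl//.
  apply: lee_wpmul2r => //; rewrite sumEFin lee_fin -mulr_sumr.
  rewrite ler_wpM2l// -[leRHS]mul1r ler_pdivlMr ?subr_gt0//.
  suff -> : (\sum_(0 <= i < m) rho ^+ i) * (1 - rho) = 1 - rho ^+ m.
    by rewrite gerBl exprn_ge0.
  elim: m => [|m IH]; first by rewrite big_nil mul0r expr0 subrr.
  by rewrite big_nat_recr//= mulrDl IH exprSr; ring.
by move=> i _; rewrite lee_fin.
Qed.

End Series.

(** * Pointwise bound for the sum of squares *)

Section SquareBound.
Variable R : realType.
Local Notation mu := (@lebesgue_measure R).
Implicit Types (f g phi : R -> R) (C L : R).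

(** Averaging $2ag \le a^2 + g^2$ with [a] the mean of [g], an argument that also covers an infinite
    mean of the square. *)
Lemma bavg_sqr_le r g x : 0 < r -> nneg_locint g ->
  (bavg r (fun y => (g y)%:E) x * bavg r (fun y => (g y)%:E) x <=
   bavg r (fun y => (g y ^+ 2)%:E) x)%E.
Proof.
move=> r0 [mg g0 gi].
have mgE : measurable_fun setT (fun y => (g y)%:E) by exact/measurable_EFinP.
have g0E y : (0 <= (g y)%:E)%E by rewrite lee_fin.
have mg2 : measurable_fun setT (fun y : R => (g y ^+ 2)%:E).
  by apply/measurable_EFinP; exact: measurable_funX.
have g20 y : (0 <= (g y ^+ 2)%:E)%E by rewrite lee_fin sqr_ge0.
have r2 : (0 <= ((2 * r)^-1)%:E)%E by rewrite lee_fin invr_ge0 mulr_ge0// ltW.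
have cst c : (((2 * r)^-1)%:E * (\int[mu]_(y in `[(x - r)%R, (x + r)%R]) c%:E) = c%:E)%E.
  rewrite lebesgue_integral_cst; last exact: measurable_itv.
  rewrite lebesgue_measure_itv/= lte_fin ltrBlDr -addrA ltrDl addr_gt0// -EFinB -!EFinM.
  by congr EFin; field; rewrite gt_eqF.
set A := bavg _ _ x.
have Af : A \is a fin_num.
  rewrite ge0_fin_numE; last by apply: bavg_ge0 => //; exact: ltW.
  by rewrite /A bavgE// lte_mul_pinfty ?ltry.
have [a EA] : exists a, A = a%:E by exists (fine A); rewrite fineK.
have A0 : 0 <= a by rewrite -lee_fin -EA bavg_ge0// ltW.
have h : (bavg r (fun y => (2 * a)%:E * (g y)%:E) x <= (a ^+ 2)%:E + bavg r (fun y => (g y ^+ 2)%:E) x)%E.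
  rewrite [in leRHS]bavgE// -{1}(cst (a ^+ 2)) -ge0_muleDr; last 2 first.
  - by apply: integral_ge0 => y _; rewrite lee_fin sqr_ge0.
  - exact: integral_ge0.
  rewrite bavgE; last 2 first.
  - exact: measurable_funeM.
  - by move=> y; rewrite mule_ge0// lee_fin mulr_ge0.
  apply: lee_wpmul2l => //; rewrite -ge0_integralD//; last 2 first.
  - by move=> y _; rewrite lee_fin sqr_ge0.
  - exact: measurable_funS mg2.
  apply: nneg_le_integral => y _; rewrite -?EFinM -?EFinD lee_fin.
    by rewrite !mulr_ge0.
  have := sqr_ge0 (a - g y); rewrite !expr2; lra.
rewrite bavgZ ?lee_fin ?mulr_ge0 ?(ltW r0)// in h.
move: h; rewrite -/A EA -!EFinM.
case: (bavg r (fun y => (g y ^+ 2)%:E) x) => [b| |]//=.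
  by rewrite -EFinD !lee_fin expr2; lra.
by move=> _; exact: leey.
Qed.

(** For $n = 4$ the weights are $2^{-m} 2^{-4i}$, and $2^{-4i} = 2^{-i} 2^{-3i}$. Two weighted
    Cauchy-Schwarz inequalities keep $2^{-m}$ and produce $2^{-i} 2^{-6i} = 2^{-7i}$; each costs a
    factor 2, so $64^2 = 32^2 \cdot 4$. *)
Lemma conv_sqr_pointwise C phi k L f x : bump C 5 phi k -> kernel_decay C 6 phi k ->
  unit_bounded L f ->
  ((conv f phi x ^+ 2)%:E <= ((64 * C) ^+ 2)%:E *
   \sum_(m <oo) ((2 ^- m)%:E * \sum_(i <oo) ((2 ^- (7 * i))%:E *
     bavg (2 ^+ i.+1 * 2 ^- k) (fun y => (dydiff f (k + m) y ^+ 2)%:E) x)))%E.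
Proof.
move=> bphi d3phi fL; have [_ C0 _ _ _] := bphi; have [lf _] := fL.
have w0 n : (0 <= (2 ^- n)%:E :> \bar R)%E by rewrite lee_fin ltW// expN2_gt0.
pose b m i := bavg (2 ^+ i.+1 * 2 ^- k) (fun y => `|dydiff f (k + m) y|%:E) x.
pose b2 m i := bavg (2 ^+ i.+1 * 2 ^- k) (fun y => (dydiff f (k + m) y ^+ 2)%:E) x.
have b0 m i : (0 <= b m i)%E.
  by apply: bavg_ge0 => [|y]; [rewrite ltW// dyrad_gt0|rewrite lee_fin].
have b20 m i : (0 <= b2 m i)%E.
  by apply: bavg_ge0 => [|y]; [rewrite ltW// dyrad_gt0|rewrite lee_fin sqr_ge0].
have bb m i : (b m i * b m i <= b2 m i)%E.
  rewrite /b2; under [X in bavg _ X]eq_fun do rewrite -[dydiff _ _ _ ^+ 2]real_normK ?num_real//.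
  by apply: bavg_sqr_le; [exact: dyrad_gt0|exact: nneg_locint_abs_dydiff].
pose Q m := (\sum_(i <oo) ((2 ^- i)%:E * ((2 ^- (3 * i))%:E * b m i)))%E.
have Q0 m : (0 <= Q m)%E by apply: nneseries_ge0 => i _ _; apply: mule_ge0 => //; exact: mule_ge0.
have Q2 m : (Q m * Q m <= 2%:E * \sum_(i <oo) ((2 ^- (7 * i))%:E * b2 m i))%E.
  apply: le_trans (nneseries_dyadic_sqr_le (b := fun i => ((2 ^- (3 * i))%:E * b m i)%E) _) _.
    by move=> i; rewrite mule_ge0.
  apply: lee_wpmul2l => //; apply: lee_nneseries => i _; first by move=> _; do ![apply: mule_ge0 => //].
  rewrite muleACA [leLHS]muleA -!EFinM.
  have -> : 2 ^- i * (2 ^- (3 * i) * 2 ^- (3 * i)) = 2 ^- (7 * i) :> R.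
    by rewrite -!invfM -!exprD; congr (2 ^- _); ring.
  by apply: lee_wpmul2l.
have F1 : (`|conv f phi x|%:E <= (32 * C)%:E * \sum_(m <oo) ((2 ^- m)%:E * Q m))%E.
  apply: le_trans (conv_pointwise (n := 4) isT bphi x d3phi fL) _.
  rewrite -nneseriesZl; last by move=> m _; rewrite mule_ge0.
  have t0 m i : (0 <= (32 * C * 2 ^- m * 2 ^- (4 * i))%:E * b m i)%E.
    apply: mule_ge0; last exact: b0.
    by rewrite lee_fin !mulr_ge0// ltW// expN2_gt0.
  apply: lee_nneseries => m _; first by move=> _; apply: nneseries_ge0 => i _ _; exact: t0.
  have s0 i : (0 <= (2 ^- i)%:E * ((2 ^- (3 * i))%:E * b m i))%E.
    by apply: mule_ge0 => //; exact: mule_ge0.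
  rewrite -nneseriesZl; last by move=> i _; exact: s0.
  rewrite -nneseriesZl; last by move=> i _; apply: mule_ge0 => //; exact: s0.
  apply: lee_nneseries => i _; first by move=> _; exact: t0.
  move: (b0 m i); rewrite -/(b m i); move: (b m i) => B B0.
  rewrite !muleA -!EFinM; apply: lee_wpmul2r => //.
  rewrite lee_fin; apply: eq_ler.
  by rewrite -(mulrA (32 * C * 2 ^- m)) -invfM -exprD.
have F2 : ((conv f phi x ^+ 2)%:E <= (32 * C)%:E * (\sum_(m <oo) ((2 ^- m)%:E * Q m)) *
    ((32 * C)%:E * \sum_(m <oo) ((2 ^- m)%:E * Q m)))%E.
  by rewrite -real_normK ?num_real// expr2 EFinM; apply: lee_pmul => //; rewrite lee_fin.
apply: le_trans F2 _; rewrite muleACA -EFinM.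
have c0 : (0 <= (32 * C * (32 * C))%:E)%E by rewrite lee_fin !mulr_ge0.
apply: le_trans (lee_wpmul2l c0 (nneseries_dyadic_sqr_le Q0)) _.
rewrite muleA -EFinM.
have -> : (64 * C) ^+ 2 = 32 * C * (32 * C) * 2 * 2 :> R by ring.
rewrite [X in (_ <= X * _)%E]EFinM -muleA; apply: lee_wpmul2l.
  by rewrite lee_fin !mulr_ge0.
rewrite -nneseriesZl; last by move=> m _; apply: mule_ge0 => //; apply: nneseries_ge0 => i _ _; apply: mule_ge0 => //; exact: (b20 m i).
apply: lee_nneseries => m _; first by move=> _; do ![apply: mule_ge0 => //].
by rewrite [leRHS]muleCA; apply: lee_wpmul2l.
Qed.

Lemma square_function_pointwise C (phi : nat -> R -> R) L f x :
  (forall k, bump C 5 (phi k) k) -> (forall k, kernel_decay C 6 (phi k) k) ->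
  unit_bounded L f ->
  (\sum_(k <oo) (conv f (phi k) x ^+ 2)%:E <= ((64 * C) ^+ 2)%:E *
   \sum_(m <oo) \sum_(i <oo) ((2 ^- m * 2 ^- (7 * i))%:E *
     dysum (fun k y => dydiff f (k + m) y ^+ 2)%R i.+1 x))%E.
Proof.
move=> bphi d3phi fL.
have w0 n : (0 <= (2 ^- n)%:E :> \bar R)%E by rewrite lee_fin ltW// expN2_gt0.
pose b2 k m i := bavg (2 ^+ i.+1 * 2 ^- k) (fun y => (dydiff f (k + m) y ^+ 2)%:E) x.
have b20 k m i : (0 <= b2 k m i)%E.
  by apply: bavg_ge0 => [|y]; [rewrite ltW// dyrad_gt0|rewrite lee_fin sqr_ge0].
pose P k m := (\sum_(i <oo) ((2 ^- m * 2 ^- (7 * i))%:E * b2 k m i))%E.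
have t0 k m i : (0 <= (2 ^- m * 2 ^- (7 * i))%:E * b2 k m i)%E.
  by rewrite mule_ge0// lee_fin mulr_ge0// ltW// expN2_gt0.
have P0 k m : (0 <= P k m)%E by exact: nneseries_ge0.
apply: (@le_trans _ _ (\sum_(k <oo) (((64 * C) ^+ 2)%:E * \sum_(m <oo) P k m))%E).
  apply: lee_nneseries => k _; first by move=> _; rewrite lee_fin sqr_ge0.
  apply: le_trans (conv_sqr_pointwise x (bphi k) (d3phi k) fL) _.
  apply: lee_wpmul2l; first by rewrite lee_fin sqr_ge0.
  apply: lee_nneseries => m _; first by move=> _; apply: mule_ge0 => //; apply: nneseries_ge0 => i _ _; apply: mule_ge0 => //; exact: (b20 k m i).
  rewrite -nneseriesZl; last by move=> i _; apply: mule_ge0 => //; exact: (b20 k m i).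
  by apply: lee_nneseries => i _; [move=> _; apply: mule_ge0 => //; apply: mule_ge0 => //; exact: (b20 k m i)|rewrite muleA -EFinM].
rewrite nneseriesZl; last by move=> k _; exact: nneseries_ge0.
apply: lee_wpmul2l; first by rewrite lee_fin sqr_ge0.
rewrite nneseries_interchange//; apply: lee_nneseries => m _; first by move=> _; exact: nneseries_ge0.
rewrite /P nneseries_interchange//; apply: lee_nneseries => i _; first by move=> _; exact: nneseries_ge0.
by rewrite nneseriesZl.
Qed.

End SquareBound.

(** * The square function of a nonnegative function *)

Section RealSquareFunction.
Variable R : realType.
Local Notation mu := (@lebesgue_measure R).
Implicit Types (f g kap : R -> R) (C L M p : R).

(** From $t \le 1 + t^p$. The bound is not homogeneous in [f], but it only ensures convergence: the
    right-hand side of [square_function_pointwise] is free of [L]. *)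
Lemma unit_bounded_of_Lp p M f : 1 < p -> measurable_fun setT f -> (forall x, 0 <= f x) ->
  (forall x, \int[mu]_(y in `[x, (x + 1)%R]) (f y `^ p)%:E <= M%:E)%E ->
  unit_bounded (1 + M) f.
Proof.
move=> p1 mf f0 fM.
have mfp : measurable_fun setT (fun y : R => (f y `^ p)%:E).
  by apply/measurable_EFinP; exact: (measurableT_comp (measurable_powR p)).
have b x : (\int[mu]_(y in `[x, (x + 1)%R]) (f y)%:E <= (1 + M)%:E)%E.
  apply: (@le_trans _ _ (\int[mu]_(y in `[x, (x + 1)%R]) (1%:E + (f y `^ p)%:E))%E).
    apply: nneg_le_integral => y _; rewrite -?EFinD lee_fin//.
    have [h|h] := leP (f y) 1; first by have := powR_ge0 (f y) p; lra.
    have : f y `^ 1 <= f y `^ p by apply: ler_powR; rewrite ltW.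
    by rewrite powRr1//; lra.
  rewrite ge0_integralD//; last 2 first.
  - by move=> y _; rewrite lee_fin powR_ge0.
  - exact: measurable_funS mfp.
  rewrite EFinD; apply: leeD => //.
  rewrite (lebesgue_integral_cst 1%:E); last exact: measurable_itv.
  by rewrite mul1e lebesgue_measure_itv/= lte_fin ltrDl ltr01 -EFinB addrAC subrr add0r.
split=> //; split=> // a c.
have mfE : measurable_fun setT (fun y : R => (f y)%:E) by exact/measurable_EFinP.
have f0E y : (0 <= (f y)%:E)%E by rewrite lee_fin.
have [n hn] : exists n : nat, c <= a + n%:R.
  exists (Num.truncn `|c - a|).+1.
  have := truncnS_gt `|c - a|; have := ler_norm (c - a); lra.
by apply: le_lt_trans (integral_itv_unit_bound mfE f0E b hn) _; rewrite -EFinM ltry.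
Qed.

Lemma measurable_nconv g kap : measurable_fun setT g -> (forall y, 0 <= g y) ->
  measurable_fun setT kap -> (forall y, 0 <= kap y) -> measurable_fun setT (nconv g kap).
Proof.
move=> mg g0 mk k0.
pose F (z : R * R) := ((g (z.1 - z.2))%:E * (kap z.2)%:E)%E.
have mF : measurable_fun setT F.
  apply: emeasurable_funM; apply/measurable_EFinP.
  - by apply: (measurableT_comp mg); exact: measurable_funB.
  - by apply: (measurableT_comp mk); exact: measurable_snd.
apply: (@measurable_fun_fubini_tonelli_F _ _ _ _ _ mu F mF).
by move=> z; rewrite mule_ge0// lee_fin.
Qed.

Variables (C : R) (phi : nat -> R -> R).
Hypotheses (bphi : forall k, bump C 5 (phi k) k) (dphi : forall k, kernel_decay C 6 (phi k) k).

Lemma measurable_conv L f k : unit_bounded L f -> measurable_fun setT (conv f (phi k)).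
Proof.
move=> fL; have [[mf f0 _] _] := fL; have [mphi _ _ _ _] := bphi k.
have -> : conv f (phi k) = fun x => fine (nconv f (pos_part (phi k)) x) -
    fine (nconv f (pos_part (fun y => - phi k y)) x).
  apply/funext => x; have [a b E] := conv_nconvE (n := 4) isT (bphi k) x fL.
  by rewrite -fineB// -E.
have mpp (h : R -> R) : measurable_fun setT h ->
    measurable_fun setT (fun x => fine (nconv f (pos_part h) x)).
  move=> mh; apply: measurableT_comp => //; apply: measurable_nconv => //.
    exact: measurable_pos_part.
  exact: pos_part_ge0.
by apply: measurable_funB; apply: mpp => //; exact: measurableT_comp.
Qed.

Definition sqfun f x : \bar R := (\sum_(k <oo) (conv f (phi k) x ^+ 2)%:E)%E.

Lemma measurable_sqfun L f : unit_bounded L f -> measurable_fun setT (sqfun f).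
Proof.
move=> fL; apply: ge0_emeasurable_sum => [k x _ _|k _]; first by rewrite lee_fin sqr_ge0.
by apply/measurable_EFinP; apply: measurable_funX; exact: measurable_conv fL.
Qed.

(** The balance of the exponents of 2. For [m] it is exactly $-p/2 + p(2-p)/2 = -p(p-1)/2$. For [i]
    it is $-7p/2 + p(2-p)/2 + 1$, which is below $-1$. *)
Lemma dyadic_weight_le2 p (m i : nat) : 1 < p <= 2 ->
  (2 ^- m * 2 ^- (7 * i)) `^ (p / 2) *
    ((2 ^+ (m + i.+1)) `^ (p * (2 - p) / 2) * 2 ^+ i.+1) <=
  4 * (2 `^ (- (p * (p - 1) / 2))) ^+ m * 2^-1 ^+ i :> R.
Proof.
move=> /andP[p1 p2].
have E (n : nat) : 2 ^+ n = 2 `^ n%:R :> R by rewrite powR_mulrn.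
have EV (n : nat) : 2 ^- n = 2 `^ (- n%:R) :> R by rewrite powRN E.
rewrite exprVn !EV (_ : 4 = 2 `^ 2 :> R); last by rewrite -(E 2%N); ring.
rewrite !E -[_ ^+ m]powR_mulrn ?powR_ge0// -!powRD; try by rewrite pnatr_eq0 implybT.
rewrite -!powRrM -!powRD; try by rewrite pnatr_eq0 implybT.
apply: ler_powR; first by rewrite ler1n.
rewrite natrD natrM -addn1 natrD; set I := i%:R; set N := m%:R.
have I0 : 0 <= I by exact: ler0n.
have I1 : 0 <= I * (p - 1) by rewrite mulr_ge0//; lra.
have e0 : 0 <= (p - 1) * (p - 1) by rewrite -expr2 sqr_ge0.
have I2 : 0 <= I * ((p - 1) * (p - 1)) by rewrite mulr_ge0.
by nra.
Qed.

(** As $p/2 \le 1$, the power $p/2$ of the double series is at most the series of the powers, so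
    each pair of offsets is integrated separately and two geometric series remain. *)
Lemma integral_sqfun_le2 p : 1 < p <= 2 -> exists2 A : R, 0 <= A & forall f M x0,
  measurable_fun setT f -> (forall x, 0 <= f x) ->
  (forall x, \int[mu]_(y in `[x, (x + 1)%R]) (f y `^ p)%:E <= M%:E)%E ->
  (\int[mu]_(x in `[x0, (x0 + 1)%R]) (sqfun f x `^ (p / 2)%R) <= (A * M)%:E)%E.
Proof.
move=> p12; have /andP[p1 p2] := p12.
have [C1 C10 H] := local_square_bound_le2 (R := R) p12.
pose rho : R := 2 `^ (- (p * (p - 1) / 2)).
have rho01 : 0 <= rho < 1.
  rewrite powR_ge0/= /rho powRN invf_lt1 ?powR_gt0//.
  apply: (@le_lt_trans _ _ (1 `^ (p * (p - 1) / 2))); first by rewrite powR1.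
  apply: gt0_ltr_powR; rewrite ?nnegrE ?ler0n ?ler01 ?ltr1n//.
  by rewrite divr_gt0// mulr_gt0//; lra.
have r01 : 0 < p / 2 <= 1 by apply/andP; split; lra.
have /andP[r0 _] := r01.
exists (((64 * C) ^+ 2) `^ (p / 2) * (4 * C1 / (1 - rho) * 2)).
  have : 0 <= (1 - rho)^-1 by rewrite invr_ge0; lra.
  by move=> h; rewrite !mulr_ge0// powR_ge0.
move=> f M x0 mf f0 fM.
have fL := unit_bounded_of_Lp p1 mf f0 fM; have [lf _] := fL.
have M0 : 0 <= M.
  rewrite -lee_fin; apply: le_trans (fM 0); apply: integral_ge0 => y _.
  by rewrite lee_fin powR_ge0.
pose w m i : R := 2 ^- m * 2 ^- (7 * i).
have w0 m i : 0 <= w m i by rewrite mulr_ge0// ltW// expN2_gt0.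
pose D m i := dysum (fun k y => dydiff f (k + m) y ^+ 2)%R i.+1.
have D0 m i x : (0 <= D m i x)%E by apply: dysum_ge0 => k y; exact: sqr_ge0.
have mD m i : measurable_fun setT (D m i).
  by apply: measurable_dysum => [k|k y]; [apply: measurable_funX; exact: measurable_dydiff|exact: sqr_ge0].
have mDp m i : measurable_fun setT (fun x => D m i x `^ (p / 2)%R)%E.
  exact: (measurableT_comp (measurable_poweR _)).
pose c := ((64 * C) ^+ 2) `^ (p / 2).
have c0 : (0 <= c%:E)%E by rewrite lee_fin powR_ge0.
pose T m x := (\sum_(i <oo) ((w m i `^ (p / 2))%:E * D m i x `^ (p / 2)%R))%E.
have t0 m i x : (0 <= (w m i `^ (p / 2))%:E * D m i x `^ (p / 2)%R)%E.
  by rewrite mule_ge0 ?poweR_ge0// lee_fin powR_ge0.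
have T0 m x : (0 <= T m x)%E by apply: nneseries_ge0.
have mT m : measurable_fun setT (T m).
  apply: ge0_emeasurable_sum => [i x _ _|i _]; first exact: t0.
  by apply: measurable_funeM.
have point x : (sqfun f x `^ (p / 2)%R <= c%:E * \sum_(m <oo) T m x)%E.
  have S0 m : (0 <= \sum_(i <oo) ((w m i)%:E * D m i x))%E.
    by apply: nneseries_ge0 => i _ _; rewrite mule_ge0// lee_fin.
  apply: le_trans (lee_poweR (ltW r0) _ (square_function_pointwise x bphi dphi fL)) _.
    by apply: nneseries_ge0 => k _ _; rewrite lee_fin sqr_ge0.
  rewrite poweRM ?lee_fin ?sqr_ge0//; last by apply: nneseries_ge0 => m _ _; exact: (S0 m).
  rewrite poweR_EFin; apply: lee_wpmul2l => //.
  apply: le_trans (nneseries_poweR_subadd S0 r01) _.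
  apply: lee_nneseries => m _; first by move=> _; exact: poweR_ge0.
  apply: le_trans (nneseries_poweR_subadd _ r01) _.
    by move=> i; rewrite mule_ge0// lee_fin.
  apply: lee_nneseries => i _; first by move=> _; exact: poweR_ge0.
  by rewrite poweRM ?lee_fin// poweR_EFin.
apply: (@le_trans _ _ (\int[mu]_(x in `[x0, (x0 + 1)%R]) (c%:E * \sum_(m <oo) T m x))%E).
  by apply: nneg_le_integral => x _; [exact: poweR_ge0|exact: point].
have mST : measurable_fun setT (fun x => \sum_(m <oo) T m x)%E.
  by apply: ge0_emeasurable_sum.
rewrite ge0_integralZl//; last 2 first.
- exact: measurable_funS mST.
- by move=> x _; exact: nneseries_ge0.
rewrite -mulrA EFinM; apply: lee_wpmul2l => //.
rewrite integral_nneseries//; last by move=> m; exact: measurable_funS (mT m).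
apply: (@le_trans _ _ (\sum_(m <oo) ((4 * C1 * rho ^+ m)%:E * (2 * M)%:E))%E); last first.
  apply: le_trans (nneseries_geometric_le (M := (2 * M)%:E) rho01 _ _) _.
  - by rewrite mulr_ge0.
  - by move=> _; rewrite lexx andbT lee_fin mulr_ge0.
  by rewrite -EFinM mulrA.
apply: lee_nneseries => m _; first by move=> _; exact: integral_ge0.
rewrite integral_nneseries//; last first.
  by move=> i; apply: measurable_funeM; exact: measurable_funS (mDp m i).
have h2 : 0 <= (2^-1 : R) < 1 by rewrite invr_ge0 ler0n invf_lt1// ltr1n.
have rm0 : 0 <= 4 * C1 * rho ^+ m.
  by rewrite !mulr_ge0// exprn_ge0//; have /andP[] := rho01.
apply: (@le_trans _ _ (\sum_(i <oo) ((4 * C1 * rho ^+ m * 2^-1 ^+ i)%:E * M%:E))%E); last first.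
  apply: le_trans (nneseries_geometric_le (M := M%:E) h2 rm0 _) _.
    by move=> _; rewrite lexx andbT lee_fin.
  by rewrite -!EFinM lee_fin; apply: eq_ler; field.
apply: lee_nneseries => i _; first by move=> _; exact: integral_ge0.
rewrite ge0_integralZl//; last 3 first.
- exact: measurable_funS (mDp m i).
- by move=> x _; exact: poweR_ge0.
- by rewrite lee_fin powR_ge0.
have wp0 : (0 <= (w m i `^ (p / 2))%:E)%E by rewrite lee_fin powR_ge0.
apply: le_trans (lee_wpmul2l wp0 (H f M x0 m i.+1 lf fM)) _.
rewrite -!EFinM lee_fin.
have W := dyadic_weight_le2 m i p12.
have -> : w m i `^ (p / 2) * (C1 * (2 ^+ (m + i.+1)%N) `^ (p * (2 - p) / 2) * (2 ^+ i.+1 * M)) =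
   C1 * M * (w m i `^ (p / 2) * ((2 ^+ (m + i.+1)%N) `^ (p * (2 - p) / 2) * 2 ^+ i.+1)) by ring.
have -> : 4 * C1 * rho ^+ m * 2^-1 ^+ i * M = C1 * M * (4 * rho ^+ m * 2^-1 ^+ i) by ring.
by apply: ler_wpM2l => //; exact: mulr_ge0.
Qed.

(** A crude bound, from which the finiteness of the integrals of [sqpart] will follow. *)
Lemma conv_abs_le L f k x : unit_bounded L f -> `|conv f (phi k) x| <= 8 * C * 2 ^+ k * L.
Proof.
move=> fL; have [mphi C0 d _ _] := bphi k; have [[mf f0 _] _] := fL.
rewrite -lee_fin; apply: le_trans (kernel_integral_bound (n := 4) x mphi C0 isT d fL).
have mI : measurable_fun setT (fun y : R => f (x - y) * phi k y).
  by apply: measurable_funM => //; apply: measurableT_comp => //; exact: measurable_funB.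
apply: le_trans (normr_Rintegral_le mI) _; apply: nneg_le_integral => y _ //.
by rewrite normrM (ger0_norm (f0 _)) mulrC EFinM.
Qed.

(** There is no loss in [m], and $2^{i+1}$ is beaten by $2^{-7i}$. The factor 8 is the 2 of
    $2^{i+1}$ times the sums of two geometric series of ratio $1/2$. *)
Lemma integral_dysum_series_gt2 p : 2 < p -> exists2 A : R, 0 <= A & forall f M x0 (v : R -> R),
  nneg_locint f -> 0 <= M ->
  (forall x, \int[mu]_(y in `[x, (x + 1)%R]) (f y `^ p)%:E <= M%:E)%E ->
  measurable_fun setT v -> (forall x, 0 <= v x) ->
  (forall x, ~ (x0 <= x <= x0 + 1) -> v x = 0) ->
  mu.-integrable setT (EFin \o v) ->
  (\int[mu]_x ((v x)%:E * \sum_(m <oo) \sum_(i <oo) ((2 ^- m * 2 ^- (7 * i))%:E *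
     dysum (fun k y => dydiff f (k + m) y ^+ 2)%R i.+1 x)) <=
   (A * M `^ (2 / p))%:E * (\int[mu]_x (v x `^ (p / (p - 2)))%:E) `^ (1 - 2 / p))%E.
Proof.
move=> p2; have [C1 C10 H] := local_square_bound_gt2 (R := R) p2.
exists (8 * C1); first by rewrite mulr_ge0.
move=> f M x0 v lf M0 fM mv v0 vI iv.
pose w m i : R := 2 ^- m * 2 ^- (7 * i).
have w0 m i : 0 <= w m i by rewrite mulr_ge0// ltW// expN2_gt0.
pose D m i := dysum (fun k y => dydiff f (k + m) y ^+ 2)%R i.+1.
have D0 m i x : (0 <= D m i x)%E by apply: dysum_ge0 => k y; exact: sqr_ge0.
have mD m i : measurable_fun setT (D m i).
  by apply: measurable_dysum => [k|k y]; [apply: measurable_funX; exact: measurable_dydiff|exact: sqr_ge0].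
have mvE : measurable_fun setT (fun x : R => (v x)%:E) by exact/measurable_EFinP.
pose F m i x := ((w m i)%:E * ((v x)%:E * D m i x))%E.
have F0 m i x : (0 <= F m i x)%E.
  by apply: mule_ge0; [rewrite lee_fin|apply: mule_ge0 => //; rewrite lee_fin].
have mvD m i : measurable_fun setT (fun x => (v x)%:E * D m i x)%E by exact: emeasurable_funM.
have mF m i : measurable_fun setT (F m i) by exact: measurable_funeM.
have mFs m : measurable_fun setT (fun x => \sum_(i <oo) F m i x)%E.
  by apply: ge0_emeasurable_sum.
have -> : (\int[mu]_x ((v x)%:E * \sum_(m <oo) \sum_(i <oo) ((w m i)%:E * D m i x)) =
   \sum_(m <oo) \sum_(i <oo) \int[mu]_x F m i x)%E.
  transitivity (\int[mu]_x \sum_(m <oo) \sum_(i <oo) F m i x)%E.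
    apply: eq_integral => x _.
    have wD m i : (0 <= (w m i)%:E * D m i x)%E by apply: mule_ge0; rewrite ?lee_fin.
    rewrite -nneseriesZl; last by move=> m _; exact: nneseries_ge0.
    apply: eq_eseriesr => m _; rewrite -nneseriesZl; last by move=> i _.
    by apply: eq_eseriesr => i _; rewrite /F muleCA.
  rewrite integral_nneseries//; last by move=> m x _; exact: nneseries_ge0.
  apply: eq_eseriesr => m _; rewrite integral_nneseries//; exact: mF.
set X := (_ `^ (1 - 2 / p))%E; have X0 : (0 <= X)%E by exact: poweR_ge0.
have h2 : 0 <= (2^-1 : R) < 1 by rewrite invr_ge0 ler0n invf_lt1// ltr1n.
set B := ((C1 * M `^ (2 / p))%:E * X)%E.
have B0 : (0 <= B)%E by apply: mule_ge0 => //; rewrite lee_fin mulr_ge0// powR_ge0.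
apply: (@le_trans _ _ (\sum_(m <oo) ((4 * 2^-1 ^+ m)%:E * B))%E); last first.
  apply: le_trans (nneseries_geometric_le (M := B) h2 _ _) _ => //.
    by move=> _; rewrite B0 lexx.
  rewrite /B muleA -EFinM; apply: lee_wpmul2r => //.
  by rewrite lee_fin; apply: eq_ler; field.
apply: lee_nneseries => m _; first by move=> _; apply: nneseries_ge0 => i _ _; exact: integral_ge0.
have hm0 : 0 <= 2 * 2^-1 ^+ m :> R by rewrite mulr_ge0// exprn_ge0// invr_ge0.
apply: (@le_trans _ _ (\sum_(i <oo) ((2 * 2^-1 ^+ m * 2^-1 ^+ i)%:E * B))%E); last first.
  apply: le_trans (nneseries_geometric_le (M := B) h2 hm0 _) _.
    by move=> _; rewrite B0 lexx.
  apply: lee_wpmul2r => //.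
  by rewrite lee_fin; apply: eq_ler; field.
apply: lee_nneseries => i _; first by move=> _; exact: integral_ge0.
rewrite /F ge0_integralZl ?lee_fin//; last by move=> x _; apply: mule_ge0 => //; rewrite lee_fin.
have wE : (0 <= (w m i)%:E)%E by rewrite lee_fin.
apply: le_trans (lee_wpmul2l wE (H f M x0 m i.+1 v lf fM mv v0 vI iv)) _.
rewrite /B !muleA -!EFinM; apply: lee_wpmul2r => //; rewrite lee_fin.
have -> : w m i * (C1 * 2 ^+ i.+1 * M `^ (2 / p)) = C1 * M `^ (2 / p) * (w m i * 2 ^+ i.+1) by ring.
rewrite mulrC; apply: ler_wpM2r; first by rewrite mulr_ge0// powR_ge0.
rewrite /w !exprVn exprS.
have -> : 2 ^- m * 2 ^- (7 * i) * (2 * 2 ^+ i) = 2 * 2 ^- m * (2 ^- (7 * i) * 2 ^+ i) :> R by ring.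
rewrite ler_wpM2l ?mulr_ge0 ?(ltW (expN2_gt0 R m))//.
rewrite mulrC ler_pdivrMr ?exp2_gt0// mulrC ler_pdivlMr ?exp2_gt0// -exprD.
  by rewrite ler_eXn2l ?ltr1n// addnn -mul2n leq_mul2r orbT.
exact: mvD.
Qed.

(** For $X > 0$ one divides by $X^{1-2/p}$. This needs a finite [X], which is the reason for the
    truncated sums [sqpart]. *)
Lemma powR_absorb p D X : 2 < p -> 0 <= D -> 0 <= X -> X <= D * X `^ (1 - 2 / p) -> X <= D `^ (p / 2).
Proof.
move=> p2 D0 X0 h; have [->|Xn0] := eqVneq X 0; first exact: powR_ge0.
have {}X0 : 0 < X by rewrite lt_neqAle eq_sym Xn0.
have p0 : 0 < p by lra.
have e : X = X `^ (2 / p) * X `^ (1 - 2 / p).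
  rewrite -powRD ?(gt_eqF X0) ?implybT//.
  have -> : 2 / p + (1 - 2 / p) = 1 by ring.
  by rewrite powRr1// ltW.
have h' : X `^ (2 / p) <= D.
  by move: h; rewrite {1}e ler_pM2r// powR_gt0.
have -> : X = (X `^ (2 / p)) `^ (p / 2).
  by rewrite -powRrM (_ : 2 / p * (p / 2) = 1) ?powRr1 ?(ltW X0)//; field; rewrite gt_eqF.
by apply: ge0_ler_powR => //; rewrite ?nnegrE ?powR_ge0// divr_ge0// ltW.
Qed.

Definition sqpart f (K : nat) x : R := \sum_(0 <= k < K) conv f (phi k) x ^+ 2.

(** With $S$ the truncated sum, $v = S^{p/2-1}$ on the unit interval is extremal in the duality: $vS
    = S^{p/2}$ and $v^{p/(p-2)} = S^{p/2}$. The same integral thus appears on both sides of the dual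
    estimate, and [powR_absorb] cancels it. *)
Lemma integral_sqpart_gt2 p : 2 < p -> exists2 A : R, 0 <= A & forall f M x0 K,
  measurable_fun setT f -> (forall x, 0 <= f x) ->
  (forall x, \int[mu]_(y in `[x, (x + 1)%R]) (f y `^ p)%:E <= M%:E)%E ->
  (\int[mu]_(x in `[x0, (x0 + 1)%R]) (sqpart f K x `^ (p / 2)%R)%:E <= (A * M)%:E)%E.
Proof.
move=> p2; have p1 : 1 < p by lra.
have p0 : 0 < p by lra.
have [A A0 H] := integral_dysum_series_gt2 p2.
exists (((64 * C) ^+ 2 * A) `^ (p / 2)); first exact: powR_ge0.
move=> f M x0 K mf f0 fM.
have fL := unit_bounded_of_Lp p1 mf f0 fM; have [lf _] := fL.
have M0 : 0 <= M.
  rewrite -lee_fin; apply: le_trans (fM 0); apply: integral_ge0 => y _.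
  by rewrite lee_fin powR_ge0.
have mB : measurable_fun setT (sqpart f K).
  by apply: measurable_sum => k; apply: measurable_funX; exact: measurable_conv fL.
have B0 x : 0 <= sqpart f K x by apply: sumr_ge0 => k _; exact: sqr_ge0.
pose I := (`[x0, x0 + 1]%classic : set R).
have mI : measurable I by exact: measurable_itv.
pose v x := sqpart f K x `^ (p / 2 - 1) * \1_I x.
have mBp r : measurable_fun setT (fun x => sqpart f K x `^ r).
  exact: (measurableT_comp (measurable_powR r)).
have mv : measurable_fun setT v by apply: measurable_funM => //; exact: measurable_indic.
have v0 x : 0 <= v x by rewrite mulr_ge0 ?powR_ge0.
have vI x : ~ (x0 <= x <= x0 + 1) -> v x = 0.
  by move=> h; rewrite /v indicE memNset ?mulr0//= in_itv.
pose b : R := \sum_(0 <= k < K) (8 * C * 2 ^+ k * (1 + M)) ^+ 2.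
have Bb x : sqpart f K x <= b.
  apply: ler_sum => k _; rewrite -real_normK ?num_real// ler_sqr ?nnegrE//.
    exact: conv_abs_le fL.
  exact: le_trans (conv_abs_le k x fL).
have fin r : 0 < r -> (\int[mu]_(x in I) (sqpart f K x `^ r)%:E < +oo)%E.
  move=> r0; apply: (@le_lt_trans _ _ (\int[mu]_(x in I) (b `^ r)%:E)%E).
    apply: nneg_le_integral => x _; rewrite lee_fin ?powR_ge0//.
    by apply: ge0_ler_powR; rewrite ?nnegrE ?(ltW r0)// (le_trans _ (Bb x)).
  rewrite lebesgue_integral_cst// /I lebesgue_measure_itv/= lte_fin ltrDl ltr01.
  by rewrite -EFinB -EFinM ltry.
have cut r : (fun x => (sqpart f K x `^ r * \1_I x)%:E) =
    (fun x => ((sqpart f K x `^ r)%:E * (\1_I x)%:E)%E).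
  by apply/funext => x; rewrite EFinM.
have iv : mu.-integrable setT (EFin \o v).
  apply/integrableP; split; first exact/measurable_EFinP.
  under eq_integral do rewrite /= (ger0_norm (v0 _)).
  rewrite /v cut integral_mul_indic; apply: fin; lra.
have r1 : 0 < p / 2 by lra.
pose X := fine (\int[mu]_(x in I) (sqpart f K x `^ (p / 2))%:E)%E.
have XE : (X%:E = \int[mu]_(x in I) (sqpart f K x `^ (p / 2))%:E)%E.
  rewrite /X fineK// ge0_fin_numE ?fin//.
  by apply: integral_ge0 => x _; rewrite lee_fin powR_ge0.
have X0 : 0 <= X.
  by rewrite -lee_fin XE; apply: integral_ge0 => x _; rewrite lee_fin powR_ge0.
rewrite -/I -XE lee_fin.
have Ev : (\int[mu]_x (v x `^ (p / (p - 2)))%:E = X%:E)%E.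
  rewrite XE -[RHS]integral_mul_indic; apply: eq_integral => x _.
  rewrite /v powRM ?powR_ge0// -powRrM -EFinM; congr ((_ * _)%:E).
    by congr (_ `^ _); field; lra.
  by rewrite indicE; case: (_ \in _); rewrite ?powR1 ?powR0// gt_eqF// divr_gt0//; lra.
have XB : (X%:E <= \int[mu]_x ((v x)%:E * ((64 * C) ^+ 2)%:E * \sum_(m <oo) \sum_(i <oo)
   ((2 ^- m * 2 ^- (7 * i))%:E * dysum (fun k y => dydiff f (k + m) y ^+ 2)%R i.+1 x)))%E.
  rewrite XE -[leLHS]integral_mul_indic; apply: nneg_le_integral => x _.
    by rewrite -EFinM lee_fin mulr_ge0// powR_ge0.
  have -> : ((sqpart f K x `^ (p / 2))%:E * (\1_I x)%:E = (v x)%:E * (sqpart f K x)%:E)%E.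
    rewrite -!EFinM /v -(mulr_powRB1 (B0 x) r1); congr EFin; ring.
  rewrite -muleA; apply: lee_wpmul2l; first by rewrite lee_fin.
  apply: le_trans (square_function_pointwise x bphi dphi fL).
  rewrite /sqpart -sumEFin; apply: nneseries_lim_ge => k _ _.
  by rewrite lee_fin sqr_ge0.
have c0 : 0 <= (64 * C) ^+ 2 by exact: sqr_ge0.
have HX := H f M x0 v lf M0 fM mv v0 vI iv.
rewrite Ev poweR_EFin -EFinM in HX.
have S0 x : (0 <= \sum_(m <oo) \sum_(i <oo)
   ((2 ^- m * 2 ^- (7 * i))%:E * dysum (fun k y => dydiff f (k + m) y ^+ 2)%R i.+1 x))%E.
  apply: nneseries_ge0 => m _ _; apply: nneseries_ge0 => i _ _.
  apply: mule_ge0; first by rewrite lee_fin mulr_ge0// ltW// expN2_gt0.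
  by apply: dysum_ge0 => k y; exact: sqr_ge0.
have mS : measurable_fun setT (fun x => \sum_(m <oo) \sum_(i <oo)
   ((2 ^- m * 2 ^- (7 * i))%:E * dysum (fun k y => dydiff f (k + m) y ^+ 2)%R i.+1 x))%E.
  have D0 m i x : (0 <= dysum (fun k y => dydiff f (k + m) y ^+ 2)%R i.+1 x)%E.
    by apply: dysum_ge0 => k y; exact: sqr_ge0.
  have w0 m i : (0 <= (2 ^- m * 2 ^- (7 * i) : R)%:E)%E.
    by rewrite lee_fin mulr_ge0// ltW// expN2_gt0.
  apply: ge0_emeasurable_sum => [m x _ _|m _]; first by apply: nneseries_ge0 => i _ _; exact: mule_ge0.
  apply: ge0_emeasurable_sum => [i x _ _|i _]; first exact: mule_ge0.
  apply: measurable_funeM; apply: measurable_dysum => [k|k y]; last exact: sqr_ge0.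
  by apply: measurable_funX; exact: measurable_dydiff.
have mvE : measurable_fun setT (fun x : R => (v x)%:E) by exact/measurable_EFinP.
have {}XB : X <= (64 * C) ^+ 2 * (A * M `^ (2 / p) * X `^ (1 - 2 / p)).
  rewrite -lee_fin EFinM; apply: le_trans XB _.
  under eq_integral do rewrite [((v _)%:E * _)%E]muleC -muleA.
  rewrite ge0_integralZl ?lee_fin//.
  - by apply: lee_wpmul2l; rewrite ?lee_fin.
  - exact: emeasurable_funM.
  - by move=> x _; apply: mule_ge0 => //; rewrite lee_fin.
have D0 : 0 <= (64 * C) ^+ 2 * A * M `^ (2 / p) by apply: mulr_ge0; [exact: mulr_ge0|exact: powR_ge0].
have := @powR_absorb p _ X p2 D0 X0; rewrite !mulrA in XB * => /(_ XB).
move=> XD; apply: le_trans XD _.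
have cA : 0 <= (64 * C) ^+ 2 * A by exact: mulr_ge0.
rewrite (powRM _ cA (powR_ge0 M (2 / p))) -powRrM.
have -> : 2 / p * (p / 2) = 1 by field; rewrite gt_eqF.
by rewrite powRr1.
Qed.

(** The bound for [sqpart] is uniform in [K], so monotone convergence removes the truncation. *)
Lemma integral_sqfun_gt2 p : 2 < p -> exists2 A : R, 0 <= A & forall f M x0,
  measurable_fun setT f -> (forall x, 0 <= f x) ->
  (forall x, \int[mu]_(y in `[x, (x + 1)%R]) (f y `^ p)%:E <= M%:E)%E ->
  (\int[mu]_(x in `[x0, (x0 + 1)%R]) (sqfun f x `^ (p / 2)%R) <= (A * M)%:E)%E.
Proof.
move=> p2; have p1 : 1 < p by lra.
have [A A0 H] := integral_sqpart_gt2 p2; exists A => // f M x0 mf f0 fM.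
have fL := unit_bounded_of_Lp p1 mf f0 fM.
have r0 : 0 < p / 2 by lra.
have mB K : measurable_fun setT (fun x : R => (sqpart f K x `^ (p / 2))%:E).
  apply/measurable_EFinP; apply: (measurableT_comp (measurable_powR (p / 2))).
  by apply: measurable_sum => k; apply: measurable_funX; exact: measurable_conv fL.
have B0 K x : 0 <= sqpart f K x by apply: sumr_ge0 => k _; exact: sqr_ge0.
pose g K (x : R) := (sqpart f K x `^ (p / 2))%:E.
have nd x : nondecreasing_seq (g ^~ x).
  apply/nondecreasing_seqP => K; rewrite lee_fin; apply: ge0_ler_powR; rewrite ?nnegrE ?(ltW r0)//.
  by rewrite /sqpart big_nat_recr//= lerDl sqr_ge0.
apply: (@le_trans _ _ (\int[mu]_(x in `[x0, (x0 + 1)%R]) limn (g ^~ x))%E).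
  apply: nneg_le_integral => x _; first exact: poweR_ge0.
  apply: nneseries_poweR_le => // [k|K]; first by rewrite lee_fin sqr_ge0.
  rewrite sumEFin poweR_EFin.
  have /cvg_lim -> // := ereal_nondecreasing_cvgn (nd x).
  by apply: ereal_sup_ubound; exists K.
rewrite monotone_convergence//.
- apply: lime_le.
    apply: ereal_nondecreasing_is_cvgn => a b ab; apply: nneg_le_integral => x _.
      by rewrite lee_fin powR_ge0.
    exact: nd.
  by apply: nearW => K; exact: H.
- by move=> K; exact: measurable_funS (mB K).
- by move=> K x _; rewrite lee_fin powR_ge0.
Qed.

Lemma integral_sqfun p : 1 < p -> exists2 A : R, 0 <= A & forall f M x0,
  measurable_fun setT f -> (forall x, 0 <= f x) ->
  (forall x, \int[mu]_(y in `[x, (x + 1)%R]) (f y `^ p)%:E <= M%:E)%E ->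
  (\int[mu]_(x in `[x0, (x0 + 1)%R]) (sqfun f x `^ (p / 2)%R) <= (A * M)%:E)%E.
Proof.
move=> p1; have [p2|p2] := leP p 2; last exact: integral_sqfun_gt2.
by apply: integral_sqfun_le2; rewrite p1.
Qed.

End RealSquareFunction.

(** * Schwartz kernels and complex values *)

Section Schwartz.
Variable R : realType.
Local Notation mu := (@lebesgue_measure R).
Implicit Types (eta phi : R -> R) (K C : R).

(** The least exponent with $|t| \le 2^i$; minimality gives $2^{i-1} < |t|$ unless $i = 0$. *)
Lemma dyadic_scale (t : R) : exists i : nat, `|t| <= 2 ^+ i /\ (i = 0%N \/ 2 ^+ i < 2 * `|t|).
Proof.
have ex : exists n : nat, `|t| <= 2 ^+ n.
  exists (Num.truncn `|t|).+1; apply: ltW; apply: lt_le_trans (truncnS_gt _) _.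
  by rewrite -natrX ler_nat ltnW// ltn_expl.
exists (ex_minn ex); case: ex_minnP => i hi mini; split=> //.
case: i hi mini => [|i] hi mini; [by left|right].
rewrite exprS ltr_pM2l// ltNge; apply/negP => /mini; by rewrite ltnn.
Qed.

(** The value [v] is attached to a point [xi] that may differ from [t], to allow for the mean value
    point in [dilate_diff_decay]. When $i > 0$, $|\xi| \le 1$ gives $2^i < 6$ and $|\xi| > 1$ gives
    $2^i < 6|\xi|$; this is the 6. *)
Lemma moment_decay K N (t xi v : R) (i : nat) : (i = 0%N \/ 2 ^+ i < 2 * `|t|) ->
  `|t| <= `|xi| + 2 -> `|v| <= K -> `|xi| ^+ N * `|v| <= K ->
  `|v| <= 6 ^+ N * K * 2 ^- (N * i).
Proof.
move=> hi ht vK xK; have K0 : 0 <= K by exact: le_trans vK.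
have six : 1 <= 6 ^+ N :> R by rewrite exprn_ege1// ler1n.
rewrite ler_pdivlMr ?exp2_gt0//.
case: hi => [->|hi].
  by rewrite muln0 expr0 mulr1; apply: le_trans vK _; rewrite ler_peMl.
rewrite mulnC exprM.
have [x1|x1] := leP `|xi| 1.
  rewrite mulrC; apply: ler_pM => //; rewrite ?exprn_ge0//.
  by rewrite lerXn2r ?nnegrE ?exprn_ge0//; lra.
apply: (@le_trans _ _ (`|v| * (6 * `|xi|) ^+ N)).
  rewrite ler_wpM2l//; rewrite lerXn2r ?nnegrE ?exprn_ge0 ?mulr_ge0//; lra.
by rewrite exprMn mulrCA ler_wpM2l ?exprn_ge0// mulrC.
Qed.

Lemma kernel_decay_weaken C N N' phi k : (N' <= N)%N -> 0 <= C ->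
  kernel_decay C N phi k -> kernel_decay C N' phi k.
Proof.
move=> NN C0 h y; have [i h1 h2] := h y; exists i => //; apply: le_trans h2 _.
rewrite ler_wpM2l ?mulr_ge0 ?exprn_ge0// lef_pV2 ?posrE ?exp2_gt0//.
by rewrite ler_eXn2l ?ltr1n// leq_mul2r NN orbT.
Qed.

Section Dilation.
Variables (eta : R -> R) (K : R) (N : nat).
Hypotheses (deta : forall x, derivable eta x 1).
Hypotheses (b0 : forall x, `|eta x| <= K) (bN : forall x, `|x| ^+ N * `|eta x| <= K).
Hypotheses (d0 : forall x, `|derive1 eta x| <= K) (dN : forall x, `|x| ^+ N * `|derive1 eta x| <= K).

Definition dilate k (y : R) : R := 2 ^+ k * eta (2 ^+ k * y).

Let K0 : 0 <= K. Proof. exact: le_trans (b0 0). Qed.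

Lemma continuous_schwartz : continuous eta.
Proof. by move=> x; apply/differentiable_continuous; apply/derivable1_diffP. Qed.

Lemma measurable_schwartz : measurable_fun setT eta.
Proof. by apply: continuous_measurable_fun; exact: continuous_schwartz. Qed.

(** The factor $2^{k+1} = 2 \cdot 2^k$ accounts for a constant 2; the 4 is the one of
    [dilate_diff_decay], since [bump] asks for a common constant. *)
Lemma dilate_decay k : kernel_decay (4 * 6 ^+ N * K) N (dilate k.+1) k.
Proof.
move=> y; have [i [h1 h2]] := dyadic_scale (2 ^+ k.+1 * y); exists i.
  rewrite ler_pdivlMr ?exp2_gt0//; apply: le_trans h1.
  rewrite normrM ger0_norm ?exprn_ge0// exprS mulrC -mulrA.
  by rewrite ler_peMl ?mulr_ge0 ?exprn_ge0// ler1n.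
rewrite /dilate normrM ger0_norm ?exprn_ge0//.
apply: (@le_trans _ _ (2 ^+ k.+1 * (6 ^+ N * K * 2 ^- (N * i)))).
  rewrite ler_wpM2l ?exprn_ge0//; apply: (moment_decay h2 _ (b0 _) (bN _)).
  by rewrite lerDl.
rewrite exprS.
have -> : 4 * 6 ^+ N * K * 2 ^+ k * 2 ^- (N * i) =
   2 * (2 * 2 ^+ k * (6 ^+ N * K * 2 ^- (N * i))) by ring.
rewrite ler_peMl ?ler1n//.
by rewrite !mulr_ge0 ?exprn_ge0// ltW// expN2_gt0.
Qed.

Lemma schwartz_mvt t s : exists2 xi, `|xi - t| <= `|s| & eta (t + s) - eta t = derive1 eta xi * s.
Proof.
have cont a b : {within `[a, b], continuous eta}.
  by apply: continuous_subspaceT; exact: continuous_schwartz.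
have dd (x : R) : is_derive x (1 : R) eta (derive1 eta x).
  by rewrite derive1E; apply: DeriveDef.
have [s0|s0] := leP 0 s.
- have ts : t <= t + s by rewrite lerDl.
  have [xi + e] := MVT_segment ts (fun x _ => dd x) (cont _ _).
  rewrite in_itv/= => /andP[x1 x2]; exists xi; last by rewrite e addrAC subrr add0r.
  by rewrite !ger0_norm ?subr_ge0//; lra.
- have ts : t + s <= t by lra.
  have [xi + e] := MVT_segment ts (fun x _ => dd x) (cont _ _).
  rewrite in_itv/= => /andP[x1 x2]; exists xi.
    by rewrite ler0_norm ?ltr0_norm//; lra.
  by rewrite -opprB e; ring.
Qed.

(** By the mean value theorem the increment is $2^{k+1} \eta'(\xi) \cdot 2^{k+1} \tau$ with
    $|2^{k+1} \tau| \le 2 \cdot 2^{-m}$. In particular $\xi$ is within 2 of $2^{k+1} y$, as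
    [moment_decay] allows. *)
Lemma dilate_diff_decay k m tau : `|tau| <= 2 ^- (k + m) ->
  kernel_decay (4 * 6 ^+ N * K * 2 ^- m) N (fun y => dilate k.+1 (y + tau) - dilate k.+1 y) k.
Proof.
move=> ht y; have [i [h1 h2]] := dyadic_scale (2 ^+ k.+1 * y); exists i.
  rewrite ler_pdivlMr ?exp2_gt0//; apply: le_trans h1.
  rewrite normrM ger0_norm ?exprn_ge0// exprS mulrC -mulrA.
  by rewrite ler_peMl ?mulr_ge0 ?exprn_ge0// ler1n.
have [xi hxi e] := schwartz_mvt (2 ^+ k.+1 * y) (2 ^+ k.+1 * tau).
have sm : `|2 ^+ k.+1 * tau| <= 2 * 2 ^- m.
  rewrite normrM ger0_norm ?exprn_ge0//.
  apply: (@le_trans _ _ (2 ^+ k.+1 * 2 ^- (k + m))); first by rewrite ler_wpM2l ?exprn_ge0.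
  apply: eq_ler; rewrite exprS exprD; field.
  by rewrite ?gt_eqF ?exp2_gt0.
rewrite /dilate mulrDr -mulrBr e !normrM.
have Vxi : `|derive1 eta xi| <= 6 ^+ N * K * 2 ^- (N * i).
  apply: (moment_decay h2 _ (d0 _) (dN _)).
  have := expN2_le1 R m; have := ler_normD xi (2 ^+ k.+1 * y - xi).
  by rewrite addrC subrK distrC; lra.
rewrite -normrM [ `|2 ^+ k.+1|]ger0_norm ?exprn_ge0//.
apply: (@le_trans _ _ (2 ^+ k.+1 * (6 ^+ N * K * 2 ^- (N * i) * (2 * 2 ^- m)))).
  by rewrite ler_wpM2l ?exprn_ge0// ler_pM.
by rewrite exprS; apply: eq_ler; ring.
Qed.

Lemma integral_dilate k : \int[mu]_y dilate k y = \int[mu]_y eta y.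
Proof.
have a0 := exp2_gt0 R k; set a := 2 ^+ k in a0 *.
have aE : (0 <= a%:E)%E by rewrite lee_fin ltW.
have me : measurable_fun setT (fun y : R => (eta y)%:E) by apply/measurable_EFinP; exact: measurable_schwartz.
have mea : measurable_fun setT (fun y : R => (eta (a * y))%:E).
  by apply: (measurableT_comp me); exact: measurable_funM.
rewrite /Rintegral; congr fine.
rewrite integralE [RHS]integralE; congr (_ - _)%E.
- rewrite (ge0_integral_affine 0 a0 (measurable_funepos me) (funepos_ge0 _)).
  rewrite -ge0_integralZl//.
    apply: eq_integral => y _; rewrite !funeposE /dilate -/a addr0 EFinM.
    by rewrite -[X in maxe _ X](mule0 a%:E) maxe_pMr.
  by apply: (measurableT_comp (measurable_funepos me)); apply: measurable_funD => //; exact: measurable_funM.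
- rewrite (ge0_integral_affine 0 a0 (measurable_funeneg me) (funeneg_ge0 _)).
  rewrite -ge0_integralZl//.
    apply: eq_integral => y _; rewrite !funenegE /dilate -/a addr0 EFinM -muleN.
    by rewrite -[X in maxe _ X](mule0 a%:E) maxe_pMr.
  by apply: (measurableT_comp (measurable_funeneg me)); apply: measurable_funD => //; exact: measurable_funM.
Qed.

Lemma measurable_dilate k : measurable_fun setT (dilate k).
Proof.
apply: measurable_funM => //; apply: (measurableT_comp measurable_schwartz).
exact: measurable_funM.
Qed.

Lemma bump_dilate k N' : (N' <= N)%N -> \int[mu]_y eta y = 0 ->
  bump (4 * 6 ^+ N * K) N' (dilate k.+1) k.
Proof.
move=> NN I0.
have C0 : 0 <= 4 * 6 ^+ N * K by rewrite !mulr_ge0// exprn_ge0.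
split=> //.
- exact: measurable_dilate.
- by apply: kernel_decay_weaken NN C0 _; exact: dilate_decay.
- move=> m tau ht; apply: (kernel_decay_weaken NN).
    by rewrite mulr_ge0// ltW// expN2_gt0.
  exact: dilate_diff_decay.
- by rewrite integral_dilate.
Qed.

End Dilation.

End Schwartz.

(** * From nonnegative functions and real kernels to complex ones *)

Section ComplexAssembly.
Variable R : realType.
Local Notation mu := (@lebesgue_measure R).
Local Notation normc := (@ComplexField.Normc.normc R).
Implicit Types (r A M p : R).

Lemma normc_sqr (z : R[i]) : normc z ^+ 2 = complex.Re z ^+ 2 + complex.Im z ^+ 2.
Proof. by case: z => a b; rewrite /= sqr_sqrtr// addr_ge0// sqr_ge0. Qed.

Lemma normc_ge0 (z : R[i]) : 0 <= normc z.
Proof. by case: z => a b; exact: sqrtr_ge0. Qed.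

Lemma Re_le_normc (z : R[i]) : `|complex.Re z| <= normc z.
Proof.
rewrite -(@ler_sqr _ `|_|) ?nnegrE ?normc_ge0// normc_sqr real_normK ?num_real//.
by rewrite lerDl sqr_ge0.
Qed.

Lemma Im_le_normc (z : R[i]) : `|complex.Im z| <= normc z.
Proof.
rewrite -(@ler_sqr _ `|_|) ?nnegrE ?normc_ge0// normc_sqr real_normK ?num_real//.
by rewrite lerDr sqr_ge0.
Qed.

Lemma ReMc (z w : R[i]) :
  complex.Re (z * w) = complex.Re z * complex.Re w - complex.Im z * complex.Im w.
Proof. by case: z => a b; case: w. Qed.

Lemma ImMc (z w : R[i]) :
  complex.Im (z * w) = complex.Re z * complex.Im w + complex.Im z * complex.Re w.
Proof. by case: z => a b; case: w. Qed.

(** Used with $r = p/2$ and [T] a sum of squares: it bounds by [A] the [p]-th power of the Stepanov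
    norm of the square root of [T]. *)
Definition local_power_bound r (T : R -> \bar R) A := [/\ measurable_fun setT T,
  (forall x, 0 <= T x)%E &
  forall x0, (\int[mu]_(x in `[x0, (x0 + 1)%R]) (T x `^ r) <= A%:E)%E].

Lemma poweR_add_le (x y : \bar R) r : (0 <= x)%E -> (0 <= y)%E -> 0 < r ->
  ((x + y) `^ r <= (2 `^ r)%:E * (x `^ r + y `^ r))%E.
Proof.
move=> x0 y0 r0.
have aux (a b : \bar R) : (0 <= a)%E -> (a <= b)%E ->
    ((a + b) `^ r <= (2 `^ r)%:E * (a `^ r + b `^ r))%E.
  move=> a0 ab; have b0 := le_trans a0 ab.
  apply: (@le_trans _ _ ((2%:E * b) `^ r)%E).
    apply: lee_poweR; [exact: ltW|exact: adde_ge0|].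
    by rewrite mule_natl mule2n leeD.
  rewrite poweRM// poweR_EFin; apply: lee_wpmul2l; first by rewrite lee_fin powR_ge0.
  by rewrite leeDr// poweR_ge0.
have [h|h] := leP x y; first exact: aux.
by rewrite addeC [(x `^ r + _)%E]addeC; apply: aux => //; exact: ltW.
Qed.

Lemma local_power_boundD r T T' A A' : 0 < r -> local_power_bound r T A -> local_power_bound r T' A' ->
  local_power_bound r (fun x => T x + T' x)%E (2 `^ r * (A + A')).
Proof.
move=> r0 [mT T0 TA] [mT' T0' TA']; split.
- exact: emeasurable_funD.
- by move=> x; exact: adde_ge0.
move=> x0.
have mTr : measurable_fun setT (fun x => T x `^ r)%E by exact: (measurableT_comp (measurable_poweR r)).
have mTr' : measurable_fun setT (fun x => T' x `^ r)%E by exact: (measurableT_comp (measurable_poweR r)).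
apply: (@le_trans _ _ (\int[mu]_(x in `[x0, (x0 + 1)%R]) ((2 `^ r)%:E * (T x `^ r + T' x `^ r)))%E).
  by apply: nneg_le_integral => x _; [exact: poweR_ge0|exact: poweR_add_le].
rewrite ge0_integralZl ?lee_fin ?powR_ge0//; last 2 first.
- by apply: emeasurable_funD; [exact: measurable_funS mTr|exact: measurable_funS mTr'].
- by move=> x _; rewrite adde_ge0// poweR_ge0.
rewrite EFinM; apply: lee_wpmul2l; first by rewrite lee_fin powR_ge0.
rewrite ge0_integralD//; last 4 first.
- by move=> x _; exact: poweR_ge0.
- exact: measurable_funS mTr.
- by move=> x _; exact: poweR_ge0.
- exact: measurable_funS mTr'.
by rewrite EFinD; apply: leeD.
Qed.

Lemma local_power_bound_le r T T' A c : 0 < r -> 0 <= c -> (forall x, 0 <= T' x)%E ->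
  (forall x, T' x <= c%:E * T x)%E -> local_power_bound r T A ->
  forall x0, (\int[mu]_(x in `[x0, (x0 + 1)%R]) (T' x `^ r) <= (c `^ r * A)%:E)%E.
Proof.
move=> r0 c0 T0' TT [mT T0 TA] x0.
have mTr : measurable_fun setT (fun x => T x `^ r)%E by exact: (measurableT_comp (measurable_poweR r)).
apply: (@le_trans _ _ (\int[mu]_(x in `[x0, (x0 + 1)%R]) ((c `^ r)%:E * T x `^ r))%E).
  apply: nneg_le_integral => x _; first exact: poweR_ge0.
  by rewrite -poweR_EFin -poweRM ?lee_fin//; apply: lee_poweR => //; exact: ltW.
rewrite ge0_integralZl ?lee_fin ?powR_ge0//; last 2 first.
- exact: measurable_funS mTr.
- by move=> x _; exact: poweR_ge0.
by rewrite EFinM; apply: lee_wpmul2l => //; rewrite lee_fin powR_ge0.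
Qed.

Lemma pos_part_sub (g : R -> R) y : g y = pos_part g y - pos_part (fun z => - g z) y.
Proof. by rewrite /pos_part; case: (ltP (g y) 0); case: (ltP (- g y) 0); lra. Qed.

Section Kernel.
Variables (C : R) (phi : R -> R) (k : nat) (g : R -> R) (L L' : R).
Hypotheses (bphi : bump C 5 phi k).
Hypotheses (gL : unit_bounded L (pos_part g)) (gL' : unit_bounded L' (pos_part (fun y => - g y))).

Lemma signed_conv_integrable x : mu.-integrable setT (EFin \o (fun y => g (x - y) * phi y)).
Proof.
have [mphi C0 d _ _] := bphi.
have i1 := conv_integrable mphi C0 (n := 4) isT d gL x.
have i2 := conv_integrable mphi C0 (n := 4) isT d gL' x.
have := integrableB measurableT i1 i2; apply: eq_integrable => // y _ /=.
by rewrite -EFinB -mulrBl -pos_part_sub.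
Qed.

Lemma conv_pos_part x :
  conv g phi x = conv (pos_part g) phi x - conv (pos_part (fun y => - g y)) phi x.
Proof.
have [mphi C0 d _ _] := bphi.
have i1 := conv_integrable mphi C0 (n := 4) isT d gL x.
have i2 := conv_integrable mphi C0 (n := 4) isT d gL' x.
rewrite /conv -RintegralB//; apply: eq_Rintegral => y _.
by rewrite -mulrBl -pos_part_sub.
Qed.

End Kernel.

Lemma sqr_sum4_le (a b c d : R) :
  (a - b - (c - d)) ^+ 2 <= 4 * (a ^+ 2 + b ^+ 2 + (c ^+ 2 + d ^+ 2)).
Proof.
have := sqr_ge0 (a + b); have := sqr_ge0 (a + c); have := sqr_ge0 (a - d).
have := sqr_ge0 (b - c); have := sqr_ge0 (b + d); have := sqr_ge0 (c + d).
rewrite !expr2; lra.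
Qed.

Section Convolution.
Variables (psi : R -> R[i]) (C : R).
Let phiR k := dilate (fun y => complex.Re (psi y)) k.+1.
Let phiI k := dilate (fun y => complex.Im (psi y)) k.+1.
Hypotheses (bR : forall k, bump C 5 (phiR k) k) (bI : forall k, bump C 5 (phiI k) k).
Variables (f : R -> R[i]) (L : R).
Let f1 y := complex.Re (f y).
Let f2 y := complex.Im (f y).
Hypotheses (f1L : unit_bounded L (pos_part f1)) (f1L' : unit_bounded L (pos_part (fun y => - f1 y))).
Hypotheses (f2L : unit_bounded L (pos_part f2)) (f2L' : unit_bounded L (pos_part (fun y => - f2 y))).

(** The real and the imaginary part are signed sums of four convolutions of a nonnegative function
    with a real kernel; the 4 is Cauchy-Schwarz for four terms. *)
Lemma convolution_sqr_le k x :
  normc (convolution f (dyadic_dilation psi k.+1) x) ^+ 2 <=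
  4 * ((conv (pos_part f1) (phiR k) x ^+ 2 + conv (pos_part (fun y => - f1 y)) (phiR k) x ^+ 2 +
       (conv (pos_part f2) (phiI k) x ^+ 2 + conv (pos_part (fun y => - f2 y)) (phiI k) x ^+ 2)) +
      (conv (pos_part f1) (phiI k) x ^+ 2 + conv (pos_part (fun y => - f1 y)) (phiI k) x ^+ 2 +
       (conv (pos_part f2) (phiR k) x ^+ 2 + conv (pos_part (fun y => - f2 y)) (phiR k) x ^+ 2))).
Proof.
have dR y : complex.Re (dyadic_dilation psi k.+1 y) = phiR k y.
  by rewrite /dyadic_dilation ReMc /= mul0r subr0.
have dI y : complex.Im (dyadic_dilation psi k.+1 y) = phiI k y.
  by rewrite /dyadic_dilation ImMc /= mul0r addr0.
rewrite normc_sqr mulrDr; apply: lerD.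
- apply: le_trans (sqr_sum4_le _ _ _ _).
  rewrite -(conv_pos_part (bR k) f1L f1L') -(conv_pos_part (bI k) f2L f2L').
  rewrite /convolution /cintegral /= /conv -RintegralB//; last 2 first.
  + exact: signed_conv_integrable (bR k) f1L f1L' x.
  + exact: signed_conv_integrable (bI k) f2L f2L' x.
  apply: eq_ler; congr (_ ^+ 2).
  by apply: eq_Rintegral => y _; rewrite ReMc dR dI.
(* In the imaginary part the two products are added, so the last two terms are negated to fit
   [sqr_sum4_le]. *)
- have := sqr_sum4_le (conv (pos_part f1) (phiI k) x) (conv (pos_part (fun y => - f1 y)) (phiI k) x)
    (- conv (pos_part f2) (phiR k) x) (- conv (pos_part (fun y => - f2 y)) (phiR k) x).
  rewrite !sqrrN -opprD opprK; apply: le_trans.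
  rewrite -(conv_pos_part (bI k) f1L f1L') -(conv_pos_part (bR k) f2L f2L').
  rewrite /convolution /cintegral /= /conv -RintegralD//; last 2 first.
  + exact: signed_conv_integrable (bI k) f1L f1L' x.
  + exact: signed_conv_integrable (bR k) f2L f2L' x.
  apply: eq_ler; congr (_ ^+ 2).
  by apply: eq_Rintegral => y _; rewrite ImMc dR dI.
Qed.

Lemma square_function_le x :
  (\sum_(1 <= k <oo) cmod (convolution f (dyadic_dilation psi k)) x ^+ 2 <=
   4%:E * (((sqfun phiR (pos_part f1) x + sqfun phiR (pos_part (fun y => - f1 y)%R) x) +
       (sqfun phiI (pos_part f2) x + sqfun phiI (pos_part (fun y => - f2 y)%R) x)) +
      ((sqfun phiI (pos_part f1) x + sqfun phiI (pos_part (fun y => - f1 y)%R) x) +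
       (sqfun phiR (pos_part f2) x + sqfun phiR (pos_part (fun y => - f2 y)%R) x))))%E.
Proof.
have sq0 (a : R) : (0 <= (a ^+ 2)%:E)%E by rewrite lee_fin sqr_ge0.
have D (u v : nat -> \bar R) : (forall k, 0 <= u k)%E -> (forall k, 0 <= v k)%E ->
    (\sum_(k <oo) u k + \sum_(k <oo) v k = \sum_(k <oo) (u k + v k))%E.
  by move=> u0 v0; rewrite nneseriesD.
rewrite /sqfun !D; try by move=> k; do ?[apply: adde_ge0].
rewrite -nneseriesZl; last by move=> k _; do ?[apply: adde_ge0].
(* The scales of the square function start at 1; the shift by one matches [phiR k] and [phiI k],
   which are dilations of index $k+1$. *)
rewrite -(@nneseries_addn _ (fun k => cmod (convolution f (dyadic_dilation psi k)) x ^+ 2)%E 1); last first.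
  by move=> k; rewrite /cmod -EFin_expe.
apply: lee_nneseries => k _; first by move=> _; rewrite /cmod -EFin_expe.
rewrite addn1 /cmod -EFin_expe -!EFinD -EFinM lee_fin; exact: convolution_sqr_le.
Qed.

End Convolution.

(** [K] dominates [psi] and its derivative, also after multiplication by $|x|^6$; six is the $n+2$
    powers of decay in the pointwise bound with $n = 4$. The condition at frequency 0 says that both
    parts of [psi] have integral zero. *)
Lemma schwartz_kernel (psi : R -> R[i]) : schwartz psi -> fourier psi 0 = 0 ->
  exists2 C : R, 0 <= C & forall k,
    [/\ bump C 5 (dilate (fun y => complex.Re (psi y)) k.+1) k,
        kernel_decay C 6 (dilate (fun y => complex.Re (psi y)) k.+1) k,
        bump C 5 (dilate (fun y => complex.Im (psi y)) k.+1) k &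
        kernel_decay C 6 (dilate (fun y => complex.Im (psi y)) k.+1) k].
Proof.
move=> [smooth decay] psi0.
have E : (fun y => psi y * cexpi (- (y * 0))) = psi.
  by apply/funext => y; rewrite mulr0 oppr0 /cexpi cos0 sin0 mulr1.
have [IR II] : \int[mu]_y complex.Re (psi y) = 0 /\ \int[mu]_y complex.Im (psi y) = 0.
  by move: psi0; rewrite /fourier E /cintegral => -[].
have [C00 D00] := decay 0%N 0%N; have [C60 D60] := decay 6%N 0%N.
have [C01 D01] := decay 0%N 1%N; have [C61 D61] := decay 6%N 1%N.
have pos m n c : (forall x : R, `|x| ^+ m * normc (cderiven n psi x) <= c) -> 0 <= c.
  by move=> /(_ 0); apply: le_trans; rewrite mulr_ge0 ?exprn_ge0 ?normc_ge0.
have p00 := pos _ _ _ D00; have p60 := pos _ _ _ D60.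
have p01 := pos _ _ _ D01; have p61 := pos _ _ _ D61.
pose K := C00 + C60 + (C01 + C61).
have bound (part : R[i] -> R) m n c : (forall z, `|part z| <= normc z) ->
    (forall x : R, `|x| ^+ m * normc (cderiven n psi x) <= c) -> c <= K ->
    forall x, `|x| ^+ m * `|part (cderiven n psi x)| <= K.
  move=> hp h cK x; apply: le_trans cK; apply: le_trans (h x).
  by rewrite ler_wpM2l ?exprn_ge0.
have kR := bound _ _ _ _ Re_le_normc; have kI := bound _ _ _ _ Im_le_normc.
exists (4 * 6 ^+ 6 * K); first by rewrite !mulr_ge0 ?exprn_ge0// /K !addr_ge0.
have zero (h : R -> R) : (forall x, `|x| ^+ 0 * `|h x| <= K) -> forall x, `|h x| <= K.
  by move=> hh x; have := hh x; rewrite expr0 mul1r.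
have K00 : C00 <= K by rewrite /K; lra.
have K60 : C60 <= K by rewrite /K; lra.
have K01 : C01 <= K by rewrite /K; lra.
have K61 : C61 <= K by rewrite /K; lra.
have dR x := (smooth 0%N x).1; have dI x := (smooth 0%N x).2.
have R0 := zero _ (kR _ _ _ D00 K00); have R6 := kR _ _ _ D60 K60.
have R0' := zero _ (kR _ _ _ D01 K01); have R6' := kR _ _ _ D61 K61.
have I0 := zero _ (kI _ _ _ D00 K00); have I6 := kI _ _ _ D60 K60.
have I0' := zero _ (kI _ _ _ D01 K01); have I6' := kI _ _ _ D61 K61.
move=> k; split.
- exact: bump_dilate dR R0 R6 R0' R6' k _ _ IR.
- exact: dilate_decay R0 R6 k.
- exact: bump_dilate dI I0 I6 I0' I6' k _ _ II.
- exact: dilate_decay I0 I6 k.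
Qed.

End ComplexAssembly.

(** * The Stepanov inequality *)

Theorem theorem4p2 (R : realType) (psi : R -> R[i]) (p : R) :
  schwartz psi -> fourier psi 0 = 0 -> 1 < p ->
  exists C : R, forall f : R -> R[i], stepanov_space p f ->
    (stepanov_norm p (square_function psi f)
       <= C%:E * stepanov_norm p (cmod f))%E.
Proof.
move=> spsi psi0 p1; have p0 : 0 < p by lra.
have r0 : 0 < p / 2 by lra.
have [C C0 hk] := schwartz_kernel spsi psi0.
pose phiR k := dilate (fun y => complex.Re (psi y)) k.+1.
pose phiI k := dilate (fun y => complex.Im (psi y)) k.+1.
have bR k : bump C 5 (phiR k) k by have [] := hk k.
have dR k : kernel_decay C 6 (phiR k) k by have [] := hk k.
have bI k : bump C 5 (phiI k) k by have [] := hk k.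
have dI k : kernel_decay C 6 (phiI k) k by have [] := hk k.
have [AR AR0 HR] := integral_sqfun bR dR p1.
have [AI AI0 HI] := integral_sqfun bI dI p1.
pose q : R := 2 `^ (p / 2).
have q0 : 0 <= q by exact: powR_ge0.
(* Three nested uses of [local_power_boundD] produce the three factors [q], and $4^{p/2}$ comes from
   [square_function_le]. *)
pose B : R := 4 `^ (p / 2) *
  (q * (q * (q * (AR + AR) + q * (AI + AI)) + q * (q * (AI + AI) + q * (AR + AR)))).
have B0 : 0 <= B.
  by apply: mulr_ge0; [exact: powR_ge0|rewrite !(mulr_ge0, addr_ge0)].
(* The summand 1 keeps the constant positive, so that the right-hand side is
   infinite whenever the norm of [f] is. *)
exists (B `^ p^-1 + 1) => f [[mf1 mf2] _].
pose S := ereal_sup [set (\int[@lebesgue_measure R]_(s in `[x, (x + 1)%R]) (`|cmod f s| `^ p))%E | x in [set: R]].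
have SE : stepanov_norm p (cmod f) = (S `^ p^-1)%E by [].
have I0 (x : R) : (0 <= \int[@lebesgue_measure R]_(s in `[x, (x + 1)%R]) (`|cmod f s| `^ p))%E.
  by apply: integral_ge0 => s _; exact: poweR_ge0.
have Sx (x : R) : (\int[@lebesgue_measure R]_(s in `[x, (x + 1)%R]) (`|cmod f s| `^ p) <= S)%E.
  by apply: ereal_sup_ubound; exists x.
have S0 : (0 <= S)%E by apply: le_trans (Sx 0).
have BC : 0 <= B `^ p^-1 by exact: powR_ge0.
rewrite SE; case: (ltP S +oo)%E => [Sfin|]; last first.
  rewrite leye_eq => /eqP ->; rewrite poweRyr ?invr_eq0 ?gt_eqF//.
  by rewrite gt0_muley ?leey// lte_fin; lra.
have [M SM] : exists M, S = M%:E by exists (fine S); rewrite fineK// ge0_fin_numE.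
have M0 : 0 <= M by rewrite -lee_fin -SM.
pose f1 y := complex.Re (f y); pose f2 y := complex.Im (f y).
(* The positive parts are dominated by [cmod f] and so inherit its local bound [M], the [p]-th power
   of the Stepanov norm. *)
have bound (g : R -> R) : measurable_fun setT g -> (forall y, `|g y| <= ComplexField.Normc.normc (f y)) ->
    [/\ measurable_fun setT (pos_part g), (forall y, 0 <= pos_part g y) &
    forall x, (\int[@lebesgue_measure R]_(y in `[x, (x + 1)%R]) (pos_part g y `^ p)%:E <= M%:E)%E].
  move=> mg gf; split; [exact: measurable_pos_part|by move=> y; exact: pos_part_ge0|move=> x].
  rewrite -SM; apply: le_trans (Sx x); apply: nneg_le_integral => y _.
    by rewrite lee_fin powR_ge0.
  rewrite -poweR_EFin; apply: lee_poweR; rewrite ?(ltW p0)// ?lee_fin ?pos_part_ge0//.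
  rewrite ger0_norm ?normc_ge0//.
  by apply: le_trans (gf y); exact: pos_part_le_norm.
have mN (g : R -> R) : measurable_fun setT g -> measurable_fun setT (fun y => - g y).
  by move=> mg; exact: measurableT_comp.
have [m1 u1 b1] := bound f1 mf1 (fun y => Re_le_normc (f y)).
have [||m1' u1' b1'] := bound (fun y => - f1 y); first exact: mN.
  by move=> y; rewrite normrN; exact: Re_le_normc.
have [m2 u2 b2] := bound f2 mf2 (fun y => Im_le_normc (f y)).
have [||m2' u2' b2'] := bound (fun y => - f2 y); first exact: mN.
  by move=> y; rewrite normrN; exact: Im_le_normc.
have L1 := unit_bounded_of_Lp p1 m1 u1 b1.
have L1' := unit_bounded_of_Lp p1 m1' u1' b1'.
have L2 := unit_bounded_of_Lp p1 m2 u2 b2.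
have L2' := unit_bounded_of_Lp p1 m2' u2' b2'.
have sq0 phi (g : R -> R) x : (0 <= sqfun phi g x)%E.
  by apply: nneseries_ge0 => k _ _; rewrite lee_fin sqr_ge0.
have QR (g : R -> R) : measurable_fun setT g -> (forall y, 0 <= g y) ->
    (forall x, \int[@lebesgue_measure R]_(y in `[x, (x + 1)%R]) (g y `^ p)%:E <= M%:E)%E ->
    local_power_bound (p / 2) (sqfun phiR g) (AR * M).
  move=> mg g0 gM; split; [|by move=> x; exact: sq0|by move=> x0; exact: HR].
  exact: measurable_sqfun bR _ _ (unit_bounded_of_Lp p1 mg g0 gM).
have QI (g : R -> R) : measurable_fun setT g -> (forall y, 0 <= g y) ->
    (forall x, \int[@lebesgue_measure R]_(y in `[x, (x + 1)%R]) (g y `^ p)%:E <= M%:E)%E ->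
    local_power_bound (p / 2) (sqfun phiI g) (AI * M).
  move=> mg g0 gM; split; [|by move=> x; exact: sq0|by move=> x0; exact: HI].
  exact: measurable_sqfun bI _ _ (unit_bounded_of_Lp p1 mg g0 gM).
have Q := local_power_boundD r0
  (local_power_boundD r0
    (local_power_boundD r0 (QR _ m1 u1 b1) (QR _ m1' u1' b1'))
    (local_power_boundD r0 (QI _ m2 u2 b2) (QI _ m2' u2' b2')))
  (local_power_boundD r0
    (local_power_boundD r0 (QI _ m1 u1 b1) (QI _ m1' u1' b1'))
    (local_power_boundD r0 (QR _ m2 u2 b2) (QR _ m2' u2' b2'))).
pose T (x : R) := (\sum_(1 <= k <oo) cmod (convolution f (dyadic_dilation psi k)) x ^+ 2)%E.
have T0 x : (0 <= T x)%E.
  by apply: nneseries_ge0 => k _ _; rewrite /cmod -EFin_expe lee_fin sqr_ge0.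
have c4 : 0 <= 4 :> R by [].
have F := local_power_bound_le r0 c4 T0
  (square_function_le bR bI L1 L1' L2 L2') Q.
have sup : (stepanov_norm p (square_function psi f) <= (B * M)%:E `^ p^-1)%E.
  apply: lee_poweR; first by rewrite invr_ge0 ltW.
    apply: le_trans (ereal_sup_ubound _); last by exists 0.
    by apply: integral_ge0 => s _; exact: poweR_ge0.
  apply: ub_ereal_sup => _ [x _ <-].
  have -> : (B * M)%:E = (4 `^ (p / 2) * (q * (q * (q * (AR * M + AR * M) + q * (AI * M + AI * M))
     + q * (q * (AI * M + AI * M) + q * (AR * M + AR * M)))))%:E.
    by congr EFin; rewrite /B; ring.
  apply: le_trans (F x); apply: eq_ler.
  (* The [p]-th power of the square root is the power $p/2$ of the sum of squares. *)
  apply: eq_integral => s _; rewrite gee0_abs ?poweR_ge0//.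
  by rewrite /square_function -poweRrM; congr (_ `^ _)%E; rewrite mulrC.
apply: le_trans sup _; rewrite SM !poweR_EFin -EFinM lee_fin powRM//.
by rewrite ler_wpM2r ?powR_ge0// lerDl.
Qed.
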